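(* Fix $q\in[0,1)$. Let $(\Pi_n)_{n\in\mathbb{N}}$ be the Mallows permutations coupled through the infinite Bernoulli model (so that each $\Pi_n$ is $\pi_{n,q}$-distributed), and let $\mathcal{Y}_q=(o,Y_q)$ be the rooted redwood Mallows tree defined in the context. Then $\mathrm{BST}(\Pi_n)$ converges locally almost surely to $\mathcal{Y}_q$, i.e. for every integer $r\ge1$ and every finite rooted graph $H$, $$\frac{1}{n}\sum_{v\in \mathrm{BST}(\Pi_n)}\mathbb{1}\{B_r(v,\mathrm{BST}(\Pi_n))\equiv H\}\longrightarrow \mathbb{P}\big(B_r(o,Y_q)\equiv H\big)\quad\text{almost surely as } n\to\infty.$$
   Context: Mallows distribution: for $q\in[0,1)$ and $n\in\mathbb{N}$, $\pi_{n,q}(\sigma)=q^{\mathrm{Inv}(\sigma)}/Z_{n,q}$ on the symmetric group $S_n$, where $\mathrm{Inv}(\sigma)=|\{i<j:\sigma(i)>\sigma(j)\}|$, $Z_{n,q}$ is the normalizing constant, and $0^0=1$. Infinite Bernoulli model: let $(B_{i,j})_{i,j\ge1}$ be independent Bernoulli$(1-q)$ variables and recursively $I_i=\min\{j\notin\{I_1,\dots,I_{i-1}\}:B_{i,j}=1\}$. For $n\in\mathbb{N}$, $\Pi_n$ is the permutation of $\{1,\dots,n\}$ recording the relative order of $(I_1,\dots,I_n)$ (i.e. $\Pi_n(i)=|\{j\le n:I_j\le I_i\}|$); it is $\pi_{n,q}$-distributed. $(I_1,I_2,\dots)$ is a permutation of $\mathbb{N}$, called the (one-sided) Mallows permutation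 on $\mathbb{N}$ with parameter $q$. Binary trees: $\mathbb{T}$ is the set of finite words over $\{0,1\}$ including the empty word $\varnothing$; for a set $S$ of words and a word $a$, $aS=\{aw:w\in S\}$. For a finite sequence $x=(x_1,\dots,x_n)$ of distinct numbers, $\mathrm{BST}(x)=\emptyset$ if $n=0$, and otherwise $\mathrm{BST}(x)=\{\varnothing\}\cup 0\,\mathrm{BST}(x_-)\cup 1\,\mathrm{BST}(x_+)$, where $x_-$ (resp. $x_+$) is the subsequence of entries smaller (resp. larger) than $x_1$ in their original order. For infinite $x$, $\mathrm{BST}(x)=\bigcup_n\mathrm{BST}(x_1,\dots,x_n)$. For a permutation $\sigma$, $\mathrm{BST}(\sigma)=\mathrm{BST}(\sigma(1),\sigma(2),\dots)$. A subset of $\mathbb{T}$ is a graph with edges $\{w,w0\},\{w,w1\}$ between its elements. Extended tree: add a letter $\Upsilon$ and use the convention $1^k=$ the word $1\cdots1$ ($k$ letters) if $k>0$, $1^0=\varnothing$, $1^k=\Upsilon^{|k|}$ if $k<0$. Let $\mathbb{Y}=\bigcup_{k\in\mathbb{Z}}(\{1^k\}\cup 1^k0\mathbb{T})$ and $\mathbb{T}_L=\{\varnothing\}\cup 0\mathbb{T}$. Subsets of $\mathbb{Y}$ are graphs with edges $\{1^k,1^{k+1}\}$ and $\{1^k,1^k0\}$ ($k\in\mathbb{Z}$), and $\{w,wa\}$ for $w\in 1^k0\mathbb{T}$, $a\in\{0,1\}$ (between elements of the subset). Redwood tree: an injective $\sigma:\mathbb{Z}\to\mathbb{Z}$ is admissible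 if $|\{i\in\mathbb{N}:\sigma(i)\notin\mathbb{N}\}|+|\{i\in\mathbb{Z}\setminus\mathbb{N}:\sigma(i)\in\mathbb{N}\}|<\infty$. A record index is $r$ with $\sigma(r)>\sigma(k)$ for all $k<r$. For admissible $\sigma$ the record indices form a two-sided infinite set; its standard record representation is the increasing enumeration $(r_k)_{k\in\mathbb{Z}}$ indexed so that $\sigma(r_0)\le0<\sigma(r_1)$. Let $\sigma[k]$ be the finite sequence of values $\sigma(i)$ with $\sigma(r_k)<\sigma(i)<\sigma(r_{k+1})$, in increasing order of $i$. The redwood tree is $\mathrm{RW}(\sigma)=\bigcup_{k\in\mathbb{Z}}\big(\{1^k\}\cup 1^k0\,\mathrm{BST}(\sigma[k])\big)\subseteq\mathbb{Y}$. Two-sided Mallows permutation: let $\Pi_+,\Pi_-$ be independent Mallows permutations on $\mathbb{N}$ with parameter $q$, and $(M_i)_{i\ge1}$ independent with $\mathbb{P}(M_i=m)=q^{im}(1-q^i)$, $m\ge0$. Let $\Lambda_1\ge\Lambda_2\ge\dots$ be the nonincreasing sequence of nonnegative integers with $|\{j:\Lambda_j=i\}|=M_i$ for all $i\ge1$ (eventually $0$). Set $\ell_i=i-\Lambda_i$ ($i\ge1$), and let $k_0>k_{-1}>k_{-2}>\dots$ enumerate $\mathbb{Z}\setminus\{\ell_i:i\ge1\}$. Define $\mathcal{X}_q(\ell_i)=\Pi_+(i)$ and $\mathcal{X}_q(k_i)=1-\Pi_-(1-i)$ for $i\le 0$. This is the two-sided infinite Mallows permutation of $\mathbb{Z}$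 (the unique $q$-invariant law); it is almost surely admissible. Let $Y_q=\mathrm{RW}(\mathcal{X}_q)$ and let $o$ be uniform on the (a.s. finite) set $Y_q\cap\mathbb{T}_L$; $\mathcal{Y}_q=(o,Y_q)$. Local notions: $B_r(v,G)$ is the subgraph of $G$ induced by vertices at graph distance at most $r$ from $v$, rooted at $v$; $\equiv$ denotes isomorphism of rooted graphs (root-preserving graph isomorphism). *)

(* Defs.v *)
From HB Require Import structures.
From mathcomp Require Import all_boot all_order all_algebra.
From mathcomp Require Import all_classical all_reals all_analysis.
Set Implicit Arguments. Unset Strict Implicit. Unset Printing Implicit Defensive.
Import Order.TTheory GRing.Theory Num.Theory.
Local Open Scope classical_set_scope.
Local Open Scope ring_scope.

Definition nat_rv_family {d} {Ω : measurableType d} {I : Type}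
  (X : I -> Ω -> nat) : Prop :=
  forall (i : I) (A : set nat), measurable (X i @^-1` A).

Definition mutually_independent {d} {Ω : measurableType d} {R : realType}
  {I : eqType} (P : probability Ω R) (X : I -> Ω -> nat) : Prop :=
  forall (J : seq I) (A : I -> set nat), uniq J ->
    P (\bigcap_(j in [set` J]) (X j @^-1` A j)) =
    (\prod_(j <- J) P (X j @^-1` A j))%E.

Definition bernoulli_law {d} {Ω : measurableType d} {R : realType}
  (P : probability Ω R) (p : R) (Z : Ω -> nat) : Prop :=
  P (Z @^-1` [set 1%N]) = p%:E /\ P (Z @^-1` [set 0%N]) = (1 - p)%:E.

(* Infinite Bernoulli model (indices i, j >= 1)                        *)

Definition first_free (bi : nat -> bool) (used : seq nat) : nat :=
  match pselect (exists j, [&& 0 < j, j \notin used & bi j]%N) with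
  | left H => ex_minn H
  | right _ => 0%N
  end.

Fixpoint Iseq (b : nat -> nat -> bool) (n : nat) : seq nat :=
  match n with
  | 0 => [::]
  | n'.+1 => let s := Iseq b n' in rcons s (first_free (b n) s)
  end.

(* I_i for i >= 1 : the Mallows permutation of N is i |-> I_i *)
Definition Ival (b : nat -> nat -> bool) (i : nat) : nat := last 0%N (Iseq b i).

Definition Pi_n (b : nat -> nat -> bool) (n : nat) : seq nat :=
  let s := Iseq b n in [seq count (fun y => y <= x)%N s | x <- s].

(* Binary search trees. Words over {0,1} are seq bool (0 = false).     *)

Fixpoint bst_aux (k : nat) (x : seq int) : seq (seq bool) :=
  match k, x with
  | 0, _ => [::]
  | _, [::] => [::]
  | k'.+1, a :: t =>
      [::] :: (map (cons false) (bst_aux k' [seq y <- t | y < a])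
               ++ map (cons true) (bst_aux k' [seq y <- t | a < y]))
  end.

Definition BST (x : seq int) : seq (seq bool) := bst_aux (size x) x.

Definition adjT (w u : seq bool) : Prop :=
  u = rcons w false \/ u = rcons w true \/ w = rcons u false \/ w = rcons u true.

Fixpoint within {X : Type} (S : X -> Prop) (adj : X -> X -> Prop)
  (n : nat) (v u : X) : Prop :=
  match n with
  | 0 => S v /\ u = v
  | n'.+1 => within S adj n' v u \/
             exists w, within S adj n' v w /\ S u /\ adj w u
  end.

Definition ball_iso {X : Type} (S : X -> Prop) (adj : X -> X -> Prop)
  (r : nat) (v : X) (V : finType) (e : rel V) (h : V) : Prop :=
  let B := within S adj r v in
  exists (f : X -> V) (g : V -> X),
    [/\ B v, f v = h,
        (forall u, B u -> g (f u) = u),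
        (forall x, B (g x) /\ f (g x) = x) &
        (forall u u', B u -> B u' -> (adj u u' <-> e (f u) (f u')))].

Definition is_Lambda (M L : nat -> nat) : Prop :=
  (forall j, (1 <= j)%N -> (L j.+1 <= L j)%N) /\
  exists N, (forall j, (N <= j)%N -> L j = 0%N) /\
            (forall i, (1 <= i)%N -> count (fun j => L j == i) (iota 1 N) = M i).

(* spec of X_q : with l_i = i - Lambda_i (i >= 1) and the decreasing
   enumeration k m = k_{-m} (m >= 0) of Z \ {l_i},
   X(l_i) = Pp i, X(k_{-m}) = 1 - Pm (1 + m) *)
Definition two_sided_spec (Pp Pm M : nat -> nat) (X : int -> int) : Prop :=
  exists (L : nat -> nat) (k : nat -> int),
    [/\ is_Lambda M L,
        (forall m, k m.+1 < k m),
        (forall z : int, (forall i, (1 <= i)%N -> (i%:Z - (L i)%:Z) != z)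
                         <-> exists m, k m = z),
        (forall i, (1 <= i)%N -> X (i%:Z - (L i)%:Z) = (Pp i)%:Z) &
        (forall m, X (k m) = 1 - (Pm (1 + m)%N)%:Z)].

Definition two_sided (Pp Pm M : nat -> nat) : int -> int :=
  match pselect (exists X, two_sided_spec Pp Pm M X) with
  | left H => proj1_sig (cid H)
  | right _ => fun _ => 0
  end.

Definition is_record (σ : int -> int) (r : int) : Prop :=
  forall k, k < r -> σ k < σ r.

Definition record_rep_spec (σ : int -> int) (rr : int -> int) : Prop :=
  [/\ (forall k, rr k < rr (k + 1)),
      (forall i, is_record σ i <-> exists k, rr k = i) &
      σ (rr 0) <= 0 < σ (rr 1)].

Definition record_rep (σ : int -> int) : int -> int :=
  match pselect (exists rr, record_rep_spec σ rr) with
  | left H => proj1_sig (cid H)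
  | right _ => fun _ => 0
  end.

Definition sigma_block_spec (σ : int -> int) (k : int) (s : seq int) : Prop :=
  let rr := record_rep σ in
  exists idx : seq int,
    [/\ sorted <%R idx,
        (forall i, i \in idx <-> (σ (rr k) < σ i < σ (rr (k + 1)))) &
        s = map σ idx].

Definition sigma_block (σ : int -> int) (k : int) : seq int :=
  match pselect (exists s, sigma_block_spec σ k s) with
  | left H => proj1_sig (cid H)
  | right _ => [::]
  end.

(* vertices of the extended tree Y: (k, None) = 1^k, (k, Some w) = 1^k 0 w *)
Definition Yvert := (int * option (seq bool))%type.

Definition adjY1 (x y : Yvert) : Prop :=
  match x, y with
  | (k, None), (k', None) => k' = k + 1
  | (k, None), (k', Some w) => k' = k /\ w = [::]
  | (k, Some w), (k', Some w') => k' = k /\ (w' = rcons w false \/ w' = rcons w true)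
  | _, _ => False
  end.

Definition adjY (x y : Yvert) : Prop := adjY1 x y \/ adjY1 y x.

Definition RW (σ : int -> int) (x : Yvert) : Prop :=
  match x with
  | (k, None) => True
  | (k, Some w) => w \in BST (sigma_block σ k)
  end.

Definition RW_TL (σ : int -> int) : seq Yvert :=
  (0, None) :: [seq (0, Some w) | w <- BST (sigma_block σ 0)].

(* For Y = RW(σ) and o uniform on Y ∩ T_L (given Y):
   P(B_r(o, Y) ≡ H | Y) *)
Definition rooted_RW_prob {R : realType} (σ : int -> int) (r : nat)
  (V : finType) (e : rel V) (h : V) : R :=
  (count (fun v => `[< ball_iso (RW σ) adjY r v e h >]) (RW_TL σ))%:R
  / (size (RW_TL σ))%:R.

Definition bst_freq {R : realType} (b : nat -> nat -> bool) (n r : nat)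
  (V : finType) (e : rel V) (h : V) : R :=
  let T := BST (map Posz (Pi_n b n)) in
  (count (fun v => `[< ball_iso (fun w => w \in T) adjT r v e h >]) T)%:R / n%:R.

(* Main.v *)
Require Import Defs.
From HB Require Import structures.
From mathcomp Require Import all_boot all_order all_algebra.
From mathcomp Require Import all_classical all_reals all_analysis.
From mathcomp Require Import measurable_realfun.
From mathcomp Require Import zify ring lra.
Set Implicit Arguments. Unset Strict Implicit. Unset Printing Implicit Defensive.
Import Order.TTheory GRing.Theory Num.Theory.
Import numFieldNormedType.Exports.
Local Open Scope classical_set_scope.
Local Open Scope ring_scope.

(** The code of a value [v] is the number of larger values appearing before [v].  Records
    are the values of code 0, and the codes of the values between two consecutive records
    determine their relative order of appearance, hence the tree hanging off the spine
    there; a ball of radius [r] is therefore determined by the codes of [2r+1] consecutive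
    blocks.

    In the Bernoulli model the greedy matching of rows and columns is symmetric: reading the
    array by columns, the value [v] occupies the first free row with a 1 in column [v], and
    its code is the number of free rows skipped.  Hence the codes are independent geometric
    variables, and a second moment argument gives the almost sure frequency of every finite
    pattern of codes; up to time [n], only a vanishing fraction of the values [1, ..., n] is
    missing.

    For the two-sided permutation, the codes of the positive values are those of [Pi_+].
    Removing the nonpositive values [0, -1, ...] one at a time turns a gap of the partition
    into a particle; a step sends (skips [g], partition [S]) to (code [a], partition [S'])
    bijectively with [g + |S| = a + |S'|], so the weight [q ^ (g + |S|)] is preserved and the
    codes are again independent geometric.  The redwood tree seen from the block at the
    origin is then a size-biased window of blocks, and choosing [o] uniformly in that block
    cancels the bias: the two limits agree.  Lower bounds for the events "isomorphic to [H]"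
    and "not isomorphic to [H]" over finitely many windows suffice, as they sum to 1. *)

Local Notation within := Defs.within.

(** A code counts larger values, so it depends on nothing below its value: this is why inserting the
    nonpositive values leaves the codes of [Pi_+] intact. Neither limit is computed. The normalising
    product in the law of the [M i] is never evaluated, and no identity says that the window
    weights, block size times [geo], sum to 1. For the two-sided model only upper bounds on the
    probabilities of window events are proved. They suffice because these events cover almost every
    outcome: finitely many carry mass [1 - eps], and the upper bounds turn that mass into lower
    bounds for the sums over windows that control the frequencies in the finite tree. This replaces
    a tightness argument for block sizes. The two-sided permutation, its records and its blocks are
    chosen from specifications, and their measurability is never established. Each event about them
    is therefore replaced by an explicit measurable event that agrees with it outside a null set,
    and the expectation is only compared with simple functions. In the one-sided model, probability
    enters through [regular] alone; from there on the argument is deterministic. *)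

Definition has_card (T : eqType) (A : T -> Prop) (n : nat) : Prop :=
  exists s : seq T, [/\ uniq s, size s = n & forall x, x \in s <-> A x].

Lemma has_card_le (T : eqType) (A A' : T -> Prop) n n' :
  has_card A n -> has_card A' n' -> (forall x, A x -> A' x) -> (n <= n')%N.
Proof.
move=> [s [us <- hs]] [s' [us' <- hs']] AA'; apply: uniq_leq_size => // x /hs/AA'.
by move/hs'.
Qed.

Lemma has_card_add (T : eqType) (A A' : T -> Prop) (y : T) n :
  has_card A n -> ~ A y -> (forall x, A' x <-> x = y \/ A x) -> has_card A' n.+1.
Proof.
move=> [s [us <- hs]] Ay AA'; exists (y :: s); split=> //=.
  by rewrite us andbT; apply/negP => /hs.
move=> x; rewrite inE; split.
  by case/orP=> [/eqP->|/hs h]; apply: (AA' _).2; [left|right].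
by move/(AA' _).1; case=> [->|/hs->]; rewrite ?eqxx ?orbT.
Qed.

(** * Codes *)

(* [tau v] is the time at which the value [v] appears: [tau] is the inverse permutation. *)
Definition coded (tau : int -> int) (c : int -> nat) : Prop :=
  injective tau /\
  forall v : int, has_card (fun v' : int => v < v' /\ tau v' < tau v) (c v).

(* The rank in time of [v + k] among the values at least [v], computed from the codes. *)
Fixpoint rk (c : nat -> nat) (v k : nat) : nat :=
  if k is k'.+1 then let m := rk c v.+1 k' in (m + (c v <= m))%N else c v.

(** Insert the values in decreasing order. Exactly [c v] of the larger values precede [v], so [v]
    comes before a larger value exactly when the rank of the latter among the values above [v] is at
    least [c v], and then that rank grows by one. *)
Lemma rk_spec tau c (a : int) : coded tau c -> forall k v,
  has_card (fun v' : int => a + v%:Z <= v' /\ tau v' < tau (a + (v + k)%:Z))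
           (rk (fun i => c (a + i%:Z)) v k) /\
  (tau (a + v%:Z)%R < tau (a + (v + k.+1)%:Z)%R) =
    (c (a + v%:Z)%R <= rk (fun i => c (a + i%:Z)%R) v.+1 k)%N.
Proof.
move=> [tau_inj hc]; set c' := fun i : nat => _.
have tneq (x y : int) : x != y -> (tau x < tau y) || (tau y < tau x).
  by move=> xy; rewrite -neq_lt; apply: contra xy => /eqP/tau_inj->.
have cmp k v : has_card (fun v' : int => a + v.+1%:Z <= v' /\
      tau v' < tau (a + (v.+1 + k)%:Z)) (rk c' v.+1 k) ->
    (tau (a + v%:Z) < tau (a + (v + k.+1)%:Z)) = (c (a + v%:Z)%R <= rk c' v.+1 k)%N.
  move=> h; rewrite addnS -addSn.
  have [lt|ge] := boolP (tau (a + v%:Z) < tau (a + (v.+1 + k)%:Z)).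
    apply/esym/(has_card_le (hc _) h) => x [vx tx]; split; first by lia.
    exact: lt_trans tx lt.
  apply/esym/negbTE; rewrite -ltnNge.
  have lt : tau (a + (v.+1 + k)%:Z) < tau (a + v%:Z).
    by have := tneq (a + v%:Z) (a + (v.+1 + k)%:Z); rewrite (negbTE ge) /=; apply; lia.
  (* In the other case [v.+1 + k] itself is one more value preceding [v], which makes the inequality
     strict. *)
  have h1 : has_card (fun v' : int => v' = a + (v.+1 + k)%:Z \/
     (a + v.+1%:Z <= v' /\ tau v' < tau (a + (v.+1 + k)%:Z))) (rk c' v.+1 k).+1.
    by apply: (has_card_add h (y := a + (v.+1 + k)%:Z)) => [[_]|x]; [rewrite ltxx | split].
  apply: (has_card_le h1 (hc _)) => x [->|[vx tx]]; first by split; [lia | exact: lt].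
  by split; [lia | exact: lt_trans tx lt].
suff main k v : has_card (fun v' : int => a + v%:Z <= v' /\
    tau v' < tau (a + (v + k)%:Z)) (rk c' v k) by move=> k v; split; [|exact: cmp].
elim: k v => [|k IH] v.
  rewrite /= addn0; have [s [us ss hs]] := hc (a + v%:Z); exists s; split=> // x.
  split=> [/hs[]|[wx tx]]; first by split=> //; lia.
  by apply/hs; split=> //; rewrite lt_neqAle wx andbT; apply/eqP => E;
    move: tx; rewrite E ltxx.
have h := IH v.+1.
rewrite /= -[in X in has_card _ X](cmp _ _ h) addnS -addSn.
rewrite -/(nat_of_bool _).
have [lt|nlt] := boolP (tau (a + v%:Z) < tau (a + (v.+1 + k)%:Z)); rewrite ?addn0 ?addn1.
  apply: (has_card_add h (y := a + v%:Z)) => [[]|x]; first by lia.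
  split=> [[vx tx]|[->|[vx tx]]].
  - by case: (eqVneq x (a + v%:Z)) => [|ne]; [left|right; split=> //; lia].
  - by split.
  - by split=> //; lia.
have [s [us ss hs]] := h; exists s; split=> // x; split=> [/hs[vx tx]|[vx tx]].
  by split=> //; lia.
apply/hs; split=> //; case: (eqVneq x (a + v%:Z)) => [E|ne]; last by lia.
by move: nlt; rewrite -E tx.
Qed.

Lemma coded_lt tau c (a : int) (v k : nat) : coded tau c ->
  (tau (a + v%:Z)%R < tau (a + (v + k.+1)%:Z)%R) =
    (c (a + v%:Z)%R <= rk (fun i => c (a + i%:Z)%R) v.+1 k)%N.
Proof. by move=> /rk_spec h; have [] := h a k v. Qed.

Lemma rk_eq (c c' : nat -> nat) (v k n : nat) :
  (v + k < n)%N -> (forall i, (i < n)%N -> c i = c' i) -> rk c v k = rk c' v k.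
Proof.
move=> + cc'; elim: k v => [|k IH] v h /=; first by apply: cc'; lia.
by rewrite IH ?cc' //; lia.
Qed.

(** The order of appearance in reflexive form, as [sort] and [sorted_eq] expect. *)
Definition before (c : nat -> nat) (i j : nat) : bool :=
  if (i < j)%N then (c i <= rk c i.+1 (j - i.+1))%N
  else if (j < i)%N then (rk c j.+1 (i - j.+1) < c j)%N else true.

(** * Binary search trees *)

Lemma bst_aux_fuel k k' (x : seq int) :
  (size x <= k)%N -> (size x <= k')%N -> bst_aux k x = bst_aux k' x.
Proof.
elim: k k' x => [|k IH] [|k'] [|a t] //= h h'.
have hs p n : (size t < n.+1)%N -> (size [seq y <- t | p y] <= n)%N.
  by move=> ht; rewrite size_filter (leq_trans (count_size _ _)).
by rewrite !(IH k') // hs.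
Qed.

Lemma BST_cons a t : BST (a :: t) =
  [::] :: (map (cons false) (BST [seq y <- t | y < a])
           ++ map (cons true) (BST [seq y <- t | a < y])).
Proof.
rewrite /BST /=; have hs p : (size [seq y <- t | p y] <= size t)%N.
  by rewrite size_filter count_size.
rewrite (@bst_aux_fuel _ (size [seq y <- t | y < a]) [seq y <- t | y < a]) //.
by rewrite (@bst_aux_fuel _ (size [seq y <- t | a < y]) [seq y <- t | a < y]).
Qed.

Lemma BST_map (T : eqType) (f g : T -> int) (s : seq T) :
  {in s &, forall x y, (f x < f y) = (g x < g y)} ->
  BST (map f s) = BST (map g s).
Proof.
have [n] := ubnP (size s); elim: n s => // n IH [|a t] //= lt_n h.
rewrite !BST_cons !filter_map.
have sub p : {subset [seq y <- t | p y] <= a :: t}.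
  by move=> x; rewrite mem_filter inE => /andP[_ ->]; rewrite orbT.
have e1 : seq.filter (preim f (fun y => y < f a)) t = seq.filter (preim g (fun y => y < g a)) t.
  by apply: eq_in_filter => x xt /=; apply: h; rewrite inE ?eqxx ?xt ?orbT.
have e2 : seq.filter (preim f (fun y => f a < y)) t = seq.filter (preim g (fun y => g a < y)) t.
  by apply: eq_in_filter => x xt /=; apply: h; rewrite inE ?eqxx ?xt ?orbT.
rewrite e1 e2 !IH //; try (by move=> x y /sub hx /sub hy; apply: h);
  by rewrite (leq_ltn_trans _ (ltnSE lt_n)) // size_filter count_size.
Qed.

Lemma size_BST (x : seq int) : uniq x -> size (BST x) = size x.
Proof.
have [n] := ubnP (size x); elim: n x => // n IH [|a t] // lt_n; rewrite cons_uniq => /andP[at_ ut].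
have sz p : (size [seq y <- t | p y] < n)%N.
  by rewrite (leq_ltn_trans _ (ltnSE lt_n)) // size_filter count_size.
rewrite BST_cons /= size_cat !size_map !IH ?filter_uniq // !size_filter.
rewrite -(count_predC (fun y => y < a) t); congr (_ + _).+1.
apply: eq_in_count => y yt /=; rewrite -leNgt lt_neqAle andbC.
by case: eqVneq => [E|]; [rewrite E yt in at_ | rewrite andbT].
Qed.

(* The tree of a block, whose entries are renumbered from 0, with codes [l]. *)
Definition tr (l : seq nat) : seq (seq bool) :=
  BST (map Posz (sort (before (nth 0%N l)) (iota 0 (size l)))).

Definition codes (c : int -> nat) (a : int) (n : nat) : seq nat :=
  [seq c (a + i%:Z) | i <- iota 0 n].

Lemma nth_codes c a n i : (i < n)%N -> nth 0%N (codes c a n) i = c (a + i%:Z).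
Proof. by move=> h; rewrite (nth_map 0%N) ?size_iota // nth_iota. Qed.

Lemma size_codes c a n : size (codes c a n) = n.
Proof. by rewrite size_map size_iota. Qed.

Lemma coded_before tau c a n (i j : nat) : coded tau c -> (i < n)%N -> (j < n)%N ->
  before (nth 0%N (codes c a n)) i j = (tau (a + i%:Z) <= tau (a + j%:Z)).
Proof.
move=> h hi hj; rewrite /before; case: ltngtP => [ij|ji|->]; last by rewrite lexx.
- rewrite nth_codes // (@rk_eq _ (fun i => c (a + i%:Z)) _ _ n); try lia.
    rewrite -(coded_lt _ _ _ h) addnS -addSn subnKC // le_eqVlt orbC.
    have [inj _] := h; case: ltP => //= _; apply/esym/negbTE/eqP => /inj; lia.
  by move=> k hk; rewrite nth_codes.
- rewrite nth_codes // (@rk_eq _ (fun i => c (a + i%:Z)) _ _ n); try lia.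
    rewrite ltnNge -(coded_lt _ _ _ h) addnS -addSn subnKC // leNgt.
    by [].
  by move=> k hk; rewrite nth_codes.
Qed.

(** Two sorted lists with the same elements are equal, so [s] is a translate of the list sorted in
    [tr], and a tree is invariant under increasing relabelling. *)
Lemma BST_block tau c (a : int) (n : nat) (s : seq int) : coded tau c ->
  sorted (fun u v => tau u < tau v) s ->
  (forall v : int, v \in s <-> a <= v < a + n%:Z) ->
  BST s = tr (codes c a n).
Proof.
move=> h ss hs; pose f (v : int) : nat := `|v - a|%N.
have sE : s = map (fun i : nat => a + i%:Z) (map f s).
  rewrite -map_comp -[LHS]map_id; apply/eq_in_map => v /hs /= vP; rewrite /f; lia.
pose le i j := tau (a + Posz i) <= tau (a + Posz j).
have -> : tr (codes c a n) = BST (map Posz (sort le (iota 0 n))).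
  rewrite /tr size_codes; congr (BST (map _ _)).
  (* [coded_before] only holds for indices below [n]; on ordinals it becomes the equality of
     relations needed to rewrite under [sort]. *)
  have E : (relpre (@nat_of_ord n) (before (nth 0%N (codes c a n))) : rel _)
      = (relpre (@nat_of_ord n) le : rel _).
    by apply/funext => i; apply/funext => j /=; apply: coded_before.
  by rewrite -val_enum_ord sort_map [in RHS]sort_map E.
have us : uniq s.
  apply: (sorted_uniq _ _ ss) => [y x z xy yz|x]; [exact: lt_trans yz|exact: ltxx].
have -> : sort le (iota 0 n) = map f s.
  have tr_le : transitive le by move=> y x z; apply: le_trans.
  have pe : perm_eq (iota 0 n) (map f s).
    apply: uniq_perm; rewrite ?iota_uniq //.
      by rewrite map_inj_in_uniq // => x y /hs xP /hs yP; rewrite /f => E; lia.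
    move=> i; rewrite mem_iota add0n /=; apply/idP/mapP => [hi|[v /hs vP ->]].
      by exists (a + i%:Z); [apply/hs; lia | rewrite /f; lia].
    by rewrite /f; lia.
  apply: (@sorted_eq _ le tr_le) => //.
  - move=> i j /andP[h1 h2]; have [inj _] := h.
    have /inj : tau (a + Posz i) = tau (a + Posz j) by apply/le_anti/andP.
    by lia.
  - by apply: sort_sorted => i j; apply: le_total.
  - rewrite sorted_map; apply: (sub_in_sorted (P := mem s)) ss; last exact/allP.
    move=> x y /hs xP /hs yP xy /=; rewrite /le /f.
    have -> : a + Posz `|x - a| = x by lia.
    have -> : a + Posz `|y - a| = y by lia.
    exact: ltW.
  - by rewrite perm_sort.
rewrite [in LHS]sE; apply: BST_map => x y _ _ /=; lia.
Qed.

(** * Balls in the trees *)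

Lemma within_in (X : Type) (S : X -> Prop) (adj : X -> X -> Prop) n v u :
  within S adj n v u -> S u.
Proof. by elim: n u => [|n IH] u /=; [case=> ? -> | case=> [/IH|[w [_ []]]]]. Qed.

Lemma within_iso (X X' : Type) (S : X -> Prop) (S' : X' -> Prop)
    (adj : X -> X -> Prop) (adj' : X' -> X' -> Prop) (phi : X -> X') (psi : X' -> X) :
  (forall x, S x -> S' (phi x) /\ psi (phi x) = x) ->
  (forall y, S' y -> S (psi y) /\ phi (psi y) = y) ->
  (forall x x', S x -> S x' -> (adj x x' <-> adj' (phi x) (phi x'))) ->
  forall n v u, S u -> S v ->
  within S adj n v u <-> within S' adj' n (phi v) (phi u).
Proof.
move=> phiS psiS adjS n v u + Sv; elim: n u => [|n IH] u Su /=.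
  split=> [[_ ->]|[_ h]]; first by have [] := phiS _ Sv.
  by split=> //; rewrite -(phiS _ Su).2 h (phiS _ Sv).2.
split.
- case=> [h|[w [h [_ a]]]]; first by left; apply/IH.
  right; exists (phi w); have Sw := within_in h.
  by split; [apply/IH | split; [have [] := phiS _ Su | apply/adjS]].
- case=> [h|[w [h [_ a]]]]; first by left; apply/IH.
  have [Sp pE] := psiS _ (within_in h).
  right; exists (psi w); split; first by apply/IH; rewrite ?pE.
  by split=> //; apply/adjS; rewrite ?pE.
Qed.

(** [phi] and [psi] are mutually inverse on the two vertex sets only. This covers both the passage
    from words to [Yvert] and translations along the spine. *)
Lemma ball_iso_transfer (X X' : Type) (S : X -> Prop) (S' : X' -> Prop)
    (adj : X -> X -> Prop) (adj' : X' -> X' -> Prop) (phi : X -> X') (psi : X' -> X)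
    r v (V : finType) (e : rel V) (h : V) :
  (forall x, S x -> S' (phi x) /\ psi (phi x) = x) ->
  (forall y, S' y -> S (psi y) /\ phi (psi y) = y) ->
  (forall x x', S x -> S x' -> (adj x x' <-> adj' (phi x) (phi x'))) ->
  S v -> ball_iso S adj r v e h <-> ball_iso S' adj' r (phi v) e h.
Proof.
move=> phiS psiS adjS Sv.
have wi := within_iso phiS psiS adjS.
have in' n y u := @within_in X' S' adj' n y u.
have wi' n y : within S' adj' n (phi v) y -> within S adj n v (psi y).
  move=> hy; have [Sp pE] := psiS _ (in' _ _ _ hy).
  by apply/wi => //; rewrite pE.
split=> -[f [g [Bv fv gf fg ef]]].
- exists (f \o psi), (phi \o g); split=> /=.
  + exact/wi.
  + by rewrite (phiS _ Sv).2.
  + move=> u Bu; rewrite gf; last exact: wi'.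
    by have [] := psiS _ (in' _ _ _ Bu).
  + move=> x; have [Bx fx] := fg x; have Sx := within_in Bx.
    by split; [apply/wi | rewrite (phiS _ Sx).2].
  + move=> u u' Bu Bu'; rewrite -ef; [|exact: wi'|exact: wi'].
    have [Su uE] := psiS _ (in' _ _ _ Bu); have [Su' uE'] := psiS _ (in' _ _ _ Bu').
    by rewrite adjS // uE uE'.
- exists (f \o phi), (psi \o g); split=> //=.
  + exact/wi.
  + move=> u Bu; have Su := within_in Bu.
    by rewrite gf; [rewrite (phiS _ Su).2 | apply/wi].
  + move=> x; have [Bx fx] := fg x; have [Sp pE] := psiS _ (in' _ _ _ Bx).
    by split; [exact: wi' | rewrite pE].
  + move=> u u' Bu Bu'; have Su := within_in Bu; have Su' := within_in Bu'.
    by rewrite adjS // ef //; apply/wi.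
Qed.

Lemma ball_iso_ext (X : Type) (S S' : X -> Prop) (adj : X -> X -> Prop)
    r v (V : finType) (e : rel V) (h : V) :
  (forall u, within S adj r v u <-> within S' adj r v u) ->
  ball_iso S adj r v e h <-> ball_iso S' adj r v e h.
Proof.
move=> E; have EE : within S adj r v = within S' adj r v.
  by apply/funext => u; apply/propext.
by rewrite /ball_iso EE.
Qed.

Lemma adjY_near (x y : Yvert) : adjY x y -> `|y.1 - x.1| <= 1.
Proof.
by case: x y => [k [w|]] [k' [w'|]]; rewrite /adjY /adjY1 /=; lia.
Qed.

Lemma within_near (S : Yvert -> Prop) r (v u : Yvert) :
  within S adjY r v u -> `|u.1 - v.1| <= r%:Z.
Proof.
elim: r u => [|r IH] u /=; first by case=> _ ->; lia.
by case=> [/IH|[w [/IH h [_ /adjY_near]]]]; lia.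
Qed.

Lemma ball_iso_local (S S' : Yvert -> Prop) r (v : Yvert) (V : finType) (e : rel V) (h : V) :
  (forall u : Yvert, `|u.1 - v.1| <= r%:Z -> (S u <-> S' u)) ->
  ball_iso S adjY r v e h <-> ball_iso S' adjY r v e h.
Proof.
move=> SS'; apply: ball_iso_ext.
have hh n : (n <= r)%N -> forall u, within S adjY n v u <-> within S' adjY n v u.
  elim: n => [|n IH] hn u /=; first by rewrite SS' // subrr normr0.
  have hn' := ltnW hn.
  split=> -[/(IH hn')|[w [hw [Su a]]]]; try by left.
  - have b := within_near hw; have b' := adjY_near a.
    right; exists w; split; first exact/(IH hn').
    by split=> //; apply/SS' => //; lia.
  - have b := within_near hw; have b' := adjY_near a.
    right; exists w; split; first exact/(IH hn').
    by split=> //; apply/SS' => //; lia.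
exact: hh.
Qed.

(** * Blocks of a tree with a spine *)

Definition spineS (T : int -> seq (seq bool)) (x : Yvert) : Prop :=
  match x with
  | (k, None) => True
  | (k, Some w) => w \in T k
  end.

Definition blockV (k : int) (t : seq (seq bool)) : seq Yvert :=
  (k, None) :: [seq (k, Some w) | w <- t].

Definition block_count (S : Yvert -> Prop) r (V : finType) (e : rel V) (h : V)
  (k : int) (t : seq (seq bool)) : nat :=
  count (fun v => `[< ball_iso S adjY r v e h >]) (blockV k t).

(* A sequence [d] of 2r+1 code lists describes the blocks -r, ..., r. *)
Definition block_tree (r : nat) (d : seq (seq nat)) (k : int) : seq (seq bool) :=
  tr (nth [::] d `|k + r%:Z|).

Definition block_num r (V : finType) (e : rel V) (h : V) (d : seq (seq nat)) : nat :=
  block_count (spineS (block_tree r d)) r e h 0 (block_tree r d 0).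

(** The extra one is the spine vertex of the block. *)
Definition block_size r (d : seq (seq nat)) : nat := (size (nth [::] d r)).+1.

Lemma size_tr l : size (tr l) = size l.
Proof.
rewrite /tr size_BST ?size_map ?size_sort ?size_iota //.
by rewrite map_inj_uniq ?sort_uniq ?iota_uniq // => x y [].
Qed.

Lemma block_num_le r (V : finType) (e : rel V) (h : V) d :
  (block_num r e h d <= block_size r d)%N.
Proof.
rewrite (leq_trans (count_size _ _)) //= size_map size_tr /block_size.
by rewrite add0r.
Qed.

(** Shifting the spine index is a graph isomorphism, and a ball of radius [r] rooted in block [k]
    sees only blocks described by [d]; farther away [S] is arbitrary, so finite trees and redwood
    trees are both covered. *)
Lemma block_count_local (S : Yvert -> Prop) r (V : finType) (e : rel V) (h : V)
    (k : int) t d :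
  (forall j : int, `|j - k| <= r%:Z ->
     S (j, None) /\ forall w, S (j, Some w) <-> w \in block_tree r d (j - k)) ->
  t = block_tree r d 0 -> block_count S r e h k t = block_num r e h d.
Proof.
move=> hS tE; rewrite /block_num /block_count -tE.
have -> : blockV 0 t = map (fun x : Yvert => (x.1 - k, x.2)) (blockV k t).
  by rewrite /blockV /= subrr -map_comp; congr cons; apply: eq_map => w /=; rewrite subrr.
rewrite count_map; apply: eq_in_count => /= v vin.
have vk : v.1 = k by move: vin; rewrite inE => /predU1P[->|/mapP[w _ ->]].
pose S' (x : Yvert) := S (x.1 + k, x.2).
have S'E j : `|j| <= r%:Z -> S' (j, None) /\ forall w, S' (j, Some w) <-> w \in block_tree r d j.
  by move=> hj; have := hS (j + k); rewrite addrK => -/(_ hj).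
have Sv : S v.
  have [|h1 h2] := hS k; first by rewrite subrr normr0.
  move: vin; rewrite inE => /predU1P[->//|/mapP[w wt ->]].
  by apply/h2; rewrite subrr -tE.
apply: asbool_equiv_eq.
rewrite (@ball_iso_transfer _ _ S S' adjY adjY (fun x => (x.1 - k, x.2))
  (fun x => (x.1 + k, x.2))) //.
- apply: ball_iso_local => -[j o] /=; rewrite vk subrr subr0 => /S'E[h1 h2].
  by case: o => [w|] /=; rewrite ?h2.
- by move=> [j o] Sx; rewrite /S' /= subrK.
- by move=> [j o] Sx; rewrite /= addrK.
- move=> [j o] [j' o'] _ _; rewrite /adjY /adjY1 /=.
  have e1 a b : (a - k = b - k) <-> a = b by lia.
  have e2 a b : (a - k = b - k + 1) <-> a = b + 1 by lia.
  by case: o => [w|]; case: o' => [w'|]; rewrite ?e1 ?e2.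
Qed.

(** * The right spine of a binary search tree *)

(** The left subtrees hanging from the words [1^k]: the blocks of a finite tree, in the shape of the
    redwood tree. *)
Fixpoint spine_aux (k : nat) (x : seq int) : seq (seq (seq bool)) :=
  match k, x with
  | k'.+1, a :: t =>
      BST [seq y <- t | y < a] :: spine_aux k' [seq y <- t | a < y]
  | _, _ => [::]
  end.

Definition spine (x : seq int) := spine_aux (size x) x.

Lemma spine_aux_fuel k k' (x : seq int) :
  (size x <= k)%N -> (size x <= k')%N -> spine_aux k x = spine_aux k' x.
Proof.
elim: k k' x => [|k IH] [|k'] [|a t] //= h h'.
have hs p n : (size t < n.+1)%N -> (size [seq y <- t | p y] <= n)%N.
  by move=> ht; rewrite size_filter (leq_trans (count_size _ _)).
by rewrite (IH k') // hs.
Qed.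

Lemma spine_cons a t : spine (a :: t) =
  BST [seq y <- t | y < a] :: spine [seq y <- t | a < y].
Proof.
rewrite {1}/spine /=; congr cons; apply: spine_aux_fuel => //.
by rewrite size_filter count_size.
Qed.

Definition word_of (y : Yvert) : seq bool :=
  nseq `|y.1| true ++ (if y.2 is Some w then false :: w else [::]).

Fixpoint vertex_of (w : seq bool) : Yvert :=
  match w with
  | [::] => (0, None)
  | false :: w' => (0, Some w')
  | true :: w' => let y := vertex_of w' in (y.1 + 1, y.2)
  end.

Lemma vertex_of_ge0 w : 0 <= (vertex_of w).1.
Proof. by elim: w => [|[] w IH] //=; lia. Qed.

Lemma vertex_ofK w : word_of (vertex_of w) = w.
Proof.
elim: w => [|[] w IH] //=; rewrite /word_of /=.
have -> : `|((vertex_of w).1 + 1)%R|%N = `|(vertex_of w).1|%N.+1.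
  by have := vertex_of_ge0 w; lia.
by rewrite /= -[X in _ :: X = _]/(word_of (vertex_of w)) IH.
Qed.

Lemma word_ofK (y : Yvert) : 0 <= y.1 -> vertex_of (word_of y) = y.
Proof.
case: y => -[k|//] o _; rewrite /word_of /=.
elim: k => [|k IH] /=; first by case: o.
by rewrite IH /=; congr pair; lia.
Qed.

Lemma vertex_of_rcons w b : vertex_of (rcons w b) =
  match vertex_of w with
  | (k, None) => if b then (k + 1, None) else (k, Some [::])
  | (k, Some u) => (k, Some (rcons u b))
  end.
Proof.
elim: w => [|[] w IH] /=; first by case: b.
  by rewrite IH; case: (vertex_of w) => k [u|] //=; case: b {IH}.
by [].
Qed.

Lemma adj_vertex_of w u :
  adjY1 (vertex_of w) (vertex_of u) <-> u = rcons w false \/ u = rcons w true.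
Proof.
have E b : u = rcons w b <-> vertex_of u = vertex_of (rcons w b).
  by split=> [->//|h]; rewrite -(vertex_ofK u) h vertex_ofK.
rewrite !E !vertex_of_rcons.
case: (vertex_of w) => k [a|]; case: (vertex_of u) => k' [a'|] /=; split.
- by case=> -> [] ->; [left|right].
- by case=> -[-> ->]; split=> //; [left|right].
- by [].
- by case.
- by case=> -> ->; left.
- by case=> // -[-> ->].
- by move=> ->; right.
- by case=> // -[->].
Qed.

Lemma adjT_vertex_of w u : adjT w u <-> adjY (vertex_of w) (vertex_of u).
Proof. by rewrite /adjT /adjY !adj_vertex_of; tauto. Qed.

Definition spineBST (x : seq int) (y : Yvert) : Prop :=
  [/\ 0 <= y.1, (`|y.1| < size (spine x))%N &
     if y.2 is Some w then w \in nth [::] (spine x) `|y.1| else true].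

Lemma mem_BST_vertex x w : (w \in BST x) <-> spineBST x (vertex_of w).
Proof.
rewrite /spineBST; have [n] := ubnP (size x).
elim: n x w => // n IH [|a t] w lt_n; first by split=> // -[].
have lt_n' : (size [seq y <- t | (a < y)%R] < n)%N.
  by rewrite (leq_ltn_trans _ (ltnSE lt_n)) // size_filter count_size.
rewrite BST_cons spine_cons inE mem_cat.
case: w => [|[] w] /=.
- by split.
- have -> : (true :: w \in [seq false :: i | i <- BST [seq y <- t | y < a]]) = false.
    by apply/negP => /mapP[].
  rewrite /= mem_map; last by move=> ? ? [].
  rewrite (IH _ _ lt_n'); have h0 := vertex_of_ge0 w.
  have -> : `|((vertex_of w).1 + 1)%R|%N = `|(vertex_of w).1|%N.+1 by lia.
  by split=> -[h1 h2 h3]; split=> //; lia.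
- have -> : (false :: w \in [seq true :: i | i <- BST [seq y <- t | a < y]]) = false.
    by apply/negP => /mapP[].
  rewrite orbF mem_map; last by move=> ? ? [].
  by split=> [h|[]].
Qed.

Lemma ball_iso_BST x r w (V : finType) (e : rel V) (h : V) : w \in BST x ->
  ball_iso (fun u => u \in BST x) adjT r w e h <->
  ball_iso (spineBST x) adjY r (vertex_of w) e h.
Proof.
apply: (ball_iso_transfer (phi := vertex_of) (psi := word_of)).
- by move=> u /mem_BST_vertex hu; rewrite vertex_ofK.
- move=> y hy; have [h0 _ _] := hy; rewrite word_ofK //; split=> //.
  by apply/mem_BST_vertex; rewrite word_ofK.
- by move=> u u' _ _; apply: adjT_vertex_of.
Qed.

Lemma count_BST (Q : pred (seq bool)) x : count Q (BST x) =
  (\sum_(k < size (spine x))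
     count (Q \o word_of) (blockV k (nth [::] (spine x) k)))%N.
Proof.
have [n] := ubnP (size x); elim: n x Q => // n IH [|a t] Q lt_n.
  by rewrite big_ord0.
rewrite BST_cons spine_cons [size (_ :: _)]/= big_ord_recl.
rewrite [LHS]/= count_cat !count_map [X in (_ + (_ + X))%N]IH; last first.
  by rewrite (leq_ltn_trans _ (ltnSE lt_n)) // size_filter count_size.
rewrite addnA; congr addn.
  by rewrite /blockV /= count_map.
apply: eq_bigr => k _; rewrite /= !count_map; congr addn.
Qed.

Lemma count_ball_BST x r (V : finType) (e : rel V) (h : V) :
  count (fun v => `[< ball_iso (fun w => w \in BST x) adjT r v e h >]) (BST x) =
  (\sum_(k < size (spine x))
     block_count (spineBST x) r e h k (nth [::] (spine x) k))%N.
Proof.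
rewrite count_BST; apply: eq_bigr => k _; apply: eq_in_count => y hy /=.
have yP : spineBST x y.
  move: hy; rewrite inE => /predU1P[->|/mapP[w wt ->]]; split=> //=; exact: ltn_ord.
have [y0 _ _] := yP.
apply: asbool_equiv_eq; rewrite ball_iso_BST ?word_ofK //.
by apply/mem_BST_vertex; rewrite word_ofK.
Qed.

Lemma sum_spine (x : seq int) : uniq x ->
  (\sum_(k < size (spine x)) (size (nth [::] (spine x) k)).+1 = size x)%N.
Proof.
move=> ux; rewrite -[RHS](size_BST ux) -[RHS]count_predT count_BST.
by apply: eq_bigr => k _; rewrite (eq_count (a2 := predT)) // count_predT /= size_map.
Qed.

(** * Records and the blocks between them *)

Definition nrec (c : int -> nat) (z : nat) : nat :=
  count (fun i : nat => c i%:Z == 0%N) (iota 1 z).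

(** 0 stands for no record so far, consistently with values that start at 1. *)
Fixpoint last_rec (c : int -> nat) (z : nat) : nat :=
  if z is z'.+1 then (if c z%:Z == 0%N then z else last_rec c z') else 0%N.

Lemma nrecS c z : nrec c z.+1 = (nrec c z + (c z.+1%:Z == 0%N))%N.
Proof. by rewrite /nrec -(addn1 z) iotaD count_cat /= addn0 add1n addn1. Qed.

Lemma last_rec_le c z : (last_rec c z <= z)%N.
Proof. by elim: z => //= z IH; case: ifP => // _; apply: leqW. Qed.

Lemma last_recP c z i : (last_rec c z < i <= z)%N -> c i%:Z != 0%N.
Proof.
elim: z => [|z IH] /=; first by lia.
case: ifPn => [|nz]; first by lia.
by case: (eqVneq i z.+1) => [->//|ne] h; apply: IH; lia.
Qed.

Lemma coded_rec tau c (v v' : int) : coded tau c -> c v = 0%N -> v < v' -> tau v < tau v'.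
Proof.
move=> [inj hc] cv vv'; have [s [_ + hs]] := hc v.
rewrite cv => /size0nil sE; rewrite ltNge le_eqVlt negb_or; apply/andP; split.
  by apply/eqP => /inj; lia.
apply/negP => h; suff : v' \in [::] by [].
by rewrite -sE; apply/hs.
Qed.

(** Climb from [v] through larger and earlier values. Below [z] no code vanishes, so the climb goes
    on until it reaches [z] or jumps over it, and the record [z] precedes every larger value. *)
Lemma coded_nonrec tau c (v z : int) : coded tau c -> c z = 0%N -> v < z ->
  (forall i, v <= i < z -> c i != 0%N) -> tau z < tau v.
Proof.
move=> cod cz; have [_ hc] := cod.
have [k] := ubnP `|z - v|%N; elim: k v => // k IH v lt_k vz nz.
have [s [us ss hs]] := hc v.
case: s us ss hs => [|w s] us ss hs; first by have := nz v; rewrite -ss /=; lia.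
have [vw tw] : v < w /\ tau w < tau v by apply/hs; rewrite inE eqxx.
case: (ltgtP w z) => [wz|zw|wz]; last by rewrite -wz.
  by apply: lt_trans tw; apply: IH => //; [lia | move=> i hi; apply: nz; lia].
by apply: lt_trans tw; apply: coded_rec cod cz zw.
Qed.

Definition present (tau : int -> int) (n : int) (x : seq int) : Prop :=
  sorted (fun u v => tau u < tau v) x /\
  forall v : int, v \in x <-> 1 <= v /\ tau v <= n.

(** Among the values above [m], the record [z.+1] appears first: the smaller ones have nonzero
    codes, the larger ones follow any record. It therefore heads the list and the tree splits
    there. *)
Lemma spine_step tau c n x (m z : nat) : coded tau c -> present tau n x ->
  (m <= z)%N -> (forall i : nat, (m < i <= z)%N -> c i%:Z != 0%N) ->
  c z.+1%:Z = 0%N -> tau z.+1%:Z <= n ->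
  spine [seq y <- x | m%:Z < y] =
     BST [seq y <- x | m%:Z < y < z.+1%:Z] :: spine [seq y <- x | z.+1%:Z < y].
Proof.
move=> cod [xs xP] mz nz cz tz.
have tr_t : transitive (fun u v => tau u < tau v) by move=> y u v; apply: lt_trans.
have zx : z.+1%:Z \in [seq y <- x | m%:Z < y].
  by rewrite mem_filter; apply/andP; split; [lia | apply/xP].
have zmin v : v \in [seq y <- x | m%:Z < y] -> v != z.+1%:Z -> tau z.+1%:Z < tau v.
  rewrite mem_filter => /andP[mv _] ne.
  case: (ltgtP v z.+1%:Z) ne => // [vz|zv] _; last exact: coded_rec cod cz zv.
  apply: (coded_nonrec cod cz vz) => i hi.
  have -> : i = `|i|%N%:Z by lia.
  by apply: nz; lia.
have -> : [seq y <- x | m%:Z < y < z.+1%:Z] =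
    [seq y <- [seq y <- x | m%:Z < y] | y < z.+1%:Z].
  by rewrite -filter_predI; apply: eq_filter => y /=; rewrite andbC.
have -> : [seq y <- x | z.+1%:Z < y] = [seq y <- [seq y <- x | m%:Z < y] | z.+1%:Z < y].
  by rewrite -filter_predI; apply: eq_filter => y /=; lia.
have := sorted_filter tr_t (fun y => m%:Z < y) xs.
case: [seq y <- x | m%:Z < y] zx zmin => [//|a t] zx zmin /= path_t.
have aE : a = z.+1%:Z.
  apply/eqP; apply: contraT => ne.
  have := zmin a (mem_head _ _) ne.
  move: zx; rewrite inE eq_sym (negbTE ne) /= => zt.
  have /allP/(_ _ zt) := order_path_min tr_t path_t.
  by move=> h1 h2; have := lt_trans h1 h2; rewrite ltxx.
by rewrite spine_cons aE !ltxx.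
Qed.

(** Each record peels one node off the right spine. Only the records up to [z] are assumed to have
    appeared; other values may still be missing. *)
Lemma spine_drop tau c n x (z : nat) : coded tau c -> present tau n x ->
  (forall i : nat, (1 <= i <= z)%N -> c i%:Z = 0%N -> tau i%:Z <= n) ->
  drop (nrec c z) (spine x) = spine [seq y <- x | (last_rec c z)%:Z < y].
Proof.
move=> cod px; elim: z => [|z IH] h.
  rewrite /nrec drop0 /=; congr spine; apply/esym/all_filterP/allP => y.
  by case: px => _ /[apply]; lia.
rewrite nrecS /=; have {}IH := IH _.
case: eqP => [cz|nz] /=; last by rewrite addn0 IH // => i hi; apply: h; lia.
rewrite addn1 -addn1 addnC -drop_drop IH; last by move=> i hi; apply: h; lia.
rewrite (spine_step cod px (last_rec_le c z) _ cz) /= ?drop0 //.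
  exact: last_recP.
by apply: h => //; lia.
Qed.

Lemma spine_nth tau c n x (s : nat) (l : seq nat) : coded tau c -> present tau n x ->
  (0 < s)%N -> c s%:Z = 0%N -> all (fun a => a != 0%N) l ->
  (forall i, (i < size l)%N -> c (s + i.+1)%:Z = nth 0%N l i) ->
  c (s + (size l).+1)%:Z = 0%N ->
  (forall i, (0 < i <= (size l).+1)%N -> tau (s + i)%:Z <= n) ->
  [/\ nth [::] (spine x) (nrec c s) = tr l, (nrec c s < size (spine x))%N &
     nrec c (s + (size l).+1) = (nrec c s).+1].
Proof.
move=> cod px s0 cs /allP nzl cl cz tl; have [xs xP] := px.
have [tauI _] := cod.
have nz i : (s < i <= s + size l)%N -> c i%:Z != 0%N.
  move=> hi; have -> : i = (s + (i - s.+1).+1)%N by lia.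
  have hl : (i - s.+1 < size l)%N by lia.
  by rewrite cl //; apply/nzl/mem_nth.
(* Records appear in increasing order, so all earlier ones are there once the closing record is. *)
have early i : (1 <= i <= s + size l)%N -> c i%:Z = 0%N -> tau i%:Z <= n.
  move=> hi ci; apply: (@le_trans _ _ (tau (s + (size l).+1)%:Z)); last by apply: tl; lia.
  by apply/ltW/(coded_rec cod) => //; lia.
have recE k : (k <= size l)%N -> nrec c (s + k) = nrec c s /\ last_rec c (s + k) = s.
  elim: k => [|k IH] hk; rewrite ?addn0 ?addnS.
    by split=> //; case: (s) s0 cs => // s' _ /= ->.
  have [h1 h2] := IH (ltnW hk).
  have /negbTE nzk := nz (s + k).+1 ltac:(lia).
  by rewrite nrecS /= nzk addn0 h1 h2.
have [r1 r2] := recE _ (leqnn _).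
have dr := spine_drop cod px early.
have tz : tau (s + size l).+1%:Z <= n by rewrite -addnS; apply: tl; lia.
have cz' : c (s + size l).+1%:Z = 0%N by rewrite -addnS.
rewrite r1 r2 (spine_step cod px (leq_addr _ _) nz cz' tz) in dr.
have szl : (nrec c s < size (spine x))%N.
  by rewrite ltnNge; apply/negP => /drop_oversize E; rewrite E in dr.
split=> //; last by rewrite addnS nrecS -addnS cz eqxx r1 addn1.
rewrite -[nrec c s]addn0 -nth_drop dr /=.
have -> : l = codes c (s%:Z + 1) (size l).
  apply: (@eq_from_nth _ 0%N) => [|i hi]; first by rewrite size_codes.
  by rewrite nth_codes // -cl //; congr (c _); lia.
apply: BST_block cod _ _ => [|v].
  by apply: sorted_filter xs => y u v; apply: lt_trans.
rewrite size_codes mem_filter; split=> [/andP[]|hv]; first by lia.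
apply/andP; split; first by lia.
apply/xP; split; first by lia.
have -> : v = (s + `|v - s%:Z|)%N%:Z by lia.
by apply: tl; lia.
Qed.

(* The codes of consecutive blocks, each closed by the code 0 of its record. *)
Definition pat (d : seq (seq nat)) : seq nat := flatten [seq rcons l 0%N | l <- d].

Definition nonzero_blocks (d : seq (seq nat)) : bool :=
  all (all (fun a => a != 0%N)) d.

Lemma pat_cons l d : pat (l :: d) = rcons l 0%N ++ pat d. Proof. by []. Qed.

Lemma spine_match tau c n x (d : seq (seq nat)) (s : nat) :
  coded tau c -> present tau n x -> (0 < s)%N -> c s%:Z = 0%N -> nonzero_blocks d ->
  (forall i, (i < size (pat d))%N -> c (s + i.+1)%:Z = nth 0%N (pat d) i) ->
  (forall i, (0 < i <= size (pat d))%N -> tau (s + i)%:Z <= n) ->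
  forall j, (j < size d)%N ->
    nth [::] (spine x) (nrec c s + j) = tr (nth [::] d j) /\
    (nrec c s + j < size (spine x))%N.
Proof.
move=> cod px; elim: d s => // l d IH s s0 cs /andP[nzl nzd].
rewrite pat_cons size_cat size_rcons => cd td.
have cl i : (i < size l)%N -> c (s + i.+1)%:Z = nth 0%N l i.
  move=> hi; rewrite cd; last by lia.
  by rewrite nth_cat size_rcons ltnS (ltnW hi) nth_rcons hi.
have cz : c (s + (size l).+1)%:Z = 0%N.
  rewrite cd; last by lia.
  by rewrite nth_cat size_rcons ltnSn nth_rcons ltnn eqxx.
have [h1 h2 h3] := @spine_nth _ c n x s l cod px s0 cs nzl cl cz
  ltac:(by move=> i hi; apply: td; lia).
case=> [|j] hj; first by rewrite addn0.
have := IH (s + (size l).+1)%N ltac:(lia) cz nzd _ _ j hj.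
rewrite h3 addSnnS; apply.
- move=> i hi; rewrite -addnA addSn cd; last by lia.
  by rewrite nth_cat size_rcons -addSnnS ltnNge leq_addr /= addKn.
- by move=> i hi; rewrite -addnA; apply: td; lia.
Qed.

(** The window opens at the record [s], whose block has spine index [nrec c s]; the central one of
    its [2r+1] blocks comes [r] later. *)
Lemma block_count_match tau c n x r (V : finType) (e : rel V) (h : V)
    (d : seq (seq nat)) (s : nat) :
  coded tau c -> present tau n x -> (0 < s)%N -> c s%:Z = 0%N -> nonzero_blocks d ->
  size d = r.*2.+1 ->
  (forall i, (i < size (pat d))%N -> c (s + i.+1)%:Z = nth 0%N (pat d) i) ->
  (forall i, (0 < i <= size (pat d))%N -> tau (s + i)%:Z <= n) ->
  let k := (nrec c s + r)%N in
  [/\ (k < size (spine x))%N,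
      block_count (spineBST x) r e h k (nth [::] (spine x) k) = block_num r e h d &
      (size (nth [::] (spine x) k)).+1 = block_size r d].
Proof.
move=> cod px s0 cs nzd sd cd td k.
have m := spine_match cod px s0 cs nzd cd td.
have [kT kS] := m r ltac:(lia).
have kE : nth [::] (spine x) k = block_tree r d 0 by rewrite kT /block_tree add0r.
split=> //; last by rewrite kT size_tr.
apply: block_count_local => // j hj.
have [] := m `|(j - k%:Z + r%:Z)%R|%N ltac:(lia).
have -> : (nrec c s + `|(j - k%:Z + r%:Z)%R|)%N = `|j|%N by rewrite /k in hj *; lia.
move=> E ls; have j0 : 0 <= j by rewrite /k in hj *; lia.
by split=> [|w]; rewrite /spineBST /= ?E /block_tree; split=> // -[].
Qed.

(** * The Bernoulli model read by columns *)

(** Makes every search along a row or a column succeed, so that [first_free] and [first_true] never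
    return their default 0. *)
Definition inf_ones (b : nat -> nat -> bool) : Prop :=
  forall i m, (exists2 j, (m < j)%N & b i j) /\ (exists2 j, (m < j)%N & b j i).

(* [unused g v] enumerates the times left free by the first [v] values, when value
   [v.+1] occupies the free time of rank [g v]. *)
Fixpoint unused (g : nat -> nat) (v : nat) : nat -> nat :=
  if v is v'.+1 then unused g v' \o bump (g v') else succn.

(** Values start at 1 while [g] is indexed from 0, hence the predecessors. *)
Definition time_of (g : nat -> nat) (v : nat) : nat := unused g v.-1 (g v.-1).

Definition first_true (p : nat -> bool) : nat :=
  match pselect (exists i, p i) with
  | left H => ex_minn H
  | right _ => 0%N
  end.

Lemma first_trueP (p : nat -> bool) : (exists i, p i) ->
  p (first_true p) /\ forall i, (i < first_true p)%N -> ~~ p i.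
Proof.
rewrite /first_true; case: pselect => [H|//] _; case: ex_minnP => m pm mmin; split=> // i.
by rewrite ltnNge; apply: contra => /mmin.
Qed.

Lemma first_true_eq (p : nat -> bool) i : p i -> (forall j, (j < i)%N -> ~~ p j) ->
  first_true p = i.
Proof.
move=> p_i imin; have [pm mmin] := first_trueP (ex_intro _ i p_i).
case: (ltngtP (first_true p) i) => // h; first by have := imin _ h; rewrite pm.
by have := mmin _ h; rewrite p_i.
Qed.

Fixpoint column_state (b : nat -> nat -> bool) (v : nat) : nat -> nat :=
  if v is v'.+1 then
    let f := column_state b v' in f \o bump (first_true (fun i => b (f i) v))
  else succn.

(* Number of free times skipped by value [v.+1]: the trials in column [v.+1] failed there. *)
Definition colcode (b : nat -> nat -> bool) (v : nat) : nat :=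
  first_true (fun i => b (column_state b v i) v.+1).

Lemma column_stateE b v : column_state b v = unused (colcode b) v.
Proof. by elim: v => //= v IH; rewrite -IH. Qed.

Lemma unused_lt g v : {homo unused g v : i j / (i < j)%N}.
Proof. by elim: v => [|v IH] i j ij //=; apply: IH; rewrite /bump; lia. Qed.

Lemma unused_inj g v : injective (unused g v).
Proof.
move=> i j E; case: (ltngtP i j) => // h; have := unused_lt g v h; rewrite E; lia.
Qed.

Lemma unused_gt0 g v i : (0 < unused g v i)%N.
Proof. by elim: v i => //= v IH i; apply: IH. Qed.

Lemma unusedP g v t : (0 < t)%N ->
  (exists i, unused g v i = t) <-> (forall u, (0 < u <= v)%N -> time_of g u != t).
Proof.
move=> t0; elim: v => [|v IH].
  by split=> [_ u|_]; [lia | exists t.-1 => /=; lia].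
split.
- move=> [i /= iE] u /andP[u0 uv].
  have {IH} [+ _] := IH; move=> /(_ (ex_intro _ _ iE)) h.
  case: (ltngtP u v.+1) => [uv'||->]; [by apply: h; lia | by lia |].
  rewrite /time_of /= -iE; apply/eqP => /unused_inj E.
  by have := neq_bump (g v) i; rewrite -E eqxx.
- move=> h; have /IH[i iE] : forall u, (0 < u <= v)%N -> time_of g u != t.
    by move=> u hu; apply: h; lia.
  have ne : g v != i.
    by apply: contra (h v.+1 ltac:(lia)) => /eqP gi; rewrite /time_of /= gi iE.
  by exists (unbump (g v) i) => /=; rewrite unbumpKcond eq_sym (negbTE ne).
Qed.

Lemma time_of_inj g u v : (0 < u)%N -> (0 < v)%N -> time_of g u = time_of g v -> u = v.
Proof.
have main a b : (0 < a)%N -> (a < b)%N -> time_of g a = time_of g b -> False.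
  move=> a0 ab E.
  have [h _] := unusedP g b.-1 (unused_gt0 g b.-1 (g b.-1)).
  have /h/(_ a) : exists i, unused g b.-1 i = unused g b.-1 (g b.-1) by exists (g b.-1).
  by rewrite E /time_of eqxx; lia.
move=> u0 v0 E; case: (ltngtP u v) => // h.
  by case: (main _ _ u0 h E).
by case: (main _ _ v0 h (esym E)).
Qed.

Lemma Iseq_size b n : size (Iseq b n) = n.
Proof. by elim: n => //= n IH; rewrite size_rcons IH. Qed.

Lemma IseqE b n : Iseq b n = [seq Ival b i | i <- iota 1 n].
Proof.
elim: n => // n IH; rewrite -[in RHS](addn1 n) iotaD map_cat -IH /= cats1 add1n.
by rewrite /Ival /= last_rcons.
Qed.

(** A form of the greedy rule that mentions only the matching itself. [time_ofP] is its transpose,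
    and [Ival_time] plays one against the other. *)
Lemma IvalP b i j : inf_ones b -> (0 < i)%N -> Ival b i = j <->
  [/\ (0 < j)%N, b i j, (forall i', (0 < i' < i)%N -> Ival b i' != j) &
     forall j', (0 < j' < j)%N -> b i j' -> exists2 i', (0 < i' < i)%N & Ival b i' = j'].
Proof.
move=> db; case: i => // i _.
have used k : (k \notin Iseq b i) <-> (forall i', (0 < i' < i.+1)%N -> Ival b i' != k).
  rewrite IseqE; split=> [h i' hi'|h].
    by apply: contra h => /eqP <-; apply: map_f; rewrite mem_iota; lia.
  by apply/mapP => -[i']; rewrite mem_iota => hi' kE; have := h i'; rewrite kE eqxx; lia.
have -> : Ival b i.+1 = first_free (b i.+1) (Iseq b i) by rewrite /Ival /= last_rcons.
rewrite /first_free; case: pselect => [H|nH]; last first.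
  exfalso; apply: nH; have [[j' hj' bj'] _] := db i.+1 (\max_(k <- Iseq b i) k)%N.
  exists j'; rewrite bj' andbT; apply/andP; split; first by lia.
  apply/negP => ju; have := leq_ltn_trans (@leq_bigmax_seq _ (Iseq b i) predT id j' ju isT) hj'.
  by rewrite ltnn.
case: ex_minnP => m /and3P[m0 mu bm] mmin; split.
- move=> <-; split=> //; first exact/used.
  move=> j' /andP[j0 jm] bj'.
  have : j' \in Iseq b i.
    by apply: contraT => ju; have := mmin j'; rewrite j0 ju bj' /=; lia.
  by rewrite IseqE => /mapP[i']; rewrite mem_iota => hi' ->; exists i' => //; lia.
- move=> [j0 bj ju jmin]; apply/eqP; rewrite eqn_leq mmin ?j0 ?bj ?andbT //=; last exact/used.
  rewrite leqNgt; apply/negP => mj.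
  have [i' hi' mE] := jmin m ltac:(lia) bm.
  by have /used/(_ i' hi') := mu; rewrite mE eqxx.
Qed.

Lemma colcodeP b v : inf_ones b -> b (unused (colcode b) v (colcode b v)) v.+1 /\
  forall i, (i < colcode b v)%N -> ~~ b (unused (colcode b) v i) v.+1.
Proof.
move=> db.
rewrite -column_stateE; apply: first_trueP.
have [_ [i' hi' bi']] := db v.+1 (\max_(u <- iota 1 v) time_of (colcode b) u)%N.
have [_ []] := @unusedP (colcode b) v i' ltac:(lia).
  move=> u hu; apply/eqP => uE.
  have : u \in iota 1 v by rewrite mem_iota; lia.
  by move=> ui; have := leq_ltn_trans (@leq_bigmax_seq _ _ predT (time_of (colcode b)) u ui isT) hi';
    rewrite uE ltnn.
by move=> j jE; exists j; rewrite column_stateE jE.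
Qed.

Lemma time_ofP b v i : inf_ones b -> (0 < v)%N -> time_of (colcode b) v = i <->
  [/\ (0 < i)%N, b i v, (forall v', (0 < v' < v)%N -> time_of (colcode b) v' != i) &
     forall i', (0 < i' < i)%N -> b i' v ->
       exists2 v', (0 < v' < v)%N & time_of (colcode b) v' = i'].
Proof.
move=> db; case: v => // v _.
have [bc cmin] := colcodeP v db.
have tE : time_of (colcode b) v.+1 = unused (colcode b) v (colcode b v) by [].
have t0 := unused_gt0 (colcode b) v (colcode b v).
have lt_unused : {mono unused (colcode b) v : a c / (a < c)%N}.
  move=> a c'; case: (ltngtP a c') => [|h|->]; rewrite ?ltnn //; first exact: unused_lt.
  by have := unused_lt (colcode b) v h; lia.
split.
- rewrite tE => <-; split=> //.
    by move=> u hu; have [] := unusedP (colcode b) v t0 => + _; apply; [exists (colcode b v)|lia].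
  move=> i' /andP[i0 it] bi'.
  have [//|nex] := pselect (exists2 v', (0 < v' < v.+1)%N & time_of (colcode b) v' = i').
  have [_ []] := unusedP (colcode b) v i0.
    by move=> u hu; apply/eqP => uE; apply: nex; exists u => //; lia.
  move=> k kE; move: it; rewrite -kE lt_unused => /cmin.
  by rewrite kE bi'.
- move=> [i0 bi iu imin].
  have [_ []] := unusedP (colcode b) v i0; first by move=> u hu; apply: iu; lia.
  move=> k kE; rewrite tE -kE; congr (unused _ _ _).
  case: (ltngtP (colcode b v) k) => // h; last by have := cmin k h; rewrite kE bi.
  have [||v' hv' vE] := imin (unused (colcode b) v (colcode b v)).
  - by rewrite t0 -kE lt_unused.
  - exact: bc.
  have [+ _] := unusedP (colcode b) v t0; move=> /(_ (ex_intro _ _ erefl) v').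
  by rewrite vE eqxx; lia.
Qed.

(* The greedy matching is characterised symmetrically in rows and columns. *)
Lemma Ival_time b i v : inf_ones b -> (0 < i)%N -> (0 < v)%N ->
  Ival b i = v <-> time_of (colcode b) v = i.
Proof.
move=> db; have [n] := ubnP (i + v); elim: n i v => // n IH i v lt_n i0 v0.
split=> E.
- have [_ biv vu vmin] := (IvalP v db i0).1 E; apply/(time_ofP i db v0); split=> //.
    move=> v' hv'; apply/eqP => E'.
    by have := (IH i v' ltac:(lia) i0 ltac:(lia)).2 E'; lia.
  move=> i' hi' bi'; have i'0 : (0 < i')%N by lia.
  have [w0 _ _ wmin] := (IvalP _ db i'0).1 (erefl (Ival b i')).
  have ne := vu i' hi'.
  (* If row [i'] went past [v], where it has a 1, then a still earlier row had taken [v], although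
     [v] is free for row [i]. *)
  case: (ltngtP (Ival b i') v) ne => // h _; last first.
    have [i2 hi2 E2] := wmin v ltac:(lia) bi'.
    by have := vu i2 ltac:(lia); rewrite E2 eqxx.
  exists (Ival b i'); first by lia.
  by apply/(IH i' _ _ i'0 w0) => //; lia.
- have [_ biv vu vmin] := (time_ofP i db v0).1 E; apply/(IvalP v db i0); split=> //.
    move=> i' hi'; apply/eqP => E'.
    by have := (IH i' v ltac:(lia) ltac:(lia) v0).1 E'; lia.
  move=> v' hv' bv'; have v'0 : (0 < v')%N by lia.
  have [w0 _ _ wmin] := (time_ofP _ db v'0).1 (erefl (time_of (colcode b) v')).
  have ne := vu v' hv'.
  case: (ltngtP (time_of (colcode b) v') i) ne => // h _; last first.
    have [i2 hi2 E2] := wmin i ltac:(lia) bv'.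
    by have := vu i2 ltac:(lia); rewrite E2 eqxx.
  exists (time_of (colcode b) v'); first by lia.
  by apply/(IH _ v' _ w0 v'0) => //; lia.
Qed.

Lemma Ival_gt0 b i : inf_ones b -> (0 < i)%N -> (0 < Ival b i)%N.
Proof. by move=> db i0; have [] := (IvalP _ db i0).1 (erefl (Ival b i)). Qed.

Lemma time_of_Ival b i : inf_ones b -> (0 < i)%N -> time_of (colcode b) (Ival b i) = i.
Proof. by move=> db i0; apply/Ival_time => //; apply: Ival_gt0. Qed.

Lemma time_of_gt0 g v : (0 < time_of g v)%N. Proof. exact: unused_gt0. Qed.

Lemma Ival_time_of b v : inf_ones b -> (0 < v)%N -> Ival b (time_of (colcode b) v) = v.
Proof. by move=> db v0; apply/Ival_time => //; apply: time_of_gt0. Qed.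

Lemma unused_lt_mono g v : {mono unused g v : a c / (a < c)%N}.
Proof.
move=> a c'; case: (ltngtP a c') => [|h|->]; rewrite ?ltnn //; first exact: unused_lt.
by have := unused_lt g v h; lia.
Qed.

(** Columns are served in increasing order: a free time skipped by [v] is eventually filled,
    necessarily by a larger value, and a larger value appearing before [v] sits at a skipped
    time. *)
Lemma code_card b v : inf_ones b -> (0 < v)%N ->
  has_card (fun v' : nat => (v < v')%N /\
              (time_of (colcode b) v' < time_of (colcode b) v)%N) (colcode b v.-1).
Proof.
move=> db v0; pose u := unused (colcode b) v.-1.
have u0 i : (0 < u i)%N by apply: unused_gt0.
exists [seq Ival b (u i) | i <- iota 0 (colcode b v.-1)]; split.
- rewrite map_inj_in_uniq ?iota_uniq // => i j _ _ E.
  apply: (@unused_inj (colcode b) v.-1); rewrite -/u.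
  by rewrite -(time_of_Ival db (u0 i)) E time_of_Ival.
- by rewrite size_map size_iota.
move=> v'; split=> [/mapP[i]|[vv' tt]].
  rewrite mem_iota add0n => /= hi ->; rewrite time_of_Ival //.
  have lt : (u i < time_of (colcode b) v)%N by rewrite /time_of unused_lt_mono.
  split=> //; rewrite ltnNge; apply/negP => le.
  have [+ _] := unusedP (colcode b) v.-1 (u0 i).
  move=> /(_ (ex_intro _ i erefl) (Ival b (u i))); rewrite time_of_Ival // eqxx.
  have := Ival_gt0 db (u0 i).
  case: (eqVneq (Ival b (u i)) v) => [E|ne]; last by lia.
  by move: lt; rewrite -E time_of_Ival // ltnn.
have [_ []] := unusedP (colcode b) v.-1 (time_of_gt0 (colcode b) v').
  by move=> w hw; apply/eqP => /time_of_inj E; lia.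
move=> i iE; apply/mapP; exists i; last by rewrite /u iE Ival_time_of //; lia.
by rewrite mem_iota add0n /= -(unused_lt_mono (colcode b) v.-1) iE.
Qed.

(** * The one-sided permutation extended to the integers *)

Lemma has_card_map (T T' : eqType) (f : T -> T') (A : T -> Prop) (A' : T' -> Prop) n :
  injective f -> has_card A n -> (forall x, A' x <-> exists2 y, A y & x = f y) ->
  has_card A' n.
Proof.
move=> finj [s [us <- hs]] AA'; exists (map f s); split.
- by rewrite map_inj_uniq.
- by rewrite size_map.
move=> x; split=> [/mapP[y /hs Ay ->]|/AA'[y /hs ys ->]]; last exact: map_f.
by apply/AA'; exists y.
Qed.

(** The identity on nonpositive integers, all of them records, lets one notion of [coded] serve both
    models. *)
Definition ext_time (b : nat -> nat -> bool) (v : int) : int :=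
  if 0 < v then (time_of (colcode b) `|v|%N)%:Z else v.

Definition ext_code (b : nat -> nat -> bool) (v : int) : nat :=
  if 0 < v then colcode b `|v|%N.-1 else 0%N.

Lemma coded_ext b : inf_ones b -> coded (ext_time b) (ext_code b).
Proof.
move=> db; split.
  move=> u v; rewrite /ext_time; case: ifP => hu; case: ifP => hv.
  - by case=> /time_of_inj h; have := h ltac:(lia) ltac:(lia); lia.
  - by have := time_of_gt0 (colcode b) `|u|%N; lia.
  - by have := time_of_gt0 (colcode b) `|v|%N; lia.
  - by [].
move=> v; rewrite /ext_time /ext_code; case: ifP => hv.
  apply: (@has_card_map _ _ Posz) (code_card db (v := `|v|%N) ltac:(lia)) _.
    by move=> i j [].
  move=> x; split=> [[vx]|[y [h1 h2] ->]].
    have -> : 0 < x by lia.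
    by move=> tx; exists `|x|%N; [split; lia | lia].
  have y0 : 0 < y%:Z by lia.
  by rewrite y0 absz_nat ltz_nat; split; first by lia.
exists [::]; split=> // x; split=> // -[vx].
by case: ifP => hx; have := time_of_gt0 (colcode b) `|x|%N; lia.
Qed.

Lemma unused_le g v i : (unused g v i <= i + v.+1)%N.
Proof.
elim: v i => [|v IH] i /=; first by lia.
by apply: leq_trans (IH _) _; rewrite /bump; lia.
Qed.

(** At most [v.-1] of the first [g v.-1 + v] times are taken, which leaves at least [(g v.-1).+1]
    free ones. A small code thus prevents a late appearance. *)
Lemma time_of_le g v : (0 < v)%N -> (time_of g v <= g v.-1 + v)%N.
Proof. by case: v => // v _; apply: unused_le. Qed.

Lemma BST_Pi_n b n : BST (map Posz (Pi_n b n)) = BST (map Posz (Iseq b n)).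
Proof.
rewrite /Pi_n -map_comp; apply: BST_map => x y xs ys /=.
set s := Iseq b n in xs ys *; rewrite !ltz_nat.
have mono u w : (u <= w)%N -> (count (fun z => (z <= u)%N) s <= count (fun z => (z <= w)%N) s)%N.
  by move=> uw; apply: sub_count => z /= /leq_trans; apply.
case: (ltnP x y) => xy; last by apply/negbTE; rewrite -leqNgt mono.
rewrite (leq_trans (n := (count (fun z => (z <= x)%N) s + count_mem y s)%N)) //.
  by rewrite -addn1 leq_add2l -has_count has_pred1.
rewrite -count_predUI [X in (_ + X)%N](_ : _ = 0%N) ?addn0; last first.
  by apply/eqP; rewrite -leqn0 leqNgt -has_count; apply/hasPn => z _ /=;
    case: eqP => [->|]; rewrite ?andbF //; lia.
by apply: sub_count => z /= /orP[|/eqP->//]; lia.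
Qed.

Lemma present_Iseq b (n : nat) : inf_ones b -> present (ext_time b) n%:Z (map Posz (Iseq b n)).
Proof.
move=> db; have tI i : (0 < i)%N -> ext_time b (Ival b i)%:Z = i.
  move=> i0; have := Ival_gt0 db i0; rewrite /ext_time ltz_nat => -> /=.
  by rewrite time_of_Ival.
split.
  rewrite IseqE !sorted_map; apply: (sub_in_sorted (P := fun i => (0 < i)%N)) (iota_ltn_sorted 1 n).
    by move=> i j i0 j0 ij /=; rewrite !tI // ltz_nat.
  by apply/allP => i; rewrite mem_iota; lia.
move=> v; rewrite IseqE -map_comp; split=> [/mapP[i]|[v1 tv]].
  rewrite mem_iota => hi -> /=; have i0 : (0 < i)%N by lia.
  by rewrite tI //; have := Ival_gt0 db i0; lia.
have hv : 0 < v by lia.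
move: tv; rewrite /ext_time hv => tv.
apply/mapP; exists (time_of (colcode b) `|v|%N).
  by rewrite mem_iota; have := time_of_gt0 (colcode b) `|v|%N; lia.
by rewrite /= Ival_time_of //; lia.
Qed.

(** * Occurrences of a pattern of codes *)

Definition occ (c : nat -> nat) (p : seq nat) (s : nat) : bool :=
  all (fun i => c (s + i)%N == nth 0%N p i) (iota 0 (size p)).

Lemma occP c p s :
  reflect (forall i, (i < size p)%N -> c (s + i)%N = nth 0%N p i) (occ c p s).
Proof.
apply: (iffP allP) => h i hi; first by apply/eqP/h; rewrite mem_iota.
by rewrite h //; move: hi; rewrite mem_iota.
Qed.

(* A pattern is parsed in a unique way, since the code 0 only occurs at the end of a block. *)
Lemma pat_inj (c : nat -> nat) d d' s : size d = size d' ->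
  nonzero_blocks d -> nonzero_blocks d' -> occ c (pat d) s -> occ c (pat d') s -> d = d'.
Proof.
elim: d d' s => [|l d IH] [|l' d'] // s [sd] /andP[nl nd] /andP[nl' nd'].
rewrite !pat_cons => /occP o /occP o'.
have get m e : (forall i, (i < size (rcons m 0%N ++ e))%N ->
      c (s + i)%N = nth 0%N (rcons m 0%N ++ e) i) ->
    (forall i, (i < size m)%N -> c (s + i)%N = nth 0%N m i) /\ c (s + size m)%N = 0%N.
  move=> h; have szE : size (rcons m 0%N ++ e) = (size m + size e).+1.
    by rewrite size_cat size_rcons.
  split=> [i hi|].
    by rewrite h ?szE ?nth_cat ?size_rcons; [rewrite ltnS (ltnW hi) nth_rcons hi | lia].
  by rewrite h ?szE ?nth_cat ?size_rcons; [rewrite ltnSn nth_rcons ltnn eqxx | lia].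
have [g1 g2] := get _ _ o; have [g1' g2'] := get _ _ o'.
have ll' : size l = size l'.
  case: (ltngtP (size l) (size l')) => // h.
    by have /allP/(_ _ (mem_nth 0%N h)) := nl'; rewrite -g1' // g2.
  by have /allP/(_ _ (mem_nth 0%N h)) := nl; rewrite -g1 // g2'.
have lE : l = l'.
  by apply: (@eq_from_nth _ 0%N) => // i hi; rewrite -g1 // -g1' // -ll'.
rewrite -lE in o' *; congr cons.
have sub e : (forall i, (i < size (rcons l 0%N ++ e))%N ->
      c (s + i)%N = nth 0%N (rcons l 0%N ++ e) i) -> occ c e (s + (size l).+1).
  move=> h; apply/occP => i hi; rewrite -addnA h.
    by rewrite nth_cat size_rcons ltnNge leq_addr /= addKn.
  by rewrite size_cat size_rcons; lia.
by apply: (IH d' _ sd nd nd' (sub _ o) (sub _ o')).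
Qed.

Lemma sum_uniq_le (f : nat -> nat) (l : seq nat) N : uniq l ->
  (forall k, k \in l -> (k < N)%N) -> (\sum_(k <- l) f k <= \sum_(k < N) f k)%N.
Proof.
move=> ul hl; rewrite -(big_mkord xpredT f) [X in (_ <= X)%N](bigID (mem l)) /=.
apply: leq_trans (leq_addr _ _); rewrite -[X in (_ <= X)%N]big_filter.
rewrite (perm_big [seq i <- index_iota 0 N | i \in l]) //; apply: uniq_perm => //.
  by rewrite filter_uniq ?iota_uniq.
by move=> k; rewrite mem_filter mem_index_iota; case: (boolP (k \in l)) => // /hl ->.
Qed.

Definition appeared (b : nat -> nat -> bool) (n : nat) (p : seq nat) (s : nat) : bool :=
  occ (colcode b) p s && all (fun i => time_of (colcode b) (s + i).+1 <= n)%N (iota 0 (size p)).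

(** The leading 0 is the record that opens the first block. *)
Definition pattern (d : seq (seq nat)) : seq nat := 0%N :: pat d.

Definition windows (r : nat) (d : seq (seq nat)) : bool :=
  (size d == r.*2.+1) && nonzero_blocks d.

Lemma appeared_match b n r (V : finType) (e : rel V) (h : V) d s :
  inf_ones b -> windows r d -> appeared b n (pattern d) s ->
  let x := map Posz (Iseq b n) in
  let k := (nrec (ext_code b) s.+1 + r)%N in
  [/\ (k < size (spine x))%N,
      block_count (spineBST x) r e h k (nth [::] (spine x) k) = block_num r e h d &
      (size (nth [::] (spine x) k)).+1 = block_size r d].
Proof.
move=> db /andP[/eqP sd nd] /andP[/occP o /allP t] x k.
have ecE i : ext_code b i.+1%:Z = colcode b i by [].
apply: (block_count_match e h (coded_ext db) (present_Iseq n db)) nd sd _ _ => //.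
- by rewrite ecE; have := o 0%N isT; rewrite addn0.
- move=> i hi; by rewrite addSn ecE o.
- move=> i /andP[i0 hi]; rewrite /ext_time /= addSn lez_nat.
  by apply: (t i); rewrite mem_iota.
Qed.

(** By unique parsing a position carries at most one pattern of [K], and distinct positions, being
    records, have distinct spine indices; the left side thus picks distinct terms of the right
    one. *)
Lemma sum_appeared_le b n r (V : finType) (e : rel V) (h : V)
    (K : seq (seq (seq nat))) (F : seq (seq nat) -> nat) (f : nat -> nat) :
  inf_ones b -> uniq K -> all (windows r) K ->
  let x := map Posz (Iseq b n) in
  (forall d s, d \in K -> appeared b n (pattern d) s ->
     F d = f (nrec (ext_code b) s.+1 + r)%N) ->
  (\sum_(d <- K) F d * count (appeared b n (pattern d)) (iota 0 n)
     <= \sum_(k < size (spine x)) f k)%N.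
Proof.
move=> db uK /allP wK x fE.
pose kk s := (nrec (ext_code b) s.+1 + r)%N.
pose hit s := has (fun d => appeared b n (pattern d) s) K.
have -> : (\sum_(d <- K) F d * count (appeared b n (pattern d)) (iota 0 n) =
    \sum_(s <- iota 0 n) \sum_(d <- K | appeared b n (pattern d) s) F d)%N.
  rewrite [RHS](exchange_big_dep xpredT) //=; apply: eq_bigr => d _.
  by rewrite -sum1_count big_distrr /=; apply: eq_bigr => s _; rewrite muln1.
have le1 s : (\sum_(d <- K | appeared b n (pattern d) s) F d <=
    if hit s then f (kk s) else 0)%N.
  case: ifPn => [/hasP[d0 d0K a0]|/hasPn nh]; last first.
    by rewrite big_seq_cond big1 // => d /andP[dK a]; have := nh d dK; rewrite a.
  rewrite (big_rem d0) //= a0 (fE _ _ d0K a0) -[X in (_ <= X)%N]addn0 leq_add2l.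
  rewrite leqn0; apply/eqP; rewrite big_seq_cond big1 // => d /andP[+ a].
  rewrite (mem_rem_uniq _ uK) inE => /andP[ne dK].
  move: a a0 => /andP[/occP o _] /andP[/occP o0 _].
  have sub d1 : (forall i, (i < size (pattern d1))%N ->
      colcode b (s + i) = nth 0%N (pattern d1) i) -> occ (colcode b) (pat d1) s.+1.
    by move=> h1; apply/occP => i hi; rewrite addSnnS h1.
  have /andP[/eqP sd nd] := wK _ dK; have /andP[/eqP sd0 nd0] := wK _ d0K.
  have E := pat_inj (etrans sd (esym sd0)) nd nd0 (sub _ o) (sub _ o0).
  by rewrite E eqxx in ne.
apply: (leq_trans (leq_sum _ (fun s _ => le1 s))).
rewrite -big_mkcond /= -big_filter -(big_map kk xpredT f); apply: sum_uniq_le.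
  rewrite map_inj_in_uniq ?filter_uniq ?iota_uniq // => s s'.
  rewrite !mem_filter => /andP[/hasP[d dK a] _] /andP[/hasP[d' dK' a'] _].
  have zero d1 s1 : appeared b n (pattern d1) s1 -> colcode b s1 = 0%N.
    by move=> /andP[/occP/(_ 0%N isT) + _]; rewrite addn0.
  have inc s1 s2 : (s1 < s2)%N -> colcode b s2 = 0%N -> (kk s1 < kk s2)%N.
    move=> s12 z; rewrite /kk ltn_add2r [X in (_ < X)%N]nrecS.
    have -> : ext_code b s2.+1%:Z = colcode b s2 by [].
    rewrite z eqxx addn1 ltnS.
    by have := subnKC s12; move: (s2 - s1.+1)%N => m <-; rewrite /nrec iotaD count_cat leq_addr.
  case: (ltngtP s s') => // ss' E.
    by have := inc _ _ ss' (zero _ _ a'); rewrite E ltnn.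
  by have := inc _ _ ss' (zero _ _ a); rewrite E ltnn.
move=> k /mapP[s]; rewrite mem_filter => /andP[/hasP[d dK a] _] ->.
by have [] := appeared_match e h db (wK _ dK) a.
Qed.

(** * Values that have not appeared by time [n] *)

Definition late (b : nat -> nat -> bool) (n : nat) : nat :=
  count (fun v => (n < time_of (colcode b) v.+1)%N) (iota 0 n).

Lemma count_has_le (T I : Type) (a : I -> pred T) (r : seq I) (l : seq T) :
  (count (fun s => has (fun i => a i s) r) l <= \sum_(i <- r) count (a i) l)%N.
Proof.
elim: r => [|i r IH]; first by rewrite big_nil (eq_count (a2 := pred0)) ?count_pred0.
rewrite big_cons; apply: leq_trans (leq_add (leqnn _) IH).
by rewrite -count_predUI leq_addr.
Qed.

(** An occurrence is lost only if one of its [size p] entries is late or lies beyond [n], and each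
    offset accounts for at most [late b n + size p] such losses. *)
Lemma count_occ_appeared b n p :
  (count (occ (colcode b) p) (iota 0 n) <=
   count (appeared b n p) (iota 0 n) + size p * (late b n + size p))%N.
Proof.
pose bad i s := (n <= s + i)%N || (n < time_of (colcode b) (s + i).+1)%N.
have step i : (i < size p)%N -> (count (bad i) (iota 0 n) <= late b n + size p)%N.
  move=> hi; pose bad0 v := (n <= v)%N || (n < time_of (colcode b) v.+1)%N.
  have E : count (bad i) (iota 0 n) = count bad0 (iota i n).
    by rewrite -[in RHS](addn0 i) iotaDl count_map; apply: eq_count => s /=; rewrite /bad addnC.
  rewrite E (leq_trans (n := count bad0 (iota 0 (i + n)))) //.
    by rewrite iotaD count_cat add0n leq_addl.
  rewrite addnC iotaD count_cat leq_add //.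
    rewrite /late -!size_filter uniq_leq_size ?filter_uniq ?iota_uniq // => v.
    by rewrite !mem_filter mem_iota /bad0; lia.
  by rewrite (leq_trans (count_size _ _)) // size_iota ltnW.
apply: (@leq_trans (count (predU (appeared b n p)
    (fun s => has (fun i => bad i s) (iota 0 (size p)))) (iota 0 n))).
  apply: sub_count => s os; rewrite /= /appeared os /=.
  rewrite -implyNb; apply/implyP => /allPn[i iP ti].
  apply/hasP; exists i => //; rewrite /bad; lia.
apply: (@leq_trans (count (appeared b n p) (iota 0 n) +
   count (fun s => has (fun i => bad i s) (iota 0 (size p))) (iota 0 n))).
  by rewrite -count_predUI leq_addr.
rewrite leq_add2l (leq_trans (count_has_le _ _ _)) //.
apply: (@leq_trans (\sum_(0 <= i < size p) (late b n + size p))); last first.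
  by rewrite sum_nat_const_nat subn0.
rewrite /index_iota subn0 big_seq [X in (_ <= X)%N]big_seq; apply: leq_sum => i.
by rewrite mem_iota => hi; apply: step.
Qed.

(** The last [C] values are given up; by [time_of_le], any other late value has code at least
    [C]. *)
Lemma late_le b n C : (late b n <= C + count (fun v => (C <= colcode b v)%N) (iota 0 n))%N.
Proof.
rewrite /late; have [nC|Cn] := leqP n C.
  by rewrite (leq_trans (count_size _ _)) // size_iota; lia.
have -> : iota 0 n = iota 0 (n - C) ++ iota (n - C) C.
  by rewrite -{2}(add0n (n - C)%N) -iotaD subnK // ltnW.
rewrite !count_cat addnC.
rewrite leq_add //.
  by rewrite (leq_trans (count_size _ _)) // size_iota.
rewrite (leq_trans _ (leq_addr _ _)) //.
rewrite -!size_filter uniq_leq_size ?filter_uniq ?iota_uniq // => v.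
rewrite !mem_filter !mem_iota => /andP[tv hv]; rewrite hv andbT.
by have := @time_of_le (colcode b) v.+1 isT; rewrite /=; lia.
Qed.

(** * The partition interleaving the two halves *)

Definition fin_supp (M : nat -> nat) : Prop := exists N, forall j, (N < j)%N -> M j = 0%N.

Definition supp_bound (M : nat -> nat) : nat :=
  match pselect (fin_supp M) with left H => proj1_sig (cid H) | right _ => 0%N end.

(* The conjugate partition: [tail M t] is the number of parts larger than [t]. *)
Definition tail (M : nat -> nat) (t : nat) : nat :=
  \sum_(t.+1 <= j < (supp_bound M).+1) M j.

Lemma tailS M t : fin_supp M -> tail M t = (M t.+1 + tail M t.+1)%N.
Proof.
rewrite /tail /supp_bound => fM; case: pselect => // H; case: (cid H) => N hN /=.
case: (ltnP t.+1 N.+1) => h; first by rewrite big_ltn.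
by rewrite !big_geq ?hN //; lia.
Qed.

Lemma tail0 M : fin_supp M -> exists N, forall t, (N <= t)%N -> tail M t = 0%N.
Proof.
rewrite /tail /supp_bound => fM; case: pselect => // H; case: (cid H) => N hN /=.
by exists N => t Nt; rewrite big_geq.
Qed.

Lemma tail_le M t t' : fin_supp M -> (t <= t')%N -> (tail M t' <= tail M t)%N.
Proof.
move=> fM /subnKC <-; elim: (t' - t)%N => [|k IH]; first by rewrite addn0.
by rewrite (leq_trans _ IH) // addnS [X in (_ <= X)%N]tailS // leq_addl.
Qed.

Lemma prefix_count (p : pred nat) N t : (forall i, p i.+1 -> p i) -> ~~ p N ->
  (t < count p (iota 0 N))%N = p t.
Proof.
move=> pS; have pD i j : (i <= j)%N -> p j -> p i.
  by move=> /subnKC <-; elim: (j - i)%N => [|k IH]; rewrite ?addn0 // addnS => /pS.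
elim: N => [|N IH] pN.
  by apply/esym/negbTE; apply: contra pN; apply: pD.
rewrite -(addn1 N) iotaD count_cat /= addn0 add0n.
have [pn|npn] := boolP (p N); last by rewrite addn0 IH.
have -> : count p (iota 0 N) = N.
  rewrite -[RHS](size_iota 0); apply/eqP; rewrite -all_count; apply/allP => i.
  by rewrite mem_iota => hi; apply: (pD _ N) => //; lia.
rewrite addn1 ltnS; case: leqP => h; first by rewrite (pD _ N).
by apply/esym/negbTE; apply: contra pN; apply: pD.
Qed.

Lemma count_le_iota b N : (b <= N)%N -> count (fun j => (j <= b)%N) (iota 1 N) = b.
Proof.
move=> bN; rewrite -(subnKC bN) iotaD count_cat.
have -> : count (fun j => (j <= b)%N) (iota 1 b) = b.
  by rewrite -[RHS](size_iota 1); apply/eqP; rewrite -all_count; apply/allP => i;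
    rewrite mem_iota; lia.
rewrite -[RHS]addn0; congr addn; apply/eqP; rewrite -leqn0 leqNgt -has_count.
by apply/hasPn => i; rewrite mem_iota -ltnNge; lia.
Qed.

(** Conjugation of partitions: the parts being nonincreasing, those larger than [t] are the first
    [tail M t] ones. *)
Lemma is_Lambda_tail M L t j : fin_supp M -> is_Lambda M L -> (0 < j)%N ->
  (t < L j)%N = (j <= tail M t)%N.
Proof.
move=> fM [Ldec [N [LN LM]]] j0.
have [N0 hN0] := tail0 fM.
have cE t0 : count (fun j => (t0 < L j)%N) (iota 1 N) = tail M t0.
  have [fN hfN] := fM; have [k] := ubnP (fN + N0 - t0)%N; elim: k t0 => // k IH t0 hk.
  case: (leqP (fN + N0)%N t0) => ht.
    rewrite hN0; last by lia.
    apply/eqP; rewrite -leqn0 leqNgt -has_count; apply/hasPn => i iN.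
    rewrite -leqNgt leqNgt; apply/negP => tL.
    have := LM (L i) ltac:(lia); rewrite hfN; last by lia.
    by move=> /eqP; rewrite -leqn0 leqNgt -has_count => /hasPn/(_ i iN); rewrite eqxx.
  rewrite tailS // -LM // -IH; last by lia.
  rewrite -count_predUI [X in (_ + X)%N](_ : _ = 0%N) ?addn0; last first.
    by apply/eqP; rewrite -leqn0 leqNgt -has_count; apply/hasPn => i _ /=; lia.
  by apply: eq_count => i /=; lia.
have := @prefix_count (fun i => (t < L i.+1)%N) N j.-1.
rewrite prednK // => <- //; last by rewrite LN //; lia.
  suff -> : count (fun i => (t < L i.+1)%N) (iota 0 N) = tail M t by [].
  by rewrite -cE -[iota 1 N]/(iota (1 + 0) N) iotaDl count_map.
by move=> i h; rewrite (leq_trans h) // Ldec.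
Qed.

Lemma is_Lambda_exists M : fin_supp M -> exists L, is_Lambda M L.
Proof.
move=> fM; have [N hN] := tail0 fM.
pose L j := count (fun t => (j <= tail M t)%N) (iota 0 N).
have LP t j : (0 < j)%N -> (t < L j)%N = (j <= tail M t)%N.
  move=> j0; apply: prefix_count => [i|]; last by rewrite hN // -ltnNge.
  by move=> h; apply: leq_trans h _; apply: tail_le.
exists L; split.
  by move=> j j1; apply: sub_count => t /=; lia.
exists (tail M 0).+1; split.
  move=> j hj; apply/eqP; rewrite -leqn0 leqNgt LP; lia.
move=> i i1.
have i0 : tail M i.-1 = (M i + tail M i)%N by rewrite tailS // prednK.
have le0 := tail_le fM (leq0n i.-1).
have E : (count (fun j => (j <= tail M i.-1)%N) (iota 1 (tail M 0).+1) =
  count (fun j => L j == i) (iota 1 (tail M 0).+1) +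
  count (fun j => (j <= tail M i)%N) (iota 1 (tail M 0).+1))%N.
  rewrite -count_predUI [X in (_ + X)%N](_ : _ = 0%N) ?addn0; last first.
    apply/eqP; rewrite -leqn0 leqNgt -has_count; apply/hasPn => j; rewrite mem_iota => hj /=.
    by rewrite -LP; lia.
  apply: eq_in_count => j; rewrite mem_iota => hj /=.
  by rewrite -!LP; lia.
by move: E; rewrite !count_le_iota; lia.
Qed.

(** A closed form for the decreasing enumeration of the complement of the [i - L i]: the Maya
    diagram of the partition, read through its conjugate. *)
Definition gap_pos (M : nat -> nat) (t : nat) : int := (tail M t)%:Z - t%:Z.

Lemma gap_pos_cmp M L t i : fin_supp M -> is_Lambda M L -> (0 < i)%N ->
  if (i <= tail M t)%N then i%:Z - (L i)%:Z < gap_pos M t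
  else gap_pos M t < i%:Z - (L i)%:Z.
Proof.
move=> fM LM i0; rewrite /gap_pos; have := is_Lambda_tail t fM LM i0.
by case: ifP; lia.
Qed.

Lemma gap_pos_dec M t : fin_supp M -> gap_pos M t.+1 < gap_pos M t.
Proof. by move=> fM; rewrite /gap_pos; have := tail_le fM (leqnSn t); lia. Qed.

Lemma gap_pos_lt M t t' : fin_supp M -> (gap_pos M t < gap_pos M t') = (t' < t)%N.
Proof.
move=> fM; have h a b : (a < b)%N -> gap_pos M b < gap_pos M a.
  by move=> ab; rewrite /gap_pos; have := tail_le fM (ltnW ab); lia.
by case: (ltngtP t' t) => [/h|/h|->]; lia.
Qed.

Lemma gap_posP M L (z : int) : fin_supp M -> is_Lambda M L ->
  (forall i, (1 <= i)%N -> (i%:Z - (L i)%:Z) != z) <-> exists m, gap_pos M m = z.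
Proof.
move=> fM LM; split=> [h|[m <-] i i0]; last first.
  by have := gap_pos_cmp m fM LM i0; case: ifP; lia.
have ex : exists t, gap_pos M t <= z.
  exists (tail M 0 + `|z|)%N; rewrite /gap_pos.
  by have := tail_le fM (leq0n (tail M 0 + `|z|)%N); lia.
case: (ex_minnP ex) => t le_t tmin; exists t; apply/eqP; rewrite eq_le le_t /=.
rewrite leNgt; apply/negP => lt_t.
have zt : 0 < z + t%:Z by rewrite /gap_pos in lt_t; lia.
(* Above gap [t] and, if [t > 0], below gap [t - 1], the site [z] holds the particle of index
   [z + t], whose part is [t]. *)
have := h `|(z + t%:Z)%R|%N ltac:(lia).
have LE t0 := is_Lambda_tail t0 fM LM (j := `|(z + t%:Z)%R|%N) ltac:(lia).
suff -> : L `|(z + t%:Z)%R|%N = t by lia.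
have := LE t; rewrite /gap_pos in lt_t tmin.
case: t {le_t ex zt h} lt_t tmin LE => [|t] lt_t tmin LE; first by lia.
have := LE t; have := tmin t; rewrite /gap_pos; lia.
Qed.

(** The specification of the two-sided permutation leaves its enumeration [k] abstract; uniqueness
    identifies it with [gap_pos]. *)
Lemma dec_enum_unique (k k' : nat -> int) : (forall m, k m.+1 < k m) ->
  (forall m, k' m.+1 < k' m) -> (forall z, (exists m, k m = z) <-> (exists m, k' m = z)) ->
  k = k'.
Proof.
have lt_ (f : nat -> int) : (forall m, f m.+1 < f m) -> forall a b : nat, (a < b)%N -> f b < f a.
  move=> fS a b /subnKC <-; elim: (b - a.+1)%N => [|j IH]; first by rewrite addn0.
  by apply: lt_trans IH; rewrite addnS.
move=> kS kS' kk'; apply/funext => m.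
have [n] := ubnP m; elim: n m => // n IH m hm.
have half (f f' : nat -> int) : (forall m, f m.+1 < f m) -> (forall m, f' m.+1 < f' m) ->
    (forall i, (i < m)%N -> f i = f' i) ->
    (forall z, (exists m, f m = z) -> (exists m, f' m = z)) -> f m <= f' m.
  move=> fS fS' E ff'; have [n' n'E] := ff' (f m) (ex_intro _ m erefl).
  case: (ltngtP n' m) => [lt_n|lt_n|nm]; last by rewrite -n'E nm.
    by have := lt_ f fS _ _ lt_n; rewrite -n'E E // ltxx.
  by rewrite -n'E ltW // lt_.
apply/eqP; rewrite eq_le !half // => [i hi|z /kk'//|i hi|z /kk'//].
- by rewrite IH //; lia.
- by rewrite IH //; lia.
Qed.

Lemma ell_lt M L i j : is_Lambda M L -> (0 < i)%N -> (i < j)%N ->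
  i%:Z - (L i)%:Z < j%:Z - (L j)%:Z.
Proof.
move=> [Ldec _] i0 /subnKC <-; elim: (j - i.+1)%N => [|k IH].
  by rewrite addn0; have := Ldec i i0; lia.
apply: lt_trans IH _; rewrite addnS; have := Ldec (i.+1 + k)%N ltac:(lia); lia.
Qed.

Lemma ell_lt_mono M L i j : is_Lambda M L -> (0 < i)%N -> (0 < j)%N ->
  (i%:Z - (L i)%:Z < j%:Z - (L j)%:Z) = (i < j)%N.
Proof.
move=> LM i0 j0; case: (ltngtP i j) => [/(ell_lt LM i0)//|h|->]; last by rewrite ltxx.
by have := ell_lt LM j0 h; lia.
Qed.

Lemma two_sided_exists Pp Pm M : fin_supp M -> exists X, two_sided_spec Pp Pm M X.
Proof.
move=> fM; have [L LM] := is_Lambda_exists fM.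
pose X z := match pselect (exists i, (0 < i)%N /\ i%:Z - (L i)%:Z = z) with
  | left H => (Pp (proj1_sig (cid H)))%:Z
  | right _ => match pselect (exists m, gap_pos M m = z) with
    | left H => 1 - (Pm (1 + proj1_sig (cid H))%N)%:Z
    | right _ => 0
    end
  end.
exists X, L, (gap_pos M); split=> //.
- by move=> m; apply: gap_pos_dec.
- by move=> z; apply: gap_posP.
- move=> i i0; rewrite /X; case: pselect => [H|nH]; last by exfalso; apply: nH; exists i.
  case: (cid H) => i' /= [i'0 E].
  have := ell_lt_mono LM i'0 i0; have := ell_lt_mono LM i0 i'0; rewrite E ltxx => h1 h2.
  by have -> : i' = i by lia.
- move=> m; rewrite /X; case: pselect => [[i [i0 E]]|_].
    by exfalso; have := gap_pos_cmp m fM LM i0; rewrite E ltxx; case: ifP.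
  case: pselect => [H|nH]; last by exfalso; apply: nH; exists m.
  case: (cid H) => m' /= E.
  have := gap_pos_lt m m' fM; have := gap_pos_lt m' m fM; rewrite E ltxx => h1 h2.
  by have -> : m' = m by lia.
Qed.

(** * The codes of the two-sided permutation *)

(* Turning one gap into a particle: the gaps to its right see one more particle to
   their left. *)
Fixpoint shifted (g S : nat -> nat) (u : nat) : nat -> nat :=
  if u is u'.+1 then fun i => (shifted g S u' (bump (g u') i) + (i < g u'))%N else S.

Definition left_code (g S : nat -> nat) (u : nat) : nat := shifted g S u (g u).

(** A remaining gap has on its left the original particles, plus the filled gaps of larger index,
    since gaps are numbered from right to left. *)
Lemma shiftedE g S u i : shifted g S u i =
  (S (unused g u i).-1 +
   count (fun u' => (unused g u i < time_of g u')%N) (iota 1 u))%N.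
Proof.
elim: u i => [|u IH] i; first by rewrite addn0.
rewrite [LHS]/= IH -[in RHS](addn1 u) iotaD count_cat /= addn0 add1n -addnA addn1.
congr addn; congr addn; rewrite /time_of /= unused_lt_mono /bump; lia.
Qed.

Definition code2 (bp bm : nat -> nat -> bool) (M : nat -> nat) (v : int) : nat :=
  if 0 < v then colcode bp `|v|%N.-1 else left_code (colcode bm) (tail M) `|v|%N.

(** The last clause takes the place of admissibility: values bounded below occur only at positions
    bounded below. *)
Lemma coded_two_sided bp bm M X : inf_ones bp -> inf_ones bm -> fin_supp M ->
  two_sided_spec (Ival bp) (Ival bm) M X ->
  exists tau, [/\ cancel tau X, cancel X tau, coded tau (code2 bp bm M) &
    forall v : int, exists p : int, forall v' : int, v <= v' -> p <= tau v'].
Proof.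
move=> dp dm fM [L [k [LM kdec kP Xl Xk]]].
have kE : k = gap_pos M.
  apply: dec_enum_unique => // [m|z]; first exact: gap_pos_dec.
  by rewrite -kP; apply: gap_posP.
pose tp v := time_of (colcode bp) v; pose tm v := time_of (colcode bm) v.
pose ell (i : nat) := i%:Z - (L i)%:Z : int.
pose tau (v : int) := if 0 < v then ell (tp `|v|%N) else gap_pos M (tm `|(1 - v)%R|%N).-1.
have tp0 v : (0 < tp v)%N by apply: time_of_gt0.
have tm0 v : (0 < tm v)%N by apply: time_of_gt0.
have tauK : cancel tau X.
  move=> v; rewrite /tau; case: ifP => hv.
    by rewrite Xl // Ival_time_of //; lia.
  by rewrite -kE Xk add1n prednK // Ival_time_of //; lia.
have XK : cancel X tau.
  move=> z; have [[i i0 <-]|nex] := pselect (exists2 i, (0 < i)%N & ell i = z).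
    rewrite Xl // /tau ltz_nat Ival_gt0 // absz_nat /tp time_of_Ival //.
  have [|m <-] := (gap_posP z fM LM).1.
    by move=> i i0; apply/eqP => E; apply: nex; exists i.
  rewrite -kE Xk /tau; have I0 := Ival_gt0 dm (i := (1 + m)%N) isT.
  have -> : (0 < 1 - (Ival bm (1 + m))%:Z :> int) = false by lia.
  have -> : `|(1 - (1 - (Ival bm (1 + m))%:Z))%R|%N = Ival bm (1 + m) by lia.
  by rewrite /tm time_of_Ival // kE.
exists tau; split=> //; last first.
  have H (n : nat) : exists p : int, forall v' : int, 1 - n%:Z <= v' -> p <= tau v'.
    elim: n => [|n [p hp]].
      exists (ell 1%N) => v' hv'; rewrite /tau; have -> : 0 < v' by lia.
      by rewrite leNgt (ell_lt_mono LM) // -leqNgt tp0.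
    exists (Num.min p (tau (- n%:Z))) => v' hv'; rewrite ge_min.
    case: (eqVneq v' (- n%:Z)) => [->|ne]; first by rewrite lexx orbT.
    by rewrite hp //; lia.
  move=> v; have [p hp] := H `|(1 - v)%R|%N; exists p => v' hv'.
  by apply: hp; lia.
split; first exact: can_inj tauK.
move=> v; rewrite /code2; case: ifP => hv.
  apply: (@has_card_map _ _ Posz) (code_card dp (v := `|v|%N) ltac:(lia)) _.
    by move=> i j [].
  move=> x; rewrite /tau hv; split=> [[vx]|[y [h1 h2] ->]].
    have -> : 0 < x by lia.
    rewrite (ell_lt_mono LM) // => h; exists `|x|%N; [split=> //; lia | lia].
  have y0 : 0 < y%:Z by lia.
  by rewrite y0 absz_nat (ell_lt_mono LM) //; split=> //; lia.
pose u := `|v|%N.+1.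
have vE : v = 1 - u%:Z by lia.
rewrite /left_code shiftedE -/(time_of (colcode bm) u) -/(tm u).
(* The larger values to the left of [v]: positive ones, on the particles left of its gap, then
   nonpositive ones, in gaps of larger index. *)
exists ([seq Posz (Ival bp i) | i <- iota 1 (tail M (tm u).-1)] ++
  [seq 1 - Posz w | w <- iota 1 u.-1 & (tm u < tm w)%N]); split.
- rewrite cat_uniq; apply/and3P; split.
  + rewrite map_inj_in_uniq ?iota_uniq // => i j; rewrite !mem_iota => hi hj [] E.
    by rewrite -(time_of_Ival dp (i := i)) ?E ?time_of_Ival //; lia.
  + apply/hasPn => x /mapP[w]; rewrite mem_filter mem_iota => /andP[_ wP] ->.
    apply/mapP => -[i]; rewrite mem_iota => hi.
    by have := Ival_gt0 dp (i := i) ltac:(lia); lia.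
  + by rewrite map_inj_uniq ?filter_uniq ?iota_uniq // => i j; lia.
- by rewrite size_cat !size_map size_iota size_filter.
move=> x; rewrite mem_cat; have tvE : tau v = gap_pos M (tm u).-1.
  by rewrite /tau hv; congr (gap_pos M (tm _).-1); lia.
rewrite tvE; split.
- case/orP=> [/mapP[i]|/mapP[w]].
    rewrite mem_iota => hi ->; have i0 : (0 < i)%N by lia.
    have I0 := Ival_gt0 dp i0; split; first by lia.
    rewrite /tau ltz_nat I0 absz_nat /tp time_of_Ival //.
    by have := gap_pos_cmp (tm u).-1 fM LM i0; case: ifP => //; lia.
  rewrite mem_filter mem_iota => /andP[tt hw] ->; split; first by lia.
  have -> : tau (1 - w%:Z) = gap_pos M (tm w).-1.
    rewrite /tau; have -> : (0 < 1 - w%:Z :> int) = false by lia.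
    by congr (gap_pos M (tm _).-1); lia.
  by rewrite gap_pos_lt //; have := tm0 u; lia.
- move=> [vx]; rewrite /tau; case: ifP => hx h; apply/orP; [left|right].
    apply/mapP; exists (tp `|x|%N); last by rewrite Ival_time_of //; lia.
    rewrite mem_iota; have := gap_pos_cmp (tm u).-1 fM LM (tp0 `|x|%N).
    by have := tp0 `|x|%N; case: ifP => hh; rewrite -/(ell _); lia.
  apply/mapP; exists `|(1 - x)%R|%N; last by lia.
  rewrite mem_filter mem_iota; move: h; rewrite gap_pos_lt // => h.
  by have := tm0 u; have := tm0 `|(1 - x)%R|%N; lia.
Qed.

(** * Records of a two-sided permutation *)

Lemma int_max (A : int -> Prop) (m a : int) : A a -> (forall x, A x -> x <= m) ->
  exists2 x, A x & forall y, A y -> y <= x.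
Proof.
move=> Aa hm; pose p n := `[< A (m - n%:Z) >].
have ex : exists n, p n.
  by exists `|(m - a)%R|%N; apply/asboolP; have := hm _ Aa; move=> h;
    have -> : m - `|(m - a)%R|%N%:Z = a by lia.
case: (ex_minnP ex) => n /asboolP An nmin; exists (m - n%:Z) => // y Ay.
have := nmin `|(m - y)%R|%N; have := hm _ Ay => h; rewrite /p.
have -> : m - `|(m - y)%R|%N%:Z = y by lia.
by move=> /(_ ltac:(exact/asboolP)); lia.
Qed.

Lemma int_min (A : int -> Prop) (m a : int) : A a -> (forall x, A x -> m <= x) ->
  exists2 x, A x & forall y, A y -> x <= y.
Proof.
move=> Aa hm; have [] := @int_max (fun x => A (- x)) (- m) (- a).
- by rewrite opprK.
- by move=> x /hm; lia.
- by move=> x Ax xmax; exists (- x) => // y Ay; have := xmax (- y); rewrite opprK => /(_ Ay); lia.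
Qed.

(** Iterate next and previous elements from the largest element that is at most 0; this starting
    point gives the required indexing. *)
Lemma int_enum (Z : int -> Prop) : (forall v : int, exists2 z : int, Z z & v < z) ->
  (forall v : int, exists2 z : int, Z z & z < v) ->
  exists f : int -> int, [/\ (forall k, f k < f (k + 1)),
    (forall z, Z z <-> exists k, f k = z) & f 0 <= 0 < f 1].
Proof.
move=> up dn.
have /choice[nx nxP] : forall v : int, exists w : int, [/\ Z w, v < w & forall y, Z y -> v < y -> w <= y].
  move=> v; have [z Zz vz] := up v.
  have [||w [Zw vw] wmin] := @int_min (fun y => Z y /\ v < y) v z; [by [] | by move=> x []; lia |].
  by exists w; split=> // y Zy vy; apply: wmin.
have /choice[pv pvP] : forall v : int, exists w : int, [/\ Z w, w < v & forall y, Z y -> y < v -> y <= w].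
  move=> v; have [z Zz zv] := dn v.
  have [||w [Zw vw] wmax] := @int_max (fun y => Z y /\ y < v) v z; [by [] | by move=> x []; lia |].
  by exists w; split=> // y Zy vy; apply: wmax.
pose z0 := pv 1.
have [Zz0 z01 z0max] : [/\ Z z0, z0 < 1 & forall y, Z y -> y < 1 -> y <= z0] := pvP 1.
pose f (k : int) : int := match k with Posz n => iter n nx z0 | Negz n => iter n.+1 pv z0 end.
have Zf k : Z (f k).
  by case: k => [[//|n]|n] /=; [have [] := nxP (iter n nx z0) | have [] := pvP (iter n pv z0)].
exists f; split.
- case=> [n|[|n]].
  + have -> : Posz n + 1 = Posz n.+1 by lia.
    by have [] := nxP (f n).
  + by have [] := pvP z0.
  + have -> : Negz n.+1 + 1 = Negz n by lia.
    by have [] := pvP (f (Negz n)).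
- move=> z; split=> [Zz|[k <-]]; last exact: Zf.
  have [zz0|zz0] := leP z0 z.
    have grow n : z0 + n%:Z <= f (Posz n).
      by elim: n => [|n IH] /=; [lia | have [_ + _] := nxP (f (Posz n)); rewrite /= in IH *; lia].
    have ex : exists n, z <= f (Posz n).
      by exists `|(z - z0)%R|%N; have := grow `|(z - z0)%R|%N; lia.
    case: (ex_minnP ex) => -[|n] hn nmin; first by exists 0; rewrite /= in hn *; lia.
    have lt : f (Posz n) < z by have := nmin n; lia.
    have [_ _ /(_ _ Zz lt) le] := nxP (f (Posz n)).
    by exists (Posz n.+1); apply/eqP; rewrite eq_le hn andbT; apply: le.
  have grow n : f (Negz n) <= z0 - n.+1%:Z.
    elim: n => [|n IH] /=; first by have [_ + _] := pvP z0; lia.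
    by have [_ + _] := pvP (f (Negz n)); rewrite /= in IH *; lia.
  have ex : exists n, f (Negz n) <= z.
    by exists `|(z - z0)%R|%N; have := grow `|(z - z0)%R|%N; lia.
  case: (ex_minnP ex) => -[|n] hn nmin.
    have [_ _ /(_ _ Zz zz0) le] := pvP z0.
    by exists (Negz 0); apply/eqP; rewrite eq_le hn; apply: le.
  have lt : z < f (Negz n) by have := nmin n; lia.
  have [_ _ /(_ _ Zz lt) le] := pvP (f (Negz n)).
  by exists (Negz n.+1); apply/eqP; rewrite eq_le hn; apply: le.
- apply/andP; split; first by rewrite /=; lia.
  have [Z1 lt1 _] := nxP z0; rewrite [f 1]/= ltNge; apply/negP => le.
  by have := z0max _ Z1 ltac:(lia); lia.
Qed.

Lemma is_record_code tau X c i : cancel tau X -> cancel X tau -> coded tau c ->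
  is_record X i <-> c (X i) = 0%N.
Proof.
move=> tauK XK cod; have [inj hc] := cod; split=> [rec|c0 j ji].
  have [[|w s] [_ <- hs]] := hc (X i) => //.
  have [h1 h2] : X i < w /\ tau w < tau (X i) by apply/hs; rewrite inE eqxx.
  by have := rec (tau w); rewrite XK in h2 => /(_ h2); rewrite tauK; lia.
rewrite ltNge le_eqVlt; apply/negP => /orP[/eqP E|lt].
  by have := congr1 tau E; rewrite !XK; lia.
by have := coded_rec cod c0 lt; rewrite !XK; lia.
Qed.

(** Records are unbounded both ways: the earliest value above [v] is a record, and so is the largest
    of the values placed before [p], all of which are below [v]. *)
Lemma record_rep_exists tau X c : cancel tau X -> cancel X tau -> coded tau c ->
  (forall v : int, exists p : int, forall v' : int, v <= v' -> p <= tau v') ->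
  exists rr, record_rep_spec X rr.
Proof.
move=> tauK XK cod low; have [inj hc] := cod.
have zero z : (forall v', z < v' -> tau z < tau v') -> c z = 0%N.
  move=> h; have [[|w s] [_ <- hs]] := hc z => //.
  have [h1 h2] : z < w /\ tau w < tau z by apply/hs; rewrite inE eqxx.
  by have := h _ h1; lia.
have [] := @int_enum (fun z => c z = 0%N).
- move=> v; have [p hp] := low v.
  have [||t [w vw ->] tmin] := @int_min (fun t => exists2 w, v < w & t = tau w) p (tau (v + 1)).
  + by exists (v + 1) => //; lia.
  + by move=> x [w vw ->]; apply: hp; lia.
  exists w => //; apply: zero => v' wv'.
  have := tmin (tau v') ltac:(by exists v' => //; lia).
  by rewrite le_eqVlt => /orP[/eqP/inj|//]; lia.
- move=> v; have [p hp] := low v.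
  have lt i : i < p -> X i < v.
    by move=> ip; rewrite ltNge; apply/negP => /hp; rewrite XK; lia.
  have [||z [i ip ->] zmax] := @int_max (fun z => exists2 i, i < p & z = X i) v (X (p - 1)).
  + by exists (p - 1) => //; lia.
  + by move=> x [i ip ->]; have := lt i ip; lia.
  exists (X i); last exact: lt.
  apply: zero => v' iv'; rewrite ltNge XK; apply/negP => le.
  by have := zmax v' ltac:(by exists (tau v'); [lia | rewrite tauK]); lia.
move=> f [fS fP f01]; exists (tau \o f); split=> /=.
- by move=> k; apply: (coded_rec cod) => //; apply/fP; exists k.
- move=> i; rewrite (is_record_code i tauK XK cod) fP.
  by split=> -[k kE]; exists k; rewrite ?kE // -kE tauK.
- by rewrite !tauK.
Qed.

(** * The redwood tree read off the codes *)

Lemma record_repP X : (exists rr, record_rep_spec X rr) ->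
  record_rep_spec X (record_rep X).
Proof. by rewrite /record_rep; case: pselect => // H _; case: (cid H). Qed.

Lemma int_lt_homo (z : int -> int) : (forall k, z k < z (k + 1)) ->
  forall j k : int, j < k -> z j < z k.
Proof.
move=> zS j k jk; have -> : k = j + 1 + `|(k - j - 1)%R|%N%:Z by lia.
elim: `|(k - j - 1)%R|%N => [|n IH]; first by rewrite addr0.
apply: lt_trans IH _; have -> : j + 1 + n.+1%:Z = j + 1 + n%:Z + 1 by lia.
exact: zS.
Qed.

Lemma BST_sigma_block tau X c k : cancel tau X -> cancel X tau -> coded tau c ->
  let z k := X (record_rep X k) in z k < z (k + 1) ->
  BST (sigma_block X k) = tr (codes c (z k + 1) `|(z (k + 1)%R - z k - 1)%R|%N).
Proof.
move=> tauK XK cod z zk; have zE j : X (record_rep X j) = z j by [].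
rewrite /sigma_block; case: pselect => [H|nH]; last first.
  exfalso; apply: nH.
  pose vs : seq int := [seq z k + 1 + Posz i | i <- iota 0 `|(z (k + 1)%R - z k - 1)%R|%N].
  exists (map X (sort <=%R (map tau vs))), (sort <=%R (map tau vs)); split=> //.
    rewrite sort_lt_sorted map_inj_uniq; last exact: can_inj tauK.
    by rewrite map_inj_uniq ?iota_uniq // => i j; lia.
  move=> i; rewrite mem_sort !zE; split=> [/mapP[v /mapP[j]]|h].
    by rewrite mem_iota add0n => /= hj vE ->; rewrite tauK vE; lia.
  rewrite -(XK i); apply/map_f/mapP; exists `|(X i - z k - 1)%R|%N; last by lia.
  by rewrite mem_iota; lia.
case: (cid H) => s [idx [si hi sE]] /=; rewrite sE.
apply: (BST_block cod).
  rewrite sorted_map; apply: sub_sorted si => i j ij /=.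
  by rewrite !XK.
move=> v; split=> [/mapP[i /hi]|h].
  by rewrite !zE => h ->; lia.
by rewrite -(tauK v); apply/map_f/hi; rewrite tauK !zE; lia.
Qed.

Definition offset (s0 : int) (d : seq (seq nat)) (j : nat) : int :=
  s0 + (size (pat (take j d)))%:Z.

Lemma pat_cat d d' : pat (d ++ d') = pat d ++ pat d'.
Proof. by rewrite /pat map_cat flatten_cat. Qed.

Lemma offsetS s0 d j : (j < size d)%N ->
  offset s0 d j.+1 = offset s0 d j + (size (nth [::] d j)).+1%:Z.
Proof.
move=> hj; rewrite /offset (take_nth [::]) // -cats1 pat_cat size_cat.
by rewrite /pat /= cats0 size_rcons; lia.
Qed.

Lemma pat_nth d j : (j < size d)%N ->
  pat d = pat (take j d) ++ rcons (nth [::] d j) 0%N ++ pat (drop j.+1 d).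
Proof.
move=> hj; rewrite -{1}(cat_take_drop j d) pat_cat (drop_nth [::]) //.
Qed.

(** The central block surrounds the origin just as the block between the records of index 0 and 1
    does in the standard representation. *)
Definition centered (r : nat) (d : seq (seq nat)) (s0 : int) : Prop :=
  offset s0 d r <= 0 < offset s0 d r.+1.

Definition matches (c : int -> nat) (d : seq (seq nat)) (s0 : int) : Prop :=
  forall i, (i < size (pattern d))%N -> c (s0 + i%:Z) = nth 0%N (pattern d) i.

Lemma matches_rec c d s0 j : matches c d s0 -> (j <= size d)%N -> c (offset s0 d j) = 0%N.
Proof.
move=> m; case: j => [|j] hj.
  by rewrite /offset take0 addr0; have := m 0%N isT; rewrite addr0.
rewrite offsetS // /offset -addrA -PoszD m /pattern /=; last first.
  by rewrite (pat_nth hj) !size_cat size_rcons; lia.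
rewrite (pat_nth hj) addnS /= nth_cat ltnNge leq_addr /= addKn.
by rewrite nth_cat size_rcons ltnSn nth_rcons ltnn eqxx.
Qed.

Lemma matches_block c d s0 j : matches c d s0 -> (j < size d)%N ->
  codes c (offset s0 d j + 1) (size (nth [::] d j)) = nth [::] d j.
Proof.
move=> m hj; apply: (@eq_from_nth _ 0%N) => [|i]; rewrite size_codes // => hi.
rewrite nth_codes //.
have -> : offset s0 d j + 1 + i%:Z = s0 + (size (pat (take j d)) + i).+1%:Z.
  by rewrite /offset; lia.
rewrite m /pattern /=; last by rewrite (pat_nth hj) !size_cat size_rcons; lia.
rewrite (pat_nth hj) nth_cat ltnNge leq_addr /= addKn.
by rewrite nth_cat size_rcons ltnS (ltnW hi) nth_rcons hi.
Qed.

Lemma matches_nonrec c d s0 j v : matches c d s0 -> nonzero_blocks d -> (j < size d)%N ->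
  offset s0 d j < v < offset s0 d j.+1 -> c v != 0%N.
Proof.
move=> m nz hj; rewrite offsetS // => hv.
have hi : (`|(v - offset s0 d j - 1)%R| < size (nth [::] d j))%N by lia.
have := nth_codes c (offset s0 d j + 1) hi.
rewrite (matches_block m hj).
have -> : offset s0 d j + 1 + `|(v - offset s0 d j - 1)%R|%N%:Z = v by lia.
by move=> <-; have /allP/(_ _ (mem_nth [::] hj))/allP := nz; apply; apply: mem_nth.
Qed.

(** Records are the zeros of the code, so consecutive records of the window are consecutive in
    [record_rep]. The centring fixes the index of one of them, and the others follow by induction in
    both directions. *)
Lemma rooted_RW_prob_match (R : realType) tau X c r (V : finType) (e : rel V) (h : V) d s0 :
  cancel tau X -> cancel X tau -> coded tau c -> (exists rr, record_rep_spec X rr) ->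
  windows r d -> centered r d s0 -> matches c d s0 ->
  rooted_RW_prob X r e h = (block_num r e h d)%:R / (block_size r d)%:R :> R.
Proof.
move=> tauK XK cod /record_repP[rrS rrP rr01] /andP[/eqP sd nz] cen m.
pose z k := X (record_rep X k).
have z01 : z 0 <= 0 < z 1 := rr01.
have zc k : c (z k) = 0%N by apply/(is_record_code _ tauK XK cod)/rrP; exists k.
have zS k : z k < z (k + 1).
  have /rrP : exists j, record_rep X j = record_rep X (k + 1) by exists (k + 1).
  by move=> /(_ _ (rrS k)).
have zlt := int_lt_homo zS.
have zall v : c v = 0%N -> exists k, z k = v.
  rewrite -{1}(tauK v) => /(is_record_code _ tauK XK cod)/rrP[k kE].
  by exists k; rewrite /z kE tauK.
have zle j k : z j < z k -> j < k.
  move=> h1; rewrite ltNge le_eqVlt; apply/negP => /orP[/eqP E|/zlt]; last by lia.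
  by rewrite E ltxx in h1.
have cen' : offset s0 d r <= 0 < offset s0 d r.+1 := cen.
have key j : (j <= size d)%N -> z (j%:Z - r%:Z) = offset s0 d j.
  have step j' k : (j' < size d)%N ->
     (z k = offset s0 d j' <-> z (k + 1) = offset s0 d j'.+1).
    move=> hj'; have lto : offset s0 d j' < offset s0 d j'.+1 by rewrite offsetS //; lia.
    split=> E.
    - have [k' kE] := zall _ (matches_rec m hj').
      have kk' : k < k' by apply: zle; rewrite E kE.
      case: (eqVneq k' (k + 1)) => [<-//|ne].
      have lt2 : z (k + 1) < z k' by apply: zlt; lia.
      have := matches_nonrec m nz hj' (v := z (k + 1)); rewrite zc.
      by have := zS k; rewrite E -kE => h1 /(_ ltac:(lia)).
    - have [k' kE] := zall _ (matches_rec m (ltnW hj')).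
      have kk' : k' < k + 1 by apply: zle; rewrite E kE.
      case: (eqVneq k' k) => [<-//|ne].
      have lt2 : z k' < z k by apply: zlt; lia.
      have := matches_nonrec m nz hj' (v := z k); rewrite zc.
      by have := zS k; rewrite E -kE => h1 /(_ ltac:(lia)).
  have zr : z 0 = offset s0 d r.
    have [k' kE] := zall _ (matches_rec m (j := r) ltac:(lia)).
    case: (eqVneq k' 0) => [<-//|ne].
    have k'1 : k' < 1.
      by apply: zle; rewrite kE (@le_lt_trans _ _ 0) //; [case/andP: cen' | case/andP: z01].
    have lt2 : z k' < z 0 by apply: zlt; lia.
    have := matches_nonrec m nz (j := r) (v := z 0) ltac:(lia); rewrite zc.
    suff -> : offset s0 d r < z 0 < offset s0 d r.+1 by move=> /(_ isT).
    by rewrite -kE lt2 (@le_lt_trans _ _ 0) //; [case/andP: z01 | case/andP: cen'].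
  have up i : (r + i <= size d)%N -> z i%:Z = offset s0 d (r + i).
    elim: i => [|i IH] hi; first by rewrite addn0.
    have -> : Posz i.+1 = i%:Z + 1 by lia.
    by rewrite addnS; apply: (step (r + i)%N i%:Z ltac:(lia)).1; apply: IH; lia.
  have dn i : (i <= r)%N -> z (- i%:Z) = offset s0 d (r - i).
    elim: i => [|i IH] hi; first by rewrite subn0 oppr0.
    apply: (step (r - i.+1)%N _ ltac:(lia)).2.
    have -> : - i.+1%:Z + 1 = - i%:Z by lia.
    have -> : (r - i.+1).+1 = (r - i)%N by lia.
    by apply: IH; lia.
  move=> hj; case: (leqP r j) => rj.
    have -> : j%:Z - r%:Z = (j - r)%N%:Z by lia.
    by rewrite up subnKC.
  have -> : j%:Z - r%:Z = - (r - j)%N%:Z by lia.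
  by rewrite dn ?leq_subr // subKn // ltnW.
have blk (k : int) : `|k| <= r%:Z -> BST (sigma_block X k) = block_tree r d k.
  move=> hk; rewrite (BST_sigma_block tauK XK cod (zS k)) -/(z k) -/(z (k + 1)) /block_tree.
  have hj : (`|(k + r%:Z)%R| < size d)%N by lia.
  have E1 := key _ (ltnW hj); have E2 := key _ hj.
  have k1 : `|(k + r%:Z)%R|%N%:Z - r%:Z = k by lia.
  have k2 : `|(k + r%:Z)%R|%N.+1%:Z - r%:Z = k + 1 by lia.
  rewrite k1 in E1; rewrite k2 in E2.
  rewrite E1 E2 offsetS // -[in RHS](matches_block m hj); congr (tr (codes c _ _)).
  lia.
have t0 : BST (sigma_block X 0) = block_tree r d 0 by apply: blk; rewrite normr0.
have -> : rooted_RW_prob X r e h =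
    (block_count (RW X) r e h 0 (BST (sigma_block X 0)))%:R /
    (size (blockV 0 (BST (sigma_block X 0))))%:R :> R by [].
congr (_%:R / _%:R).
  apply: block_count_local t0 => j; rewrite subr0 => hj; split=> // w.
  by rewrite /= blk.
by rewrite /= size_map t0 size_tr add0r.
Qed.

(** Makes the window events exhaustive: blocks [-r] to [r] are read off the permutation itself. *)
Lemma matches_exists tau X c r :
  cancel tau X -> cancel X tau -> coded tau c -> (exists rr, record_rep_spec X rr) ->
  exists d s0, [/\ windows r d, centered r d s0 & matches c d s0].
Proof.
move=> tauK XK cod /record_repP[rrS rrP rr01].
pose z k := X (record_rep X k).
have zc k : c (z k) = 0%N by apply/(is_record_code _ tauK XK cod)/rrP; exists k.
have zS k : z k < z (k + 1).
  have /rrP : exists j, record_rep X j = record_rep X (k + 1) by exists (k + 1).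
  by move=> /(_ _ (rrS k)).
have zlt := int_lt_homo zS.
have znz k v : z k < v < z (k + 1) -> c v != 0%N.
  move=> /andP[h1 h2]; apply/eqP; rewrite -{1}(tauK v).
  move=> /(is_record_code _ tauK XK cod)/rrP[j jE].
  have zj : z j = v by rewrite /z jE tauK.
  case: (ltgtP j k) => [/zlt|kj|jk]; [lia| |by rewrite -zj jk ltxx in h1].
  case: (ltgtP j (k + 1)) => [|/zlt|jk]; [lia|lia|by rewrite -zj jk ltxx in h2].
pose l j := codes c (z (j%:Z - r%:Z) + 1)
  `|(z (j%:Z - r%:Z + 1)%R - z (j%:Z - r%:Z)%R - 1)%R|%N.
pose d := [seq l j | j <- iota 0 r.*2.+1].
have sd : size d = r.*2.+1 by rewrite size_map size_iota.
have dj j : (j < size d)%N -> nth [::] d j = l j.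
  by move=> hj; rewrite (nth_map 0%N) ?size_iota -?sd // nth_iota -?sd.
have off j : (j <= size d)%N -> offset (z (- r%:Z)) d j = z (j%:Z - r%:Z).
  elim: j => [|j IH] hj; first by rewrite /offset take0 addr0 sub0r.
  rewrite offsetS // IH ?(ltnW hj) // dj // size_codes.
  have -> : j.+1%:Z - r%:Z = j%:Z - r%:Z + 1 by lia.
  by have := zS (j%:Z - r%:Z); lia.
exists d, (z (- r%:Z)); split.
- rewrite /windows sd eqxx andTb; apply/allP => _ /mapP[j _ ->]; apply/allP => a /mapP[i].
  rewrite mem_iota => hi ->; apply: (znz (j%:Z - r%:Z)).
  by have := zS (j%:Z - r%:Z); lia.
- rewrite /centered !off; [|lia|lia].
  have -> : r%:Z - r%:Z = 0 :> int by lia.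
  have -> : r.+1%:Z - r%:Z = 1 :> int by lia.
  exact: rr01.
- have main j : (j <= size d)%N -> forall i, (i < (size (pat (take j d))).+1)%N ->
      c (z (- r%:Z) + i%:Z) = nth 0%N (pattern (take j d)) i.
    elim: j => [|j IH] hj i.
      by rewrite take0 /=; case: i => // _; rewrite addr0 zc.
    rewrite (take_nth [::]) // -cats1 pat_cat size_cat /pattern pat_cat -cat_cons => hi.
    rewrite nth_cat /=; case: ifPn => hi'; first by apply: IH => //; apply: ltnW.
    set m := size (pat (take j d)) in hi hi' *.
    have offj : z (- r%:Z) + m%:Z = z (j%:Z - r%:Z) by rewrite -off ?(ltnW hj).
    have -> : z (- r%:Z) + i%:Z = z (j%:Z - r%:Z) + 1 + (i - m.+1)%N%:Z by lia.
    move: hi; rewrite /pat /= cats0 size_rcons nth_rcons dj // => hi.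
    case: (ltnP (i - m.+1)%N (size (l j))) => h1.
      by rewrite /l nth_codes //; move: h1; rewrite size_codes.
    have -> : (i - m.+1)%N = size (l j) by lia.
    rewrite eqxx size_codes -(zc (j%:Z - r%:Z + 1)); congr c.
    by have := zS (j%:Z - r%:Z); lia.
  by move=> i hi; have := main _ (leqnn _) i; rewrite take_size; apply.
Qed.

(** * Cylinder events *)

(** The event that the codes start with [t]. Prescribing [t] also prescribes which rows are free at
    each column, so the event involves finitely many fixed cells of the array. *)
Definition cyl (t : seq nat) (b : nat -> nat -> bool) : Prop :=
  forall v, (v < size t)%N ->
    (forall i, (i < nth 0%N t v)%N -> ~~ b (unused (nth 0%N t) v i) v.+1) /\
    b (unused (nth 0%N t) v (nth 0%N t v)) v.+1.

Lemma unused_eq g g' v : (forall i, (i < v)%N -> g i = g' i) -> unused g v = unused g' v.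
Proof.
elim: v => //= v IH h; rewrite IH ?h // => i hi; apply: h; exact: ltnW.
Qed.

Lemma cyl_code t b v : cyl t b -> (v < size t)%N -> colcode b v = nth 0%N t v.
Proof.
move=> ct; have [n] := ubnP v; elim: n v => // n IH v hv vt.
have [nb bt] := ct v vt; rewrite /colcode column_stateE.
rewrite (@unused_eq _ (nth 0%N t)) => [|i hi]; last by apply: IH; lia.
exact: first_true_eq.
Qed.

Lemma cyl_mkseq b n : inf_ones b -> cyl (mkseq (colcode b) n) b.
Proof.
move=> db v; rewrite size_mkseq => hv; rewrite nth_mkseq //.
rewrite (@unused_eq _ (colcode b)) => [|i hi]; last by rewrite nth_mkseq //; lia.
by have [] := colcodeP v db.
Qed.

Lemma cyl_take t b n : cyl t b -> cyl (take n t) b.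
Proof.
move=> ct v; rewrite size_take => hv.
have vn : (v < n)%N by case: ifP hv; lia.
have vt : (v < size t)%N by case: ifP hv; lia.
rewrite nth_take // (@unused_eq _ (nth 0%N t)) => [|i hi]; last by rewrite nth_take //; lia.
exact: ct.
Qed.

(** The cells inspected on this event. They are pairwise distinct, so independence multiplies one
    factor [q] per failure and [1 - q] per success. *)
Definition trials (t : seq nat) : seq (nat * nat) :=
  [seq (unused (nth 0%N t) v i, v.+1) | v <- iota 0 (size t), i <- iota 0 (nth 0%N t v).+1].

Definition bset (t : seq nat) (ij : nat * nat) : set nat :=
  if ij.1 == unused (nth 0%N t) ij.2.-1 (nth 0%N t ij.2.-1) then [set~ 0%N] else [set 0%N].

Lemma uniq_trials t : uniq (trials t).
Proof.
apply: allpairs_uniq_dep; rewrite ?iota_uniq //; first by move=> v _; rewrite iota_uniq.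
by move=> [v i] [v' i'] /= _ _ [E vE]; move: E; rewrite vE => /unused_inj ->.
Qed.

Lemma cylE (T : Type) (B : nat * nat -> T -> nat) t :
  [set w | cyl t (fun i j => B (i, j) w != 0%N)] =
  \bigcap_(ij in [set` trials t]) (B ij @^-1` bset t ij).
Proof.
apply/seteqP; split=> w /= h.
  move=> ij /= /allpairsPdep[v [i [hv hi ->]]]; rewrite /bset /=.
  have vt : (v < size t)%N by move: hv; rewrite mem_iota.
  have [h1 h2] := h v vt; case: eqP => [E|ne].
    by rewrite E => /eqP; apply/negP.
  apply/eqP; rewrite -[_ == _]negbK; apply: h1.
  have ne' : i <> nth 0%N t v by move=> E; apply: ne; rewrite E.
  by move: hi; rewrite mem_iota; lia.
move=> v vt.
have mem i : (i <= nth 0%N t v)%N -> (unused (nth 0%N t) v i, v.+1) \in trials t.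
  move=> hi; apply/allpairsPdep; exists v, i; split=> //; rewrite mem_iota ?add0n //.
split=> [i hi|].
  have := h _ (mem _ (ltnW hi)); rewrite /bset /=.
  case: eqP => [/unused_inj E|_ ->//]; first by rewrite E ltnn in hi.
by have := h _ (mem _ (leqnn _)); rewrite /bset /= eqxx => /eqP.
Qed.

Definition geo (R : realType) (q : R) (t : seq nat) : R :=
  \prod_(a <- t) (q ^+ a * (1 - q)).

Lemma prod_EFin (R : realType) (I : Type) (s : seq I) (f : I -> R) :
  (\prod_(i <- s) (f i)%:E)%E = (\prod_(i <- s) f i)%:E.
Proof. by elim/big_rec2: _ => // i x y _ ->. Qed.

Lemma bernoulli_ne0 d (T : measurableType d) (R : realType) (P : probability T R) (q : R)
    (X : T -> nat) : measurable (X @^-1` [set 0%N]) -> bernoulli_law P (1 - q) X ->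
  P (X @^-1` [set 0%N]) = q%:E /\ P (X @^-1` [set~ 0%N]) = (1 - q)%:E.
Proof.
move=> mX [_ h0]; have h0' : P (X @^-1` [set 0%N]) = q%:E by rewrite h0; congr EFin; ring.
split=> //; have -> : X @^-1` [set~ 0%N] = ~` (X @^-1` [set 0%N]) by [].
rewrite probability_setC // h0'.
by rewrite -EFinB.
Qed.

Lemma prod_trials d (T : measurableType d) (R : realType) (P : probability T R) (q : R)
    (B : nat * nat -> T -> nat) t : nat_rv_family B ->
  (forall ij, bernoulli_law P (1 - q) (B ij)) ->
  (\prod_(ij <- trials t) P (B ij @^-1` bset t ij))%E = (geo q t)%:E.
Proof.
move=> mB lB; pose f (ij : nat * nat) : R :=
  if ij.1 == unused (nth 0%N t) ij.2.-1 (nth 0%N t ij.2.-1) then 1 - q else q.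
rewrite (eq_bigr (fun ij => (f ij)%:E)); last first.
  move=> ij _; rewrite /bset /f; have [h1 h2] := bernoulli_ne0 (mB ij _) (lB ij).
  by case: ifP.
rewrite prod_EFin /trials big_allpairs_dep /geo; congr EFin.
rewrite -[in RHS](mkseq_nth 0%N t) big_map; apply: eq_bigr => v _.
set n := nth 0%N t v; rewrite -addn1 iotaD big_cat big_seq1 /= add0n.
have -> : f (unused (nth 0%N t) v n, v.+1) = 1 - q by rewrite /f /= eqxx.
congr (_ * _); rewrite big_seq (eq_bigr (fun=> q)); last first.
  move=> i; rewrite mem_iota add0n /f /= => hi; case: eqP => // /unused_inj E.
  by rewrite E ltnn in hi.
by rewrite -big_seq big_const_seq count_predT size_iota iter_mulr_1.
Qed.

Lemma measurable_bigcap_seq d (T : measurableType d) (I : eqType) (J : seq I)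
    (F : I -> set T) : (forall i, measurable (F i)) ->
  measurable (\bigcap_(i in [set` J]) F i).
Proof. by move=> mF; apply: fin_bigcap_measurable => // i _; apply: mF. Qed.

Lemma measurable_cyl d (T : measurableType d) (B : nat * nat -> T -> nat) t :
  nat_rv_family B -> measurable [set w | cyl t (fun i j => B (i, j) w != 0%N)].
Proof. by move=> mB; rewrite cylE; apply: measurable_bigcap_seq. Qed.

Lemma prob_cyl d (T : measurableType d) (R : realType) (P : probability T R) (q : R)
    (B : nat * nat -> T -> nat) t : nat_rv_family B -> mutually_independent P B ->
  (forall ij, bernoulli_law P (1 - q) (B ij)) ->
  P [set w | cyl t (fun i j => B (i, j) w != 0%N)] = (geo q t)%:E.
Proof. by move=> mB iB lB; rewrite cylE iB ?uniq_trials // (prod_trials t mB lB). Qed.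

Lemma expr_small (R : realType) (q eps : R) : 0 <= q -> q < 1 -> 0 < eps ->
  exists k, q ^+ k < eps.
Proof.
move=> q0 q1 e0; have /cvgrPdist_lt/(_ eps e0) : (GRing.exp q : R ^nat) x @[x --> \oo] --> 0.
  by apply: cvg_expr; rewrite ger0_norm.
move=> [k _ /(_ k (leqnn k))] /=; rewrite sub0r normrN ger0_norm ?exprn_ge0 // => h.
by exists k.
Qed.

Lemma mutually_independent_comp d (T : measurableType d) (R : realType)
    (P : probability T R) (I I' : eqType) (X : I' -> T -> nat) (f : I -> I') :
  injective f -> mutually_independent P X -> mutually_independent P (X \o f).
Proof.
move=> inj_f iX J A uJ.
pose A' k := [set x | forall j, f j = k -> A j x].
have A'E j : A' (f j) = A j.
  apply/seteqP; split=> x /=; first by apply.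
  by move=> Ax j' /inj_f ->.
have := iX (map f J) A'; rewrite map_inj_uniq // => /(_ uJ).
rewrite big_map; under [in RHS]eq_bigr do rewrite A'E.
move=> <-; congr (P _); apply/seteqP; split=> w /= h k.
  by move=> /= /mapP[j jJ ->] ; rewrite /= A'E; apply: h.
by move=> /= kJ; rewrite -A'E; apply: h; apply: map_f.
Qed.

Lemma ae_some_one d (T : measurableType d) (R : realType) (P : probability T R) (q : R)
    (B : nat -> T -> nat) m : 0 <= q -> q < 1 -> nat_rv_family B ->
  mutually_independent P B -> (forall j, bernoulli_law P (1 - q) (B j)) ->
  {ae P, forall w, exists2 j, (m < j)%N & B j w != 0%N}.
Proof.
move=> q0 q1 mB iB lB.
pose F k := \bigcap_(j in [set` iota m.+1 k]) (B j @^-1` [set 0%N]).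
have mF k : measurable (F k) by apply: measurable_bigcap_seq => j; apply: mB.
have PF k : P (F k) = (q ^+ k)%:E.
  rewrite /F (iB _ (fun=> [set 0%N])) ?iota_uniq //.
  rewrite (eq_bigr (fun=> q%:E)); last first.
    by move=> j _; have [] := bernoulli_ne0 (mB j _) (lB j).
  by rewrite prod_EFin big_const_seq count_predT size_iota iter_mulr_1.
have mN : measurable (\bigcap_k F k) by apply: bigcap_measurableType.
exists (\bigcap_k F k); split=> //.
  apply/eqP; rewrite eq_le measure_ge0 andbT; apply/lee_addgt0Pr => e e0.
  have [k hk] := expr_small q0 q1 e0; rewrite add0e.
  apply: (@le_trans _ _ (P (F k))); last by rewrite PF lee_fin ltW.
  by apply: le_measure; rewrite ?inE // => w; apply.
move=> w /= nw k _ j /=; rewrite mem_iota => hj; apply/eqP/negP => /negP nz.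
by apply: nw; exists j => //; lia.
Qed.

Lemma ae_inf_ones d (T : measurableType d) (R : realType) (P : probability T R) (q : R)
    (B : nat * nat -> T -> nat) : 0 <= q -> q < 1 -> nat_rv_family B ->
  mutually_independent P B -> (forall ij, bernoulli_law P (1 - q) (B ij)) ->
  {ae P, forall w, inf_ones (fun i j => B (i, j) w != 0%N)}.
Proof.
move=> q0 q1 mB iB lB; apply: ae_foralln => i; apply: ae_foralln => m.
have h (f : nat -> nat * nat) : injective f ->
    {ae P, forall w, exists2 j, (m < j)%N & B (f j) w != 0%N}.
  move=> fI; apply: (@ae_some_one _ _ _ P q (B \o f)) => //.
  - by move=> j A; apply: mB.
  - exact: mutually_independent_comp.
  - by move=> j; apply: lB.
have := filterI (h (fun j => (i, j)) _) (h (fun j => (j, i)) _).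
by apply; move=> ? ? [].
Qed.

(** * Factors of the code sequence *)

Definition fits (o : seq (option nat)) (t : seq nat) : bool :=
  all2 (fun x y => if x is Some a then y == a else true) o t.

(** A cylinder prescribes all codes from the first one on; entries [None] leave a code free, which
    gives access to the middle of the sequence. *)
Definition factor_event (T : Type) (B : nat * nat -> T -> nat) (t : seq nat)
  (o : seq (option nat)) : set T :=
  [set w | exists2 a, fits o a & cyl (t ++ a) (fun i j => B (i, j) w != 0%N)].

Lemma factor_event_nil T (B : nat * nat -> T -> nat) t :
  factor_event B t [::] = [set w | cyl t (fun i j => B (i, j) w != 0%N)].
Proof.
apply/seteqP; split=> w /=; first by case=> -[|//] _; rewrite cats0.
by move=> h; exists [::]; rewrite ?cats0.
Qed.

Lemma factor_event_Some T (B : nat * nat -> T -> nat) t x o :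
  factor_event B t (Some x :: o) = factor_event B (rcons t x) o.
Proof.
apply/seteqP; split=> w /= -[a fa ca].
  by case: a fa ca => // y a /andP[/eqP -> fa]; exists a; rewrite // cat_rcons.
by exists (x :: a); rewrite /= ?eqxx // -cat_rcons.
Qed.

Lemma factor_event_None T (B : nat * nat -> T -> nat) t o :
  factor_event B t (None :: o) = \bigcup_x factor_event B (rcons t x) o.
Proof.
apply/seteqP; split=> w /=.
  by move=> [[//|y a] /= fa ca]; exists y => //; exists a; rewrite // cat_rcons.
by move=> [y _ [a fa ca]]; exists (y :: a) => //; rewrite -cat_rcons.
Qed.

Lemma measurable_factor d (T : measurableType d) (B : nat * nat -> T -> nat) t o :
  nat_rv_family B -> measurable (factor_event B t o).
Proof.
move=> mB; elim: o t => [|[x|] o IH] t.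
- by rewrite factor_event_nil; apply: measurable_cyl.
- by rewrite factor_event_Some.
- by rewrite factor_event_None; apply: bigcup_measurable.
Qed.

Lemma geo_nil (R : realType) (q : R) : geo q [::] = 1.
Proof. by rewrite /geo big_nil. Qed.

Lemma geo_cons (R : realType) (q : R) x t : geo q (x :: t) = q ^+ x * (1 - q) * geo q t.
Proof. by rewrite /geo big_cons. Qed.

Lemma geo_rcons (R : realType) (q : R) t x : geo q (rcons t x) = geo q t * (q ^+ x * (1 - q)).
Proof. by rewrite /geo -cats1 big_cat big_seq1. Qed.

Lemma geo_cat (R : realType) (q : R) t t' : geo q (t ++ t') = geo q t * geo q t'.
Proof. by rewrite /geo big_cat. Qed.

Lemma geo_ge0 (R : realType) (q : R) t : 0 <= q -> q < 1 -> 0 <= geo q t.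
Proof.
by move=> q0 q1; apply: prodr_ge0 => a _; rewrite mulr_ge0 ?exprn_ge0 // subr_ge0 ltW.
Qed.

Lemma geometric_total (R : realType) (q c : R) : 0 <= q -> q < 1 -> 0 <= c ->
  (\sum_(0 <= x <oo) (c * (q ^+ x * (1 - q)))%:E)%E = c%:E.
Proof.
move=> q0 q1 c0; apply: cvg_lim => //.
have E n : (\sum_(0 <= x < n) (c * (q ^+ x * (1 - q)))%:E)%E = (c - c * q ^+ n)%:E.
  elim: n => [|n IH]; first by rewrite big_geq // expr0 mulr1 subrr.
  by rewrite big_nat_recr //= IH -EFinD; congr EFin; rewrite exprS; ring.
under eq_fun do rewrite E.
apply: cvg_EFin; first by apply: nearW.
rewrite -[X in _ --> X]subr0 -[X in _ --> _ - X](mulr0 c).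
apply: cvgB; first exact: cvg_cst.
by apply: cvgM; [exact: cvg_cst | apply: cvg_expr; rewrite ger0_norm].
Qed.

(** A free position splits the event into a disjoint union over the value of its code, and the
    geometric weights sum to 1. *)
Lemma prob_factor d (T : measurableType d) (R : realType) (P : probability T R) (q : R)
    (B : nat * nat -> T -> nat) t o : 0 <= q -> q < 1 ->
  nat_rv_family B -> mutually_independent P B ->
  (forall ij, bernoulli_law P (1 - q) (B ij)) ->
  P (factor_event B t o) = (geo q t * geo q (pmap id o))%:E.
Proof.
move=> q0 q1 mB iB lB; elim: o t => [|[x|] o IH] t.
- by rewrite factor_event_nil (prob_cyl t mB iB lB) /= geo_nil mulr1.
- by rewrite factor_event_Some IH geo_rcons /= geo_cons; congr EFin; ring.
rewrite factor_event_None measure_semi_bigcup.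
- rewrite (eq_eseriesr (g := fun x => (geo q t * geo q (pmap id o) * (q ^+ x * (1 - q)))%:E)).
    by rewrite geometric_total // mulr_ge0 ?geo_ge0.
  by move=> x _; apply: etrans (IH (rcons t x)) _; rewrite geo_rcons; congr EFin; ring.
- by move=> x; apply: measurable_factor.
- move=> x y _ _ [w [[a fa ca] [a' fa' ca']]].
  have h z e : cyl (rcons t z ++ e) (fun i j => B (i, j) w != 0%N) ->
      colcode (fun i j => B (i, j) w != 0%N) (size t) = z.
    move=> /cyl_code ->; last by rewrite size_cat size_rcons; lia.
    by rewrite nth_cat size_rcons ltnSn nth_rcons ltnn eqxx.
  by rewrite -(h _ _ ca) (h _ _ ca').
- by apply: bigcup_measurable => x _; apply: measurable_factor.
Qed.

(** * A law of large numbers for events with finite-range dependence *)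

Definition visits (R : realType) (T : Type) (E : nat -> set T) (n : nat) (w : T) : R :=
  \sum_(s <- iota 0 n) \1_(E s) w.

Lemma measurable_visits d (T : measurableType d) (R : realType) (E : nat -> set T) n :
  (forall s, measurable (E s)) -> measurable_fun setT (visits R E n).
Proof. by move=> mE; apply: measurable_sum => s; apply: measurable_indic. Qed.

Lemma sum_indic_close (n L s : nat) (f : nat -> nat) :
  (forall s', (s + L <= s')%N || (s' + L <= s)%N -> f s' = 0%N) ->
  (forall s', f s' <= 1)%N -> (\sum_(s' <- iota 0 n) f s' <= L.*2)%N.
Proof.
move=> f0 f1.
apply: (@leq_trans (\sum_(s' <- iota 0 n | s' \in iota (s - L) L.*2) 1)%N).
  rewrite [X in (_ <= X)%N]big_mkcond; apply: leq_sum => s' _; case: ifPn => // h.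
  by rewrite f0 //; move: h; rewrite mem_iota; lia.
rewrite sum1_count -size_filter -[X in (_ <= X)%N](size_iota (s - L)).
apply: uniq_leq_size; first by rewrite filter_uniq ?iota_uniq.
by move=> s'; rewrite mem_filter => /andP[].
Qed.

(** For each [s], at most [2 L] indices [s'] lie closer than [L]; only these contribute to the
    variance, each by at most 1. *)
Lemma second_moment d (T : measurableType d) (R : realType) (P : probability T R)
    (E : nat -> set T) (p : R) (L n : nat) :
  (forall s, measurable (E s)) -> (forall s, P (E s) = p%:E) ->
  (forall s s', (s + L <= s')%N -> P (E s `&` E s') = (p ^+ 2)%:E) ->
  (\int[P]_w ((visits R E n w - n%:R * p) ^+ 2)%:E <= (L.*2 * n)%:R%:E)%E.
Proof.
move=> mE PE PEE.
have p0 : 0 <= p by rewrite -lee_fin -(PE 0%N).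
pose S w : R := visits R E n w.
have mS : measurable_fun setT S by apply: measurable_visits.
have S0 w : 0 <= S w by apply: sumr_ge0.
pose pp s s' : R := fine (P (E s `&` E s')).
have ppE s s' : P (E s `&` E s') = (pp s s')%:E.
  by rewrite /pp fineK // fin_num_measure //; apply: measurableI.
have intS : (\int[P]_w (S w)%:E = (n%:R * p)%:E)%E.
  rewrite /S /visits; under eq_integral do rewrite -sumEFin.
  rewrite ge0_integral_sum //; last first.
    by move=> s; apply/measurable_EFinP; apply: measurable_indic.
  rewrite (eq_bigr (fun=> p%:E)); last first.
    by move=> s _; rewrite integral_indic // setIT; apply: PE.
  by rewrite sumEFin big_const_seq count_predT size_iota iter_addr_0 mulr_natl.
have intS2 : (\int[P]_w ((S w) ^+ 2)%:E =
    (\sum_(s <- iota 0 n) \sum_(s' <- iota 0 n) pp s s')%:E)%E.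
  under eq_integral.
    move=> w _; rewrite (_ : (S w) ^+ 2 =
      \sum_(s <- iota 0 n) \sum_(s' <- iota 0 n) \1_(E s `&` E s') w); last first.
      rewrite expr2 /S /visits mulr_suml; apply: eq_bigr => s _.
      by rewrite mulr_sumr; apply: eq_bigr => s' _; rewrite indicI.
    rewrite -sumEFin; over.
  rewrite ge0_integral_sum //; last 2 first.
  - by move=> s; apply/measurable_EFinP; apply: measurable_sum => s';
      apply: measurable_indic; apply: measurableI.
  - by move=> s w _; rewrite lee_fin sumr_ge0.
  rewrite -sumEFin; apply: eq_bigr => s _.
  under eq_integral do rewrite -sumEFin.
  rewrite ge0_integral_sum //; last first.
    by move=> s'; apply/measurable_EFinP; apply: measurable_indic; apply: measurableI.
  rewrite -sumEFin; apply: eq_bigr => s' _.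
  by rewrite integral_indic ?setIT //; [apply: ppE | apply: measurableI].
pose D w : R := (S w - n%:R * p) ^+ 2.
have mD : measurable_fun setT D.
  by apply: measurable_funX; apply: measurable_funB => //; apply: measurable_cst.
have D0 w : 0 <= D w by apply: sqr_ge0.
have c0 : 0 <= 2 * n%:R * p :> R by rewrite !mulr_ge0.
(* The square is expanded with the cross term moved to the other side, so that only nonnegative
   functions are integrated. *)
have lhs : (\int[P]_w (D w + (2 * n%:R * p) * S w)%:E =
    \int[P]_w (D w)%:E + (2 * n%:R * p * (n%:R * p))%:E)%E.
  under eq_integral do rewrite EFinD.
  rewrite ge0_integralD //; last 4 first.
  - by move=> w _; rewrite lee_fin.
  - exact/measurable_EFinP.
  - by move=> w _; rewrite lee_fin mulr_ge0.
  - by apply/measurable_EFinP; apply: measurable_funM => //; apply: measurable_cst.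
  congr (_ + _)%E; under eq_integral do rewrite EFinM.
  have mSE : measurable_fun setT (EFin \o S) by exact/measurable_EFinP.
  rewrite (ge0_integralZl_EFin P measurableT _ mSE c0) /=; first by rewrite intS EFinM.
  by move=> w _; rewrite lee_fin.
have rhs : (\int[P]_w (D w + (2 * n%:R * p) * S w)%:E =
    (\sum_(s <- iota 0 n) \sum_(s' <- iota 0 n) pp s s' + (n%:R * p) ^+ 2)%:E)%E.
  under eq_integral.
    move=> w _; rewrite (_ : D w + _ = (S w) ^+ 2 + (n%:R * p) ^+ 2); last by rewrite /D; ring.
    rewrite EFinD; over.
  rewrite ge0_integralD //; last 3 first.
  - by move=> w _; rewrite lee_fin sqr_ge0.
  - by apply/measurable_EFinP; apply: measurable_funX.
  - by move=> w _; rewrite lee_fin sqr_ge0.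
  have -> : (\int[P]_w ((n%:R * p) ^+ 2)%:E = ((n%:R * p) ^+ 2)%:E)%E.
    apply: etrans (integral_cst P measurableT _) _.
    by apply: etrans (congr1 (fun y => _ * y)%E (probability_setT P)) _; rewrite mule1.
  by rewrite intS2 EFinD.
have {lhs rhs} DE : (\int[P]_w (D w)%:E =
    (\sum_(s <- iota 0 n) \sum_(s' <- iota 0 n) pp s s' - (n%:R * p) ^+ 2)%:E)%E.
  move: lhs; rewrite rhs; case: (\int[P]_w (D w)%:E)%E => [x| |] //=.
  by move=> [h]; congr EFin; rewrite -[LHS](addrK (2 * n%:R * p * (n%:R * p))) -h; ring.
rewrite -/(S _) DE lee_fin.
have -> : (n%:R * p) ^+ 2 = \sum_(s <- iota 0 n) \sum_(s' <- iota 0 n) p ^+ 2.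
  rewrite !big_const_seq !count_predT !size_iota !iter_addr_0.
  by rewrite -[in RHS]mulr_natr -[in RHS]mulr_natr; ring.
rewrite -sumrB natrM mulrC.
apply: (@le_trans _ _ (\sum_(s <- iota 0 n) L.*2%:R)); last first.
  by rewrite big_const_seq count_predT size_iota iter_addr_0 mulr_natl.
apply: ler_sum => s _; rewrite -sumrB.
pose f s' : nat := ~~ ((s + L <= s')%N || (s' + L <= s)%N).
apply: (@le_trans _ _ (\sum_(s' <- iota 0 n) (f s')%:R)); last first.
  rewrite -natr_sum ler_nat; apply: (@sum_indic_close n L s) => s'; rewrite /f.
    by move=> ->.
  by case: (~~ _).
apply: ler_sum => s' _; rewrite /f; case: orP => [[h|h]|_] /=.
- by rewrite /pp PEE //= subrr.
- by rewrite /pp setIC PEE //= subrr.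
rewrite lerBlDr (le_trans (y := 1)) ?lerDl ?sqr_ge0 //.
by rewrite -lee_fin -ppE probability_le1 //; apply: measurableI.
Qed.

(** * Interpolation between squares *)

Lemma sqrt_floor n : exists k, (k ^ 2 <= n < k.+1 ^ 2)%N.
Proof.
elim: n => [|n [k /andP[h1 h2]]]; first by exists 0%N.
by case: (ltnP n.+1 (k.+1 ^ 2)) => h; [exists k | exists k.+1]; nia.
Qed.

Lemma quotient_close (R : realType) (b z p e : R) : 0 < z ->
  - e <= p - b / z <= e -> b <= (p + e) * z /\ (p - e) * z <= b.
Proof.
move=> z0 /andP[h1 h2]; split; first by rewrite -ler_pdivrMr //; lra.
by rewrite -ler_pdivlMr //; lra.
Qed.

Lemma close_quotient (R : realType) (b z p e : R) : 0 < z ->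
  (p - e) * z <= b <= (p + e) * z -> - e <= p - b / z <= e.
Proof.
move=> z0 /andP[]; rewrite -ler_pdivlMr // => h1; rewrite -ler_pdivrMr // => h2.
by apply/andP; split; lra.
Qed.

Lemma cvg_along_squares (R : realType) (S : nat -> R) (p : R) : 0 <= p <= 1 ->
  (forall n, 0 <= S n.+1 - S n <= 1) ->
  (S (k.+1 ^ 2)%N / (k.+1 ^ 2)%:R) @[k --> \oo] --> p ->
  (S n / n%:R) @[n --> \oo] --> p.
Proof.
move=> /andP[p0 p1] Sinc hS; apply/cvgrPdist_le => e e0.
have Slip m k : 0 <= S (m + k)%N - S m <= k%:R.
  elim: k => [|k IH]; first by rewrite addn0 subrr lexx.
  by rewrite addnS; have := Sinc (m + k)%N; rewrite -natr1; lra.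
have e2 : 0 < e / 2 by lra.
have e8 : 0 < e / 10 by lra.
move: hS => /cvgrPdist_le/(_ _ e2)[K1 _ hK1].
(* At a root [x] past [10 / e], the distance to the next square is at most [2 x], up to one, and
   [2 x] is at most [(e / 5) x ^ 2], which the margin [e / 2] absorbs. *)
have [K2 hK2] : exists K2 : nat, 10 / e < K2%:R.
  by exists (Num.bound (10 / e)); apply: archi_boundP; rewrite divr_ge0 // ltW.
exists ((K1 + K2).+1 ^ 2)%N => // n /= hn.
have [k /andP[k1 k2]] := sqrt_floor n.
have kK : (K1 + K2 < k)%N.
  rewrite ltnNge; apply/negP => le.
  have : (k.+1 ^ 2 <= (K1 + K2).+1 ^ 2)%N by rewrite leq_exp2r.
  by lia.
case: k k1 k2 kK => // k k1 k2 kK.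
have := hK1 k ltac:(rewrite /=; lia).
have n0 : 0 < n%:R :> R by rewrite ltr0n; nia.
have kk0 : 0 < (k.+1 ^ 2)%:R :> R by rewrite ltr0n expn_gt0.
have k0 : 0 < k.+1%:R :> R by rewrite ltr0n.
have kn : (k.+1 ^ 2)%:R <= n%:R :> R by rewrite ler_nat.
have dn : (n - k.+1 ^ 2)%:R <= 2 * k.+1%:R :> R.
  by rewrite -natrM ler_nat; nia.
have dE : (n - k.+1 ^ 2)%:R = n%:R - (k.+1 ^ 2)%:R :> R by rewrite natrB.
have big : 10 <= e * k.+1%:R.
  have : 10 / e < k.+1%:R by apply: lt_le_trans hK2 _; rewrite ler_nat; lia.
  by rewrite ltr_pdivrMr // mulrC => /ltW.
have := Slip (k.+1 ^ 2)%N (n - k.+1 ^ 2)%N; rewrite subnKC //; move: (S n) (S (k.+1 ^ 2)%N) => a b ab.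
have sqE : (k.+1 ^ 2)%:R = k.+1%:R ^+ 2 :> R by rewrite natrX.
rewrite !ler_norml => hb; rewrite sqE in kk0 kn dE hb ab dn *.
have [hb1 hb2] := quotient_close kk0 hb.
apply: close_quotient => //.
rewrite dE in dn ab.
move: (k.+1%:R : R) (n%:R : R) k0 n0 kk0 kn dn big hb1 hb2 ab => x y *.
by apply/andP; split; nra.
Qed.

Lemma sum_inv_squares (R : realType) n : \sum_(0 <= k < n) ((k.+1 ^ 2)%:R)^-1 <= 2 :> R.
Proof.
have main m : \sum_(0 <= k < m.+1) ((k.+1 ^ 2)%:R)^-1 <= 2 - (m.+1%:R)^-1 :> R.
  elim: m => [|m IH]; first by rewrite big_nat1 invr1; lra.
  rewrite big_nat_recr //=; apply: (le_trans (lerD IH (lexx _))).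
  have x0 : 0 < m.+1%:R :> R by rewrite ltr0n.
  rewrite natrX -[m.+2%:R]natr1; move: x0; move: (m.+1%:R : R) => x x0.
  have x1 : 0 < x + 1 by lra.
  have -> : 2 - x^-1 + ((x + 1) ^+ 2)^-1 =
      2 - (x + 1)^-1 - (x * (x + 1) ^+ 2)^-1.
    by field; rewrite !gt_eqF.
  by rewrite lerBlDr lerDl invr_ge0 mulr_ge0 ?sqr_ge0 ?ltW.
apply: (@le_trans _ _ (\sum_(0 <= k < n.+1) ((k.+1 ^ 2)%:R)^-1)).
  by rewrite big_nat_recr //= lerDl invr_ge0.
by apply: (le_trans (main n)); rewrite lerBlDr lerDl invr_ge0.
Qed.

(** Along squares the normalised second moments are summable, so the series of squared deviations
    has finite integral, converges almost everywhere, and its terms vanish in the limit. *)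
Lemma lln d (T : measurableType d) (R : realType) (P : probability T R)
    (E : nat -> set T) (p : R) (L : nat) :
  (forall s, measurable (E s)) -> (forall s, P (E s) = p%:E) ->
  (forall s s', (s + L <= s')%N -> P (E s `&` E s') = (p ^+ 2)%:E) ->
  {ae P, forall w, (visits R E n w / n%:R) @[n --> \oo] --> p}.
Proof.
move=> mE PE PEE.
have p0 : 0 <= p by rewrite -lee_fin -(PE 0%N).
have p1 : p <= 1 by rewrite -lee_fin -(PE 0%N) probability_le1.
pose G k w : R := ((visits R E (k.+1 ^ 2) w - (k.+1 ^ 2)%:R * p) / (k.+1 ^ 2)%:R) ^+ 2.
have mG k : measurable_fun setT (fun w => (G k w)%:E).
  apply/measurable_EFinP; apply: measurable_funX; apply: measurable_funM; last exact: measurable_cst.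
  by apply: measurable_funB; [exact: measurable_visits | exact: measurable_cst].
have G0 k w : (0 <= (G k w)%:E)%E by rewrite lee_fin sqr_ge0.
have intG k : (\int[P]_w (G k w)%:E <= (L.*2%:R * ((k.+1 ^ 2)%:R)^-1)%:E)%E.
  have c0 : 0 <= (((k.+1 ^ 2)%:R)^-1) ^+ 2 :> R by apply: sqr_ge0.
  under eq_integral do rewrite /G exprMn mulrC EFinM.
  rewrite ge0_integralZl_EFin //; last 2 first.
  - by move=> w _; rewrite lee_fin sqr_ge0.
  - apply/measurable_EFinP; apply: measurable_funX.
    by apply: measurable_funB; [exact: measurable_visits | exact: measurable_cst].
  apply: (le_trans (lee_wpmul2l _ (second_moment (k.+1 ^ 2) mE PE PEE))).
    by rewrite lee_fin.
  rewrite -EFinM lee_fin natrM expr2.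
  have k0 : (k.+1 ^ 2)%:R != 0 :> R by rewrite pnatr_eq0 expn_eq0.
  by move: ((k.+1 ^ 2)%:R : R) k0 => x x0; rewrite le_eqVlt; apply/orP; left; apply/eqP; field.
have fin : (\int[P]_w (\sum_(0 <= k <oo) (G k w)%:E) < +oo)%E.
  rewrite integral_nneseries //.
  apply: (@le_lt_trans _ _ (L.*2%:R * 2)%:E); last by rewrite ltry.
  apply: lime_le.
    by apply: is_cvg_nneseries => k _ _; apply: integral_ge0.
  apply: nearW => n; apply: (le_trans (lee_sum _ (fun k _ => intG k))).
  by rewrite sumEFin lee_fin -mulr_sumr ler_wpM2l // sum_inv_squares.
have fint : P.-integrable setT (fun w => \sum_(0 <= k <oo) (G k w)%:E)%E.
  apply/integrableP; split; last first.
    by under eq_integral do (rewrite gee0_abs; last exact: nneseries_ge0).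
  exact: ge0_emeasurable_sum.
apply: filterS (integrable_ae measurableT fint) => w /(_ I) fw.
apply: cvg_along_squares; first by rewrite p0.
  move=> n; rewrite /visits -(addn1 n) iotaD big_cat big_seq1 /= add0n addrAC subrr add0r.
  by rewrite indicE; case: (_ \in _) => /=; rewrite ?lexx ?ler01.
have tl : (\sum_(N <= k <oo) (G k w)%:E)%E @[N --> \oo] --> 0%E.
  by apply: nneseries_tail_cvg => //; rewrite ltey_eq fw.
have Gcvg : (G k w) @[k --> \oo] --> (0 : R).
  have : (G k w)%:E @[k --> \oo] --> 0%E.
    apply: squeeze_cvge (cvg_cst 0%E) tl; apply: nearW => N; rewrite G0 /=.
    have := @nneseries_lim_ge R (fun k => (G k w)%:E) xpredT N N.+1 (fun k _ _ => G0 k w).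
    by rewrite big_nat1.
  by move=> /fine_cvgP[].
apply/cvgrPdist_le => e e0.
move: Gcvg => /cvgrPdist_le/(_ (e ^+ 2) ltac:(by rewrite exprn_gt0)).
apply: filterS => k; rewrite sub0r normrN ger0_norm ?sqr_ge0 // /G => h.
have k0 : (k.+1 ^ 2)%:R != 0 :> R by rewrite pnatr_eq0 expn_eq0.
set X := (visits R E (k.+1 ^ 2) w - _) / _ in h.
have -> : p - visits R E (k.+1 ^ 2) w / (k.+1 ^ 2)%:R = - X by rewrite /X; field.
rewrite normrN ler_norml; move: X e e0 h => X e e0 h.
by apply/andP; split; nra.
Qed.

(** * Frequencies of patterns in the one-sided model *)

Fixpoint sat (c : nat -> nat) (off : nat) (o : seq (option nat)) : Prop :=
  if o is x :: o' then (if x is Some a then c off = a else True) /\ sat c off.+1 o'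
  else True.

Lemma sat_cat c off o o' : sat c off (o ++ o') <-> sat c off o /\ sat c (off + size o) o'.
Proof.
elim: o off => [|x o IH] off /=; first by rewrite addn0; tauto.
by rewrite IH addSnnS; tauto.
Qed.

Lemma sat_nseq c off n : sat c off (nseq n None).
Proof. by elim: n off => //= n IH off; split. Qed.

Lemma sat_Some c off p : sat c off (map Some p) <-> occ c p off.
Proof.
have -> : (occ c p off : Prop) <-> forall i, (i < size p)%N -> c (off + i)%N = nth 0%N p i.
  by split=> [/occP|/occP].
elim: p off => [|a p IH] off /=; first by split.
rewrite IH; split=> [[h1 h2] [|i] hi|h]; first by rewrite addn0.
  by rewrite -addSnnS h2.
split; first by have := h 0%N isT; rewrite addn0.
by move=> i hi; have := h i.+1 hi; rewrite -addSnnS.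
Qed.

Lemma sat_eq c c' off o : (forall i, (off <= i < off + size o)%N -> c i = c' i) ->
  sat c off o <-> sat c' off o.
Proof.
elim: o off => //= x o IH off h.
rewrite h; last by lia.
by rewrite (IH off.+1) // => i hi; apply: h; lia.
Qed.

Lemma fits_sat pre o a :
  fits o a <-> size a = size o /\ sat (nth 0%N (pre ++ a)) (size pre) o.
Proof.
elim: o a pre => [|x o IH] [|y a] pre //=; first by split=> // -[].
  by split=> // -[].
have hy : nth 0%N (pre ++ y :: a) (size pre) = y by rewrite nth_cat ltnn subnn.
have := IH a (rcons pre y); rewrite cat_rcons size_rcons => {}IH.
split.
  move=> /andP[h /IH[sa ha]]; rewrite sa; split=> //; split=> //.
  by case: x h => [b|//] /eqP; rewrite hy.
move=> [[sa] [h1 h2]]; apply/andP; split; last exact/IH.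
by case: x h1 => [b|//]; rewrite hy => ->.
Qed.

Lemma factor_eventP T (B : nat * nat -> T -> nat) o w :
  let b := fun i j => B (i, j) w != 0%N in
  factor_event B [::] o w <->
  cyl (mkseq (colcode b) (size o)) b /\ sat (colcode b) 0 o.
Proof.
move=> b; split=> [[a fa ca]|[cb sb]].
  have [sa ha] := (fits_sat [::] o a).1 fa; rewrite cat0s in ca ha.
  have aE : a = mkseq (colcode b) (size o).
    apply: (@eq_from_nth _ 0%N); rewrite ?size_mkseq // sa => i hi.
    by rewrite nth_mkseq // (cyl_code ca) // sa.
  rewrite -aE; split=> //; apply/(@sat_eq _ (nth 0%N a)) => // i hi.
  by rewrite (cyl_code ca) // sa; lia.
exists (mkseq (colcode b) (size o)) => //; apply/(fits_sat [::]); rewrite size_mkseq.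
split=> //; rewrite cat0s [size _]/=; apply/(@sat_eq _ (colcode b)) => // i hi.
by rewrite nth_mkseq //; lia.
Qed.

Definition occ_event (T : Type) (B : nat * nat -> T -> nat) (p : seq nat) (s : nat) : set T :=
  factor_event B [::] (nseq s None ++ map Some p).

Lemma occ_eventP T (B : nat * nat -> T -> nat) p s w :
  let b := fun i j => B (i, j) w != 0%N in
  occ_event B p s w <->
  cyl (mkseq (colcode b) (s + size p)) b /\ occ (colcode b) p s.
Proof.
move=> b; rewrite /occ_event factor_eventP size_cat size_nseq size_map sat_cat sat_Some.
by rewrite size_nseq add0n; have := sat_nseq (colcode b) 0 s; tauto.
Qed.

Lemma pmap_Some (p : seq nat) : pmap id (map Some p) = p.
Proof. by elim: p => //= a p ->. Qed.

Lemma pmap_None s (o : seq (option nat)) : pmap id (nseq s None ++ o) = pmap id o.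
Proof. by elim: s. Qed.

(** Two disjoint occurrences form one longer pattern with free positions in between, so
    [prob_factor] also gives the decorrelation required by [lln]. *)
Lemma occ_event_pair T (B : nat * nat -> T -> nat) p s s' : (s + size p <= s')%N ->
  occ_event B p s `&` occ_event B p s' =
  factor_event B [::] (nseq s None ++ map Some p ++ nseq (s' - (s + size p)) None ++ map Some p).
Proof.
move=> ss'; apply/seteqP; split=> w; set b := fun i j => B (i, j) w != 0%N.
  move=> [/occ_eventP[_ oc1] /occ_eventP[c2 oc2]]; apply/factor_eventP.
  rewrite !size_cat !size_nseq !size_map !sat_cat !sat_Some !size_nseq !size_map add0n.
  have -> : (s + (size p + (s' - (s + size p) + size p)) = s' + size p)%N by lia.
  have -> : (s + size p + (s' - (s + size p)) = s')%N by lia.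
  by do !split=> //; apply: sat_nseq.
move=> /factor_eventP.
rewrite !size_cat !size_nseq !size_map !sat_cat !sat_Some !size_nseq !size_map add0n.
have -> : (s + (size p + (s' - (s + size p) + size p)) = s' + size p)%N by lia.
have -> : (s + size p + (s' - (s + size p)) = s')%N by lia.
move=> [cb [_ [oc1 [_ oc2]]]]; split; apply/occ_eventP; split=> //.
have := cyl_take (n := (s + size p)%N) cb; rewrite -/b.
rewrite /mkseq -map_take take_iota; have -> : minn (s + size p) (s' + size p) = (s + size p)%N.
  by apply/minn_idPl; lia.
by [].
Qed.

Lemma freq_pattern d (T : measurableType d) (R : realType) (P : probability T R) (q : R)
    (B : nat * nat -> T -> nat) (p : seq nat) : 0 <= q -> q < 1 -> nat_rv_family B ->
  mutually_independent P B -> (forall ij, bernoulli_law P (1 - q) (B ij)) ->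
  {ae P, forall w,
    ((count (occ (colcode (fun i j => B (i, j) w != 0%N)) p) (iota 0 n))%:R / n%:R)
      @[n --> \oo] --> geo q p}.
Proof.
move=> q0 q1 mB iB lB.
have h := @lln _ _ _ P (occ_event B p) (geo q p) (size p).
apply: filterS2 (ae_inf_ones q0 q1 mB iB lB) (h _ _ _).
- move=> w /= db; set b := fun i j => B (i, j) w != 0%N in db *.
  suff E n : visits R (occ_event B p) n w = (count (occ (colcode b) p) (iota 0 n))%:R.
    by under eq_fun do rewrite E.
  rewrite /visits -sum1_count natr_sum [RHS]big_mkcond; apply: eq_bigr => s _.
  rewrite indicE; have [oc|noc] := boolP (occ _ _ _); last first.
    by rewrite memNset // => /occ_eventP[_ oc]; rewrite oc in noc.
  by rewrite mem_set //; apply/occ_eventP; split=> //; apply: cyl_mkseq.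
- by move=> s; apply: measurable_factor.
- move=> s; apply: etrans (prob_factor [::] _ q0 q1 mB iB lB) _.
  by rewrite geo_nil mul1r pmap_None pmap_Some.
- move=> s s' ss'; rewrite occ_event_pair //.
  apply: etrans (prob_factor [::] _ q0 q1 mB iB lB) _.
  rewrite geo_nil mul1r pmap_None pmap_cat pmap_Some pmap_None pmap_Some geo_cat.
  by congr EFin; rewrite expr2.
Qed.

Lemma ae_count d (T : measurableType d) (R : realType) (P : probability T R)
    (I : countType) (Q : I -> T -> Prop) : (forall i, {ae P, forall w, Q i w}) ->
  {ae P, forall w, forall i, Q i w}.
Proof.
move=> h; have : {ae P, forall w, forall n, forall i : I, pickle_inv n = Some i -> Q i w}.
  apply: ae_foralln => n; case: (@pickle_inv I n) => [i|]; last exact: filterE.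
  by apply: filterS (h i) => w Qw j [<-].
by apply: filterS => w H i; apply: (H (pickle i)); rewrite pickleK_inv.
Qed.

(** All patterns at once: they are countably many, so one null set suffices. *)
Definition regular (R : realType) (q : R) (b : nat -> nat -> bool) : Prop :=
  inf_ones b /\ forall p, ((count (occ (colcode b) p) (iota 0 n))%:R / n%:R)
    @[n --> \oo] --> geo q p.

Lemma ae_regular d (T : measurableType d) (R : realType) (P : probability T R) (q : R)
    (B : nat * nat -> T -> nat) : 0 <= q -> q < 1 -> nat_rv_family B ->
  mutually_independent P B -> (forall ij, bernoulli_law P (1 - q) (B ij)) ->
  {ae P, forall w, regular q (fun i j => B (i, j) w != 0%N)}.
Proof.
move=> q0 q1 mB iB lB; apply: filterS2 (ae_inf_ones q0 q1 mB iB lB)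
  (ae_count (fun p => freq_pattern p q0 q1 mB iB lB)) => w h1 h2; split=> //.
Qed.

Lemma cvg_sum_seq (R : realType) (I : Type) (s : seq I) (f : I -> nat -> R) (l : I -> R) :
  (forall i, f i n @[n --> \oo] --> l i) ->
  (\sum_(i <- s) f i n) @[n --> \oo] --> \sum_(i <- s) l i.
Proof.
move=> h; elim: s => [|i s IH].
  by under eq_fun do rewrite big_nil; rewrite big_nil; apply: cvg_cst.
by under eq_fun do rewrite big_cons; rewrite big_cons; apply: cvgD.
Qed.

Lemma cvg_div_nat (R : realType) (c : R) : (c / n%:R) @[n --> \oo] --> (0 : R).
Proof.
rewrite -[X in _ --> X](mulr0 c); apply: cvgM; first exact: cvg_cst.
apply/cvgrPdist_le => e e0.
exists (Num.bound e^-1) => // n /= hn.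
have n0 : e^-1 < n%:R.
  by apply: lt_le_trans (archi_boundP _) _; rewrite ?invr_ge0 ?ler_nat // ltW.
rewrite sub0r normrN ger0_norm ?invr_ge0 // -[leRHS]invrK lef_pV2 ?ltW // posrE ?invr_gt0 //.
by apply: lt_trans n0; rewrite invr_gt0.
Qed.

(** For each [C], [late_le] bounds the fraction by [C / n] plus the frequency of codes at least [C].
    The latter is the complement of finitely many one-letter patterns and tends to [q ^ C]. *)
Lemma cvg_late (R : realType) (q : R) b : 0 <= q -> q < 1 -> regular q b ->
  ((late b n)%:R / n%:R : R) @[n --> \oo] --> (0 : R).
Proof.
move=> q0 q1 [db freq]; apply/cvgrPdist_le => e e0.
have e2 : 0 < e / 2 by lra.
have [C hC] := expr_small q0 q1 e2.
pose u n : R := C%:R / n%:R + (1 - \sum_(a <- iota 0 C)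
  (count (occ (colcode b) [:: a]) (iota 0 n))%:R / n%:R).
have cu : u n @[n --> \oo] --> q ^+ C.
  have -> : q ^+ C = 0 + (1 - \sum_(a <- iota 0 C) geo q [:: a]).
    rewrite add0r; elim: C {hC u} => [|C IH]; first by rewrite big_nil subr0.
    rewrite -(addn1 C) iotaD big_cat big_seq1 /= add0n opprD addrA -IH geo_cons geo_nil.
    by rewrite addn1 exprS; ring.
  apply: cvgD; first exact: cvg_div_nat.
  apply: cvgB; first exact: cvg_cst.
  by apply: cvg_sum_seq => a; apply: freq.
have le n : (0 < n)%N -> (late b n)%:R / n%:R <= u n.
  move=> n0; have n0R : 0 < n%:R :> R by rewrite ltr0n.
  have nn : n%:R != 0 :> R by rewrite gt_eqF.
  have cE : (count (fun v => (C <= colcode b v)%N) (iota 0 n) +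
     \sum_(a <- iota 0 C) count (occ (colcode b) [:: a]) (iota 0 n) = n)%N.
    rewrite -[RHS](size_iota 0 n) -(count_predC (fun v => (C <= colcode b v)%N)); congr addn.
    elim: C {hC u cu} => [|C IH].
      by rewrite big_nil; apply/esym/eqP; rewrite -leqn0 leqNgt -has_count; apply/hasPn.
    rewrite -(addn1 C) iotaD big_cat big_seq1 /= add0n IH -count_predUI.
    rewrite [X in (_ + X)%N](_ : _ = 0%N) ?addn0; last first.
      apply/eqP; rewrite -leqn0 leqNgt -has_count; apply/hasPn => v _ /=.
      by rewrite /occ /= addn0; lia.
    by apply: eq_count => v /=; rewrite /occ /= addn0; lia.
  rewrite ler_pdivrMr // /u -mulr_suml mulrDl divfK // mulrBl mul1r divfK //.
  rewrite -natr_sum; apply: (@le_trans _ _ (C + count (fun v => (C <= colcode b v)%N) (iota 0 n))%:R).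
    by rewrite ler_nat late_le.
  by rewrite natrD lerD2l lerBrDr -natrD cE.
move: cu => /cvgrPdist_le/(_ _ e2) [N _ hN].
exists N.+1 => // n /= hn; rewrite sub0r normrN ger0_norm ?divr_ge0 //.
have := hN n (ltnW hn); rewrite /= ler_norml => /andP[h1 h2].
by apply: (le_trans (le n ltac:(lia))); lra.
Qed.

(** The upper bound is the lower bound for vertices whose ball is not [H]: by [sum_spine], the
    blocks partition the [n] vertices. *)
Lemma bst_freq_lower (R : realType) (q : R) b r (V : finType) (e : rel V) (h : V)
    (K : seq (seq (seq nat))) eps : 0 <= q -> q < 1 -> regular q b -> 0 < eps ->
  uniq K -> all (windows r) K ->
  \forall n \near \oo,
    \sum_(d <- K) (block_num r e h d)%:R * geo q (pattern d) - eps <= bst_freq b n r e h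
    <= 1 - \sum_(d <- K) (block_size r d - block_num r e h d)%:R * geo q (pattern d) + eps.
Proof.
move=> q0 q1 reg e0 uK wK; have [db freq] := reg.
have cl := cvg_late q0 q1 reg.
(* The frequency of each pattern, minus the loss allowed by [count_occ_appeared]. *)
pose x (F : seq (seq nat) -> nat) n : R := \sum_(d <- K) (F d)%:R *
  ((count (occ (colcode b) (pattern d)) (iota 0 n))%:R / n%:R
   - (size (pattern d))%:R * ((late b n)%:R / n%:R + (size (pattern d))%:R / n%:R)).
have cx F : x F n @[n --> \oo] --> \sum_(d <- K) (F d)%:R * geo q (pattern d).
  apply: cvg_sum_seq => d; apply: cvgM; first exact: cvg_cst.
  rewrite -[X in _ --> X]subr0 -[X in _ --> _ - X](mulr0 (size (pattern d))%:R).
  apply: cvgB; first exact: freq.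
  apply: cvgM; first exact: cvg_cst.
  by rewrite -[X in _ --> X]addr0; apply: cvgD => //; apply: cvg_div_nat.
have key (F : seq (seq nat) -> nat) (f : nat -> nat) n : (0 < n)%N ->
  (forall d s, d \in K -> appeared b n (pattern d) s -> F d = f (nrec (ext_code b) s.+1 + r)%N) ->
  x F n <= (\sum_(k < size (spine (map Posz (Iseq b n)))) f k)%:R / n%:R.
  move=> n0 fE; rewrite ler_pdivlMr ?ltr0n // /x mulr_suml.
  apply: (le_trans (y := (\sum_(d <- K) F d * count (appeared b n (pattern d)) (iota 0 n))%:R)); last first.
    by rewrite ler_nat; apply: (sum_appeared_le e h db uK wK).
  rewrite natr_sum; apply: ler_sum => d _; rewrite natrM -mulrA ler_wpM2l //.
  have nn : n%:R != 0 :> R by rewrite gt_eqF // ltr0n.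
  have -> : ((count (occ (colcode b) (pattern d)) (iota 0 n))%:R / n%:R
   - (size (pattern d))%:R * ((late b n)%:R / n%:R + (size (pattern d))%:R / n%:R)) * n%:R
   = (count (occ (colcode b) (pattern d)) (iota 0 n))%:R
   - (size (pattern d))%:R * ((late b n)%:R + (size (pattern d))%:R) :> R by field.
  by rewrite lerBlDr -natrD -natrM -natrD ler_nat count_occ_appeared.
have [N1 _ hN1] : \forall n \near \oo, \sum_(d <- K) (block_num r e h d)%:R * geo q (pattern d) - eps
    <= x (block_num r e h) n.
  move: (cx (block_num r e h)) => /cvgrPdist_le/(_ _ e0); apply: filterS => n.
  by rewrite ler_norml => /andP[h1 h2]; lra.
have [N2 _ hN2] : \forall n \near \oo,
    \sum_(d <- K) (block_size r d - block_num r e h d)%:R * geo q (pattern d) - eps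
    <= x (fun d => block_size r d - block_num r e h d)%N n.
  move: (cx (fun d => block_size r d - block_num r e h d)%N) => /cvgrPdist_le/(_ _ e0).
  by apply: filterS => n; rewrite ler_norml => /andP[h1 h2]; lra.
exists (N1 + N2).+1 => // n /= hn.
have n0 : (0 < n)%N by lia.
have n0R : 0 < n%:R :> R by rewrite ltr0n.
have fE : bst_freq b n r e h = (\sum_(k < size (spine (map Posz (Iseq b n))))
    block_count (spineBST (map Posz (Iseq b n))) r e h k (nth [::] (spine (map Posz (Iseq b n))) k))%:R
    / n%:R :> R.
  by rewrite /bst_freq BST_Pi_n count_ball_BST.
have un : uniq (map Posz (Iseq b n)).
  have [xs _] := present_Iseq n db.
  by apply: (sorted_uniq _ _ xs) => [y u v uy yv|u]; [exact: lt_trans yv | exact: ltxx].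
apply/andP; split.
  rewrite fE; apply: (le_trans (hN1 n ltac:(rewrite /=; lia))).
  apply: (key _ (fun k : nat => block_count (spineBST (map Posz (Iseq b n))) r e h k
    (nth [::] (spine (map Posz (Iseq b n))) k))) => // d s dK a.
  by have [_ -> _] := appeared_match e h db (allP wK _ dK) a.
have := hN2 n ltac:(rewrite /=; lia).
pose f (k : nat) := ((size (nth [::] (spine (map Posz (Iseq b n))) k)).+1 -
    block_count (spineBST (map Posz (Iseq b n))) r e h k (nth [::] (spine (map Posz (Iseq b n))) k))%N.
have := key (fun d => block_size r d - block_num r e h d)%N f n n0.
move=> /(_ ltac:(by move=> d s dK a; rewrite /f;
   have [_ -> ->] := appeared_match e h db (allP wK _ dK) a)).
have -> : (\sum_(k < size (spine (map Posz (Iseq b n)))) f k)%:R / n%:R =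
    1 - bst_freq b n r e h :> R.
  rewrite fE /f sumnB; last first.
    move=> k _; rewrite (leq_trans (count_size _ _)) //= size_map //.
  rewrite sum_spine // size_map Iseq_size natrB; last first.
    rewrite [leqRHS](_ : n = \sum_(k < size (spine (map Posz (Iseq b n))))
      (size (nth [::] (spine (map Posz (Iseq b n))) k)).+1)%N; last first.
      by rewrite sum_spine // size_map Iseq_size.
    by apply: leq_sum => k _; rewrite (leq_trans (count_size _ _)) //= size_map.
  by rewrite mulrBl divff // gt_eqF.
lra.
Qed.

(** * The law of the codes of the two-sided permutation *)

Definition partition_fun (S : nat -> nat) : Prop :=
  (forall i, S i.+1 <= S i)%N /\ exists N, forall i, (N <= i)%N -> S i = 0%N.

Lemma partition_tail M : fin_supp M -> partition_fun (tail M).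
Proof. by move=> fM; split; [move=> i; apply: tail_le | apply: tail0]. Qed.

Lemma partition_remove S g : partition_fun S ->
  partition_fun (fun i => S (bump g i) + (i < g))%N.
Proof.
move=> [dec [N zN]]; split.
  move=> i; rewrite /bump; have := dec i; have := dec i.+1.
  by case: (ltngtP i.+1 g) => h; case: (ltnP i g) => h' /=; rewrite ?add0n ?add1n; lia.
by exists (N + g)%N => i hi; rewrite zN /bump; lia.
Qed.

Lemma partition_shifted g S u : partition_fun S -> partition_fun (shifted g S u).
Proof. by move=> pS; elim: u => //= u IH; apply: partition_remove. Qed.

(** For a partition and [N] large this is its size; identities between sizes are stated beyond a
    threshold. *)
Definition psum (S : nat -> nat) (N : nat) : nat := \sum_(i < N) S i.

(** The entry [S g] disappears and each of the [g] entries before it gains one. *)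
Lemma psum_remove S g N : (g <= N)%N -> S N = 0%N ->
  (S g + psum (fun i => S (bump g i) + (i < g)) N = g + psum S N)%N.
Proof.
move=> gN SN; rewrite /psum big_split /= addnA.
have -> : (S g + \sum_(i < N) S (bump g i) = \sum_(i < N.+1) S i)%N.
  by rewrite (bigD1_ord (Ordinal (gN : (g < N.+1)%N))).
rewrite big_ord_recr /= SN addn0 addnC; congr addn.
rewrite -(big_mkord xpredT (fun i => nat_of_bool (i < g)%N)) (big_cat_nat _ (n := g)) //=.
rewrite big_nat_cond (eq_bigr (fun=> 1%N)); last by move=> i; rewrite andbT => /andP[_ ->].
rewrite -big_nat_cond sum_nat_const_nat subn0 muln1.
rewrite big_nat_cond big1 ?addn0 // => i; rewrite andbT => /andP[gi _].
by rewrite ltnNge gi.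
Qed.

(* One step of the removal process is invertible, and preserves [g + |S| = a + |S'|]. *)
Lemma step_back a S' : partition_fun S' -> exists g0 S0, [/\ partition_fun S0,
  (forall g S, partition_fun S ->
    (S g = a /\ (forall i, S (bump g i) + (i < g) = S' i)%N) <->
    (g = g0 /\ forall i, S i = S0 i)) &
  exists N0, forall N, (N0 <= N)%N -> (g0 + psum S0 N = a + psum S' N)%N].
Proof.
move=> [dec [N zN]].
have ex : exists i, (S' i <= a)%N by exists N; rewrite zN.
have dec' i j : (i <= j)%N -> (S' j <= S' i)%N.
  move=> /subnKC <-; elim: (j - i)%N => [|k IH]; first by rewrite addn0.
  by rewrite addnS (leq_trans (dec _)).
(* Entries before the removed [a] were at least [a] and gained one; those after it are at most [a].
   So the skip is the number of entries of [S'] exceeding [a]. *)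
case: (ex_minnP ex) => g ga gmin.
have gP i : (a < S' i)%N = (i < g)%N.
  case: (ltnP i g) => h; first by rewrite ltnNge; apply/negP => /gmin; lia.
  by apply/negbTE; rewrite -leqNgt (leq_trans (dec' _ _ h)).
pose S0 i := if (i < g)%N then (S' i).-1 else if i == g then a else S' i.-1.
have pS0 : partition_fun S0.
  split.
    move=> i; rewrite /S0; have := dec i; have := gP i; have := gP i.+1; have := dec i.-1.
    case: (ltngtP i g) => h; case: (ltngtP i.+1 g) => h' //=; try lia.
    by rewrite prednK; lia.
  by exists (N + g).+1 => i hi; rewrite /S0 ifN ?ifN ?zN; lia.
have S0g : S0 g = a by rewrite /S0 ltnn eqxx.
have S0r i : (S0 (bump g i) + (i < g) = S' i)%N.
  rewrite /S0 /bump; have := gP i; case: (ltnP i g) => h /=; rewrite ?add0n ?h ?add1n.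
    by lia.
  by rewrite ifN ?ifN //=; lia.
exists g, S0; split=> //.
- move=> g1 S pS; split=> [[Sg Sr]|[-> SE]]; last first.
    by rewrite SE S0g; split=> // i; rewrite SE.
  have [decS _] := pS.
  have g1E : g1 = g.
    have h1 : (S' g1 <= a)%N by rewrite -Sr /bump leqnn ltnn /= add1n addn0 -Sg; apply: decS.
    have h2 := gmin _ h1; apply/eqP; rewrite eqn_leq h2 andbT leqNgt; apply/negP => lt.
    have := Sr g; rewrite /bump leqNgt lt /= add0n.
    have : (S g1 <= S g)%N.
      move: (ltnW lt) => /subnKC <-; elim: (g1 - g)%N => [|k IH]; first by rewrite addn0.
      by rewrite addnS (leq_trans (decS _)).
    by rewrite Sg; lia.
  split=> // i; rewrite g1E in Sg Sr.
  case: (eqVneq i g) => [->|ne]; first by rewrite Sg S0g.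
  have iE : i = bump g (unbump g i) by rewrite unbumpKcond (negbTE ne).
  by have := Sr (unbump g i); have := S0r (unbump g i); rewrite -iE; lia.
- have [_ [N1 z1]] := pS0.
  exists (g + N1)%N => M hM; rewrite -(psum_remove (g := g)) ?S0g; [|lia|by apply: z1; lia].
  by congr addn; apply: eq_bigr => i _.
Qed.

(** Undoing the steps from the last to the first: once the final partition is fixed, the codes and
    the initial data determine each other. *)
Lemma code_back al S' : partition_fun S' -> exists t S0,
  [/\ size t = size al, partition_fun S0,
  (forall g S, partition_fun S ->
    ((forall u, (u < size al)%N -> left_code g S u = nth 0%N al u) /\
      (forall i, shifted g S (size al) i = S' i)) <->
    ((forall u, (u < size al)%N -> g u = nth 0%N t u) /\ forall i, S i = S0 i)) &
  exists N0, forall N, (N0 <= N)%N -> (sumn t + psum S0 N = sumn al + psum S' N)%N].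
Proof.
elim/last_ind: al S' => [|al a IH] S' pS'.
  exists [::], S'; split=> //; last by exists 0%N.
  by move=> g S pS /=; split=> -[_ h]; split.
have [g0 [S1 [pS1 hS1 [N1 w1]]]] := step_back a pS'.
have [t [S0 [st pS0 hS0 [N0 w0]]]] := IH S1 pS1.
have ltS u : (u < (size al).+1)%N -> (u < size al)%N \/ u = size al by lia.
exists (rcons t g0), S0; split=> //.
- by rewrite !size_rcons st.
- move=> g S pS; rewrite size_rcons.
  have pU := partition_shifted g (size al) pS.
  have h1 := hS1 (g (size al)) _ pU; have h0 := hS0 g S pS.
  split=> -[hu hi].
    have [] := h1.1.
      split; last exact: hi.
      by have := hu _ (ltnSn _); rewrite nth_rcons ltnn eqxx.
    move=> gE SE; have [] := h0.1.
      split=> // u ul; have := hu u (ltnW ul); rewrite nth_rcons ul //.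
    move=> gu Si; split=> // u /ltS[ul|->]; rewrite nth_rcons st; first by rewrite ul gu.
    by rewrite ltnn eqxx.
  have [] := h0.2.
    split=> // u ul; have := hu u (ltnW ul); rewrite nth_rcons st ul //.
  move=> lu si; have [] := h1.2.
    split=> //; have := hu _ (ltnSn _); rewrite nth_rcons st ltnn eqxx //.
  move=> lc sh; split=> // u /ltS[ul|->]; rewrite nth_rcons; first by rewrite ul lu.
  by rewrite ltnn eqxx.
- exists (N0 + N1)%N => N hN; rewrite !sumn_rcons.
  by have := w0 N ltac:(lia); have := w1 N ltac:(lia); lia.
Qed.

Definition mult (S : nat -> nat) (i : nat) : nat := (S i.-1 - S i)%N.

Lemma tail_mult M S : fin_supp M -> partition_fun S ->
  (forall i, tail M i = S i) <-> (forall i, (0 < i)%N -> M i = mult S i).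
Proof.
move=> fM [dec [N zN]]; split=> h.
  by case=> // i _; rewrite /mult /= -!h (tailS i fM) addnK.
have [N' zN'] := tail0 fM.
move=> i; have [k] := ubnP (N + N' - i)%N; elim: k i => // k IH i hk.
case: (leqP (N + N')%N i) => hi; first by rewrite zN ?zN'; lia.
rewrite tailS // IH; last by lia.
by rewrite h // /mult /=; have := dec i; lia.
Qed.

(** Summation by parts. When [S] is the conjugate partition, [mult S i] is the number of parts equal
    to [i], so the powers of [q] in the law of the [M i] multiply to [q ^ psum S N]. *)
Lemma sum_mult S N : (forall i, S i.+1 <= S i)%N ->
  (\sum_(i <- iota 1 N) i * mult S i + N * S N = psum S N)%N.
Proof.
move=> dec; rewrite /psum; elim: N => [|N IH]; first by rewrite big_nil big_ord0.
have -> : iota 1 N.+1 = iota 1 N ++ [:: N.+1] by rewrite -(addn1 N) iotaD /= add1n addn1.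
rewrite big_ord_recr /= -IH big_cat big_seq1 /= /mult /=.
by have := dec N; nia.
Qed.

Lemma mult_inj S S' : partition_fun S -> partition_fun S' ->
  (forall i, (0 < i)%N -> mult S i = mult S' i) -> forall i, S i = S' i.
Proof.
move=> [dec [N zN]] [dec' [N' zN']] h i.
have [k] := ubnP (N + N' - i)%N; elim: k i => // k IH i hk.
case: (leqP (N + N')%N i) => hi; first by rewrite zN ?zN'; lia.
have E := IH i.+1 ltac:(lia).
by have := h i.+1 isT; have := dec i; have := dec' i; rewrite /mult /=; lia.
Qed.

(* No trailing 0, so that a partition is represented by exactly one sequence. *)
Definition canon (s : seq nat) : bool := last 1%N s != 0%N.

Lemma canon_exists S : partition_fun S -> exists2 s, canon s & forall i, nth 0%N s i = S i.
Proof.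
move=> [dec [N zN]]; have ex : exists n, S n == 0%N by exists N; rewrite zN.
case: (ex_minnP ex) => n /eqP Sn nmin; exists (mkseq S n).
  case: n Sn nmin => [|n] _ nmin //; rewrite /canon -nth_last size_mkseq /= nth_mkseq //.
  by apply/negP => /nmin; rewrite ltnn.
move=> i; case: (ltnP i n) => hi; first by rewrite nth_mkseq.
rewrite nth_default ?size_mkseq //; apply/esym/eqP; rewrite -leqn0 -Sn.
move: hi => /subnKC <-; elim: (i - n)%N => [|k IH]; first by rewrite addn0.
by rewrite addnS (leq_trans (dec _)).
Qed.

Lemma canon_inj s s' : canon s -> canon s' -> (forall i, nth 0%N s i = nth 0%N s' i) ->
  s = s'.
Proof.
have half u v : canon v -> (forall i, nth 0%N u i = nth 0%N v i) -> (size v <= size u)%N.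
  move=> cv E; rewrite leqNgt; apply/negP => lt; move: cv; rewrite /canon -nth_last.
  rewrite (set_nth_default 0%N) -?E ?nth_default //; lia.
move=> cs cs' E; apply: (@eq_from_nth _ 0%N) => //.
by apply/eqP; rewrite eqn_leq !half.
Qed.

Lemma geoE (R : realType) (q : R) t : geo q t = q ^+ sumn t * (1 - q) ^+ size t.
Proof.
elim: t => [|a t IH]; first by rewrite geo_nil mulr1.
by rewrite geo_cons IH /= exprD exprS; ring.
Qed.

(** * The joint law of the two arrays and the multiplicities *)

Section Joint.
Variables (d : measure_display) (T : measurableType d) (R : realType).
Variables (P : probability T R) (q : R) (Z : (nat * nat + nat * nat + nat) -> T -> nat).
Hypotheses (q0 : 0 <= q) (q1 : q < 1).
Hypotheses (mZ : nat_rv_family Z) (iZ : mutually_independent P Z).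
Hypothesis lp : forall ij, bernoulli_law P (1 - q) (Z (inl (inl ij))).
Hypothesis lm : forall ij, bernoulli_law P (1 - q) (Z (inl (inr ij))).
Hypothesis lM : forall (i m : nat), (1 <= i)%N ->
  P (Z (inr i) @^-1` [set m]) = (q ^+ (i * m) * (1 - q ^+ i))%:E.

Let bp (w : T) (i j : nat) : bool := Z (inl (inl (i, j))) w != 0%N.
Let bm (w : T) (i j : nat) : bool := Z (inl (inr (i, j))) w != 0%N.
Let MM (w : T) (i : nat) : nat := Z (inr i) w.

Definition joint_event be t m N : set T :=
  [set w | [/\ cyl be (bp w), cyl t (bm w) & forall i, (0 < i <= N)%N -> MM w i = m i]].

Lemma joint_eventE be t m N : joint_event be t m N =
  \bigcap_(k in [set` [seq inl (inl ij) | ij <- trials be] ++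
                      [seq inl (inr ij) | ij <- trials t] ++ [seq inr i | i <- iota 1 N]])
    (Z k @^-1` (match k with inl (inl ij) => bset be ij | inl (inr ij) => bset t ij
                | inr i => [set m i] end)).
Proof.
have e1 := cylE (fun ij => Z (inl (inl ij))) be.
have e2 := cylE (fun ij => Z (inl (inr ij))) t.
apply/seteqP; split=> w.
  move=> [c1 c2 hm] k; rewrite /= !mem_cat => /or3P[] /mapP[x xt ->].
  - have : [set w | cyl be (bp w)] w by []; rewrite /bp e1; exact.
  - have : [set w | cyl t (bm w)] w by []; rewrite /bm e2; exact.
  - by apply: hm; move: xt; rewrite mem_iota; lia.
move=> h; split.
- suff : [set w | cyl be (bp w)] w by [].
  rewrite /bp e1 => ij ijt; apply: (h (inl (inl ij))).
  by rewrite /= mem_cat map_f.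
- suff : [set w | cyl t (bm w)] w by [].
  rewrite /bm e2 => ij ijt; apply: (h (inl (inr ij))).
  by rewrite /= !mem_cat (map_f (fun ij => inl (inr ij))) ?orbT.
- move=> i hi; apply: (h (inr i)).
  by rewrite /= !mem_cat (map_f (fun i => inr i)) ?orbT // mem_iota; lia.
Qed.

Lemma measurable_joint be t m N : measurable (joint_event be t m N).
Proof. by rewrite joint_eventE; apply: measurable_bigcap_seq => k; apply: mZ. Qed.

Lemma prob_joint be t m N : P (joint_event be t m N) =
  (geo q be * geo q t * \prod_(i <- iota 1 N) (q ^+ (i * m i) * (1 - q ^+ i)))%:E.
Proof.
rewrite joint_eventE iZ; last first.
  rewrite !cat_uniq !map_inj_uniq ?uniq_trials ?iota_uniq //=; try by move=> ? ? [].
  apply/andP; split.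
    by apply/hasPn => k; rewrite mem_cat => /orP[] /mapP[x _ ->]; apply/mapP => -[].
  by rewrite andbT; apply/hasPn => k /mapP[x _ ->]; apply/mapP => -[].
rewrite !big_cat !big_map /=.
have mp : nat_rv_family (fun ij => Z (inl (inl ij))) by move=> ij A; apply: mZ.
have mm : nat_rv_family (fun ij => Z (inl (inr ij))) by move=> ij A; apply: mZ.
rewrite (prod_trials be mp lp) (prod_trials t mm lm).
rewrite big_seq (eq_bigr (fun i => (q ^+ (i * m i) * (1 - q ^+ i))%:E)); last first.
  by move=> i; rewrite mem_iota => hi; apply: lM; lia.
by rewrite -big_seq prod_EFin -!EFinM mulrA.
Qed.

Definition joint_lim be t m : set T := \bigcap_N joint_event be t m N.

Lemma measurable_joint_lim be t m : measurable (joint_lim be t m).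
Proof. by apply: bigcap_measurableType => N _; apply: measurable_joint. Qed.

Lemma joint_cvg be t m :
  P (joint_event be t m N) @[N --> \oo] --> P (joint_lim be t m).
Proof.
apply: nonincreasing_cvg_mu.
- by rewrite (le_lt_trans (probability_le1 P (measurable_joint _ _ _ _))) // ltry.
- by move=> N; apply: measurable_joint.
- exact: measurable_joint_lim.
- move=> a b ab; apply/subsetPset => w [c1 c2 h]; split=> // i hi; apply: h; lia.
Qed.

(** The infinite product of the [1 - q ^ i] stays hidden in the probability that all multiplicities
    vanish, which is kept as a common factor. *)
Lemma prob_joint_lim be t S N0 : partition_fun S -> (forall i, (N0 <= i)%N -> S i = 0%N) ->
  P (joint_lim be t (mult S)) =
  ((geo q be * geo q t * q ^+ psum S N0)%:E * P (joint_lim [::] [::] (fun=> 0%N)))%E.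
Proof.
move=> [dec _] z.
set c := geo q be * geo q t * q ^+ psum S N0.
have E N : (N0 <= N)%N ->
    P (joint_event be t (mult S) N) = (c%:E * P (joint_event [::] [::] (fun=> 0%N) N))%E.
  move=> hN; rewrite !prob_joint -EFinM !geo_nil; congr EFin.
  rewrite !mul1r -/c /c -!mulrA; congr (_ * (_ * _)).
  rewrite big_split /= [in RHS]big_split /=; rewrite mulrA; congr (_ * _).
  rewrite [X in _ * X]big1 ?mulr1; last by move=> i _; rewrite muln0 expr0.
  rewrite -expr_sum; congr (_ ^+ _).
  have := sum_mult N dec; rewrite z // muln0 addn0 => ->.
  rewrite /psum -(subnKC hN) big_split_ord /= [X in (_ + X)%N]big1 ?addn0 // => i _.
  by rewrite z //= leq_addr.
have h1 := @joint_cvg be t (mult S).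
have h2 : (c%:E * P (joint_event [::] [::] (fun=> 0%N) N))%E @[N --> \oo] -->
    (c%:E * P (joint_lim [::] [::] (fun=> 0%N)))%E.
  by apply: cvgeZl => //; apply: joint_cvg.
apply: (cvg_unique _ h1); first exact: ereal_hausdorff.
by apply: cvg_trans h2; apply: near_eq_cvg; exists N0 => // N /= hN; rewrite E.
Qed.

Lemma joint_limP be t m w : joint_lim be t m w <->
  [/\ cyl be (bp w), cyl t (bm w) & forall i, (0 < i)%N -> MM w i = m i].
Proof.
split=> [h|[c1 c2 hm] N _]; last by split=> // i /andP[i0 _]; apply: hm.
have [c1 c2 _] := h 0%N I; split=> // i i0.
by have [_ _] := h i I; apply; lia.
Qed.

Lemma cyl_iff t b : inf_ones b -> cyl t b <-> forall v, (v < size t)%N -> colcode b v = nth 0%N t v.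
Proof.
move=> db; split=> [c v|h]; first exact: cyl_code.
have -> : t = mkseq (colcode b) (size t); last exact: cyl_mkseq.
apply: (@eq_from_nth _ 0%N); rewrite ?size_mkseq // => i hi.
by rewrite nth_mkseq // h.
Qed.

(** Split according to the final partition [s]. By [code_back] and conservation of weight, each
    piece has probability [geo q al * geo q be] times that of starting from [s]. The latter events
    are disjoint, so their total mass is at most 1. *)
Lemma code_event al be : exists H : set T, [/\ measurable H,
  (P H <= (geo q al * geo q be)%:E)%E &
  forall w, inf_ones (bp w) -> inf_ones (bm w) -> fin_supp (MM w) ->
    (H w <-> (forall u, (u < size al)%N ->
                left_code (colcode (bm w)) (tail (MM w)) u = nth 0%N al u) /\
             (forall v, (v < size be)%N -> colcode (bp w) v = nth 0%N be v))].
Proof.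
have /choice[f fP] : forall s : seq nat, exists p : seq nat * (nat -> nat),
    partition_fun (nth 0%N s) ->
  [/\ size p.1 = size al, partition_fun p.2,
  (forall g S, partition_fun S ->
    ((forall u, (u < size al)%N -> left_code g S u = nth 0%N al u) /\
      (forall i, shifted g S (size al) i = nth 0%N s i)) <->
    ((forall u, (u < size al)%N -> g u = nth 0%N p.1 u) /\ forall i, S i = p.2 i)) &
  exists N0, forall N, (N0 <= N)%N ->
    (sumn p.1 + psum p.2 N = sumn al + psum (nth 0%N s) N)%N].
  move=> s; have [ps|nps] := pselect (partition_fun (nth 0%N s)); last by exists ([::], id).
  by have [t [S0 h]] := code_back al ps; exists (t, S0).
pose ok (s : seq nat) := canon s /\ partition_fun (nth 0%N s).
(* [F s] prescribes the initial data that produce the codes and end at [s]; [G s] says that the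
   initial partition is [s]. Canonical sequences make the family countable. *)
pose F s := if `[< ok s >] then joint_lim be (f s).1 (mult (f s).2) else set0.
pose G s := if `[< ok s >] then joint_lim [::] [::] (mult (nth 0%N s)) else set0.
pose F' n := if @pickle_inv (seq nat) n is Some s then F s else set0.
pose G' n := if @pickle_inv (seq nat) n is Some s then G s else set0.
have mF s : measurable (F s) by rewrite /F; case: asboolP => ? //; apply: measurable_joint_lim.
have mG s : measurable (G s) by rewrite /G; case: asboolP => ? //; apply: measurable_joint_lim.
have mF' n : measurable (F' n) by rewrite /F'; case: pickle_inv.
have mG' n : measurable (G' n) by rewrite /G'; case: pickle_inv.
have FG s : P (F s) = ((geo q al * geo q be)%:E * P (G s))%E.
  rewrite /F /G; case: asboolP => [[cs ps]|?]; last by rewrite !measure0 mule0.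
  have [st pS0 _ [N0 w0]] := fP s ps.
  have [_ [N1 z1]] := pS0; have [_ [N2 z2]] := ps.
  rewrite (@prob_joint_lim be _ (f s).2 (N0 + N1 + N2)%N) //; last by move=> i hi; apply: z1; lia.
  rewrite (@prob_joint_lim [::] [::] (nth 0%N s) (N0 + N1 + N2)%N) //; last by move=> i hi; apply: z2; lia.
  rewrite muleA -EFinM !geo_nil !mul1r; congr (_%:E * _)%E.
  rewrite (geoE q (f s).1) (geoE q al) st.
  have := w0 (N0 + N1 + N2)%N ltac:(lia) => E.
  transitivity (geo q be * (1 - q) ^+ size al * q ^+ (sumn (f s).1 + psum (f s).2 (N0 + N1 + N2))).
    by rewrite exprD; ring.
  by rewrite E exprD; ring.
have FG' n : P (F' n) = ((geo q al * geo q be)%:E * P (G' n))%E.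
  by rewrite /F' /G'; case: pickle_inv => [s|]; [apply: FG | rewrite !measure0 mule0].
have c0 : 0 <= geo q al * geo q be by rewrite mulr_ge0 ?geo_ge0.
have GP s w : G s w -> ok s /\ forall i, (0 < i)%N -> MM w i = mult (nth 0%N s) i.
  by rewrite /G; case: asboolP => // oks /joint_limP[].
have tG : trivIset setT G'.
  move=> m n _ _ [w [Gm Gn]].
  rewrite /G' in Gm Gn.
  case Em : (@pickle_inv (seq nat) m) Gm => [s|//] Gm.
  case En : (@pickle_inv (seq nat) n) Gn => [s'|//] Gn.
  have [[cs ps] hs] := GP _ _ Gm; have [[cs' ps'] hs'] := GP _ _ Gn.
  have ss' : s = s'.
    by apply: canon_inj => //; apply: mult_inj => // i i0; rewrite -hs // -hs'.
  have := @pickle_invK (seq nat) m; have := @pickle_invK (seq nat) n.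
  by rewrite Em En /= ss' => -> ->.
have mUG : measurable (\bigcup_n G' n) by apply: bigcup_measurable.
exists (\bigcup_n F' n); split.
- exact: bigcup_measurable.
- have mU : measurable (\bigcup_n F' n) by apply: bigcup_measurable.
  apply: (le_trans (measure_sigma_subadditive P mF' mU (@subset_refl _ _))).
  rewrite (eq_eseriesr (g := fun n => (geo q al * geo q be)%:E * P (G' n))%E); last by move=> n _; apply: FG'.
  rewrite nneseriesZl // -(measure_semi_bigcup P mG' tG mUG).
  by rewrite -[leRHS]mule1; apply: lee_wpmul2l; rewrite ?lee_fin // probability_le1.
move=> w dp dm fM; have pT := partition_tail fM; split.
- move=> [n _]; rewrite /F'; case: pickle_inv => [s|//]; rewrite /F.
  case: asboolP => // -[cs ps] /joint_limP[c1 c2 hm].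
  have [st pS0 hback _] := fP s ps.
  split; last by move=> v hv; apply: cyl_code.
  have [] := (hback (colcode (bm w)) _ pT).2; last by [].
  split; first by move=> u hu; apply: cyl_code => //; rewrite st.
  exact/(tail_mult fM pS0).
- move=> [hal hbe].
  have [s cs sE] := canon_exists (partition_shifted (colcode (bm w)) (size al) pT).
  have ps : partition_fun (nth 0%N s).
    have -> : nth 0%N s = shifted (colcode (bm w)) (tail (MM w)) (size al) by apply/funext.
    exact: partition_shifted.
  have [st pS0 hback _] := fP s ps.
  have [|gt SE] := (hback (colcode (bm w)) _ pT).1; first by split.
  exists (pickle s) => //; rewrite /F' pickleK_inv /F; case: asboolP => [?|[]//].
  apply/joint_limP; split.
  + exact/(cyl_iff _ dp).
  + by apply/(cyl_iff _ dm) => v; rewrite st; apply: gt.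
  + exact/(tail_mult fM pS0).
Qed.

Lemma match_event r dd s0 : windows r dd -> centered r dd s0 -> exists H : set T,
  [/\ measurable H, (P H <= (geo q (pattern dd))%:E)%E &
  forall w, inf_ones (bp w) -> inf_ones (bm w) -> fin_supp (MM w) ->
    (H w <-> matches (code2 (bp w) (bm w) (MM w)) dd s0)].
Proof.
move=> /andP[/eqP sd nz] /andP[c1 c2].
(* The window meets the nonpositive values in [s0, ..., 0]. [left_code] lists them from 0 downwards,
   hence the reversal, which [geo] does not see. *)
pose U := `|s0|%N.+1.
have s0le : s0 <= 0 by move: c1; rewrite /offset; lia.
have UL : (U <= size (pattern dd))%N.
  have : (size (pat (take r.+1 dd)) <= size (pat dd))%N.
    by rewrite -{2}(cat_take_drop r.+1 dd) pat_cat size_cat leq_addr.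
  by move: c2; rewrite /offset /pattern /= /U; lia.
have [H [mH PH HP]] := code_event (rev (take U (pattern dd))) (drop U (pattern dd)).
exists H; split=> //.
  apply: le_trans PH _; rewrite lee_fin -{3}(cat_take_drop U (pattern dd)) geo_cat.
  rewrite le_eqVlt; apply/orP; left; apply/eqP; congr (_ * _).
  by rewrite /geo; apply: perm_big; rewrite perm_rev.
move=> w dp dm fM; rewrite (HP w dp dm fM) size_rev size_takel // size_drop.
split=> [[hal hbe] i hi|m].
  rewrite /code2; case: ifPn => h.
    have -> : `|(s0 + i%:Z)%R|%N.-1 = (i - U)%N by rewrite /U; lia.
    by rewrite hbe ?nth_drop ?subnKC //; rewrite /U; lia.
  have hu : (`|(s0 + i%:Z)%R|%N < U)%N by rewrite /U; lia.
  rewrite hal // nth_rev size_takel //.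
  have -> : (U - `|(s0 + i%:Z)%R|.+1)%N = i by rewrite /U; lia.
  by rewrite nth_take //; rewrite /U; lia.
split=> [u hu|v hv].
  rewrite nth_rev size_takel // nth_take; last by lia.
  rewrite -m; last by lia.
  have E : s0 + (U - u.+1)%N%:Z = - u%:Z by rewrite /U in hu *; lia.
  by rewrite E /code2 ifN; [rewrite abszN absz_nat | rewrite -leNgt; lia].
rewrite nth_drop -m; last by lia.
have E : s0 + (U + v)%N%:Z = v.+1%:Z by rewrite /U; lia.
by rewrite E.
Qed.

(** Borel-Cantelli: [M i] is nonzero with probability [q ^ i]. *)
Lemma ae_fin_supp : {ae P, forall w, fin_supp (MM w)}.
Proof.
pose F n := Z (inr n.+1) @^-1` [set~ 0%N].
have mF n : measurable (F n) by apply: mZ.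
have PF n : P (F n) = (q / (1 - q) * (q ^+ n * (1 - q)))%:E.
  have -> : F n = ~` (Z (inr n.+1) @^-1` [set 0%N]) by [].
  rewrite probability_setC; last exact: mZ.
  rewrite lM // muln0 expr0 mul1r -EFinB; congr EFin.
  have : 1 - q != 0 by rewrite subr_eq0 gt_eqF.
  by move=> h; rewrite exprS; field.
exists (lim_sup_set F); split.
- apply: bigcap_measurableType => n _; exact: bigcup_measurable.
- apply: lim_sup_set_cvg0 => //; rewrite (eq_eseriesr (fun n _ => PF n)).
  by rewrite geometric_total ?ltry // divr_ge0 // subr_ge0 ltW.
move=> w /= nf n _; apply: contrapT => nb; apply: nf; exists n => j hj.
apply: contrapT => nz; apply: nb; exists j.-1 => /=; first by lia.
by rewrite /F /= prednK //; lia.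
Qed.

End Joint.

(** * The expectation over the two-sided model *)

(* No measurability is required: the integral of a nonnegative function is a supremum over
   the simple functions below it. *)
Lemma ge0_le_integral_nonmeasurable d (T : measurableType d) (R : realType)
    (P : probability T R) (f g : T -> R) :
  (forall w, 0 <= f w) -> (forall w, f w <= g w) ->
  (\int[P]_w (f w)%:E <= \int[P]_w (g w)%:E)%E.
Proof.
move=> f0 fg; rewrite !ge0_integralE; last 2 first.
- by move=> w _; rewrite lee_fin (le_trans (f0 w)).
- by move=> w _; rewrite lee_fin.
apply: le_ereal_sup => _ [s sf <-]; exists s => // w.
by apply: le_trans (sf w) _; rewrite !patch_setT lee_fin.
Qed.

(** Centring confines [s0] to [block_size r d] consecutive integers, one per place of the origin in
    the central block: this is the size bias. *)
Lemma centered_count r d (l : seq int) : windows r d -> uniq l ->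
  (forall s0, s0 \in l -> centered r d s0) -> (size l <= block_size r d)%N.
Proof.
move=> /andP[/eqP sd _] ul hl.
pose c := (size (pat (take r d)))%:Z.
rewrite -(size_iota 0 (block_size r d)) -(size_map (fun i : nat => - c - i%:Z)).
apply: uniq_leq_size => // s0 /hl; rewrite /centered offsetS ?sd; last by lia.
rewrite /offset -/c => h; apply/mapP; exists `|(s0 + c)%R|%N; last by lia.
by rewrite mem_iota /block_size; lia.
Qed.

(** A window [d] occurs at no more than [block_size r d] positions, which cancels the denominator
    due to the uniform root. *)
Lemma group_by_window (R : realType) (q : R) r (I : seq nat) (x : nat -> seq (seq nat) * int)
    (ee : nat -> R) (wt : seq (seq nat) -> R) :
  uniq I -> {in I &, injective x} ->
  (forall k, k \in I -> windows r (x k).1 /\ centered r (x k).1 (x k).2) ->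
  (forall k, k \in I -> ee k <= geo q (pattern (x k).1)) -> 0 <= q -> q < 1 ->
  (forall d, 0 <= wt d) ->
  \sum_(k <- I) ee k * (wt (x k).1 / (block_size r (x k).1)%:R) <=
  \sum_(d <- undup [seq (x k).1 | k <- I]) wt d * geo q (pattern d).
Proof.
move=> uI xI xw le_e q0 q1 wt0; set K := undup _.
have -> : \sum_(k <- I) ee k * (wt (x k).1 / (block_size r (x k).1)%:R) =
    \sum_(d <- K) \sum_(k <- I | (x k).1 == d) ee k * (wt d / (block_size r d)%:R).
  rewrite (exchange_big_dep xpredT) //= big_seq [RHS]big_seq; apply: eq_bigr => k kI.
  have dK : (x k).1 \in K by rewrite mem_undup; apply: map_f.
  rewrite big_mkcond (bigD1_seq (x k).1) ?undup_uniq //= eqxx big1 ?addr0 // => d dx.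
  by rewrite eq_sym (negbTE dx).
rewrite big_seq [leRHS]big_seq; apply: ler_sum => d; rewrite mem_undup => /mapP[k0 k0I dE].
have bs0 : 0 < (block_size r d)%:R :> R by rewrite ltr0n.
rewrite -mulr_suml mulrA ler_pdivrMr // mulrC -mulrA ler_wpM2l //.
apply: (@le_trans _ _ (\sum_(k <- I | (x k).1 == d) geo q (pattern d))).
  rewrite big_seq_cond [leRHS]big_seq_cond; apply: ler_sum => k /andP[kI /eqP <-].
  exact: le_e.
rewrite big_const_seq iter_addr_0 -[_ *+ _]mulr_natr ler_wpM2l ?geo_ge0 // ler_nat.
rewrite -size_filter -(size_map (fun k => (x k).2)).
have [wd _] := xw _ k0I; rewrite -dE in wd.
apply: (centered_count wd).
  rewrite map_inj_in_uniq ?filter_uniq // => k k'; rewrite !mem_filter.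
  move=> /andP[/eqP kd kI] /andP[/eqP k'd k'I] E; apply: xI => //.
  by rewrite [x k]surjective_pairing [x k']surjective_pairing kd k'd E.
move=> s0 /mapP[k]; rewrite mem_filter => /andP[/eqP kd kI] ->.
by have [_] := xw k kI; rewrite kd.
Qed.

Lemma rooted_RW_prob_ge0 (R : realType) X r (V : finType) (e : rel V) (h : V) :
  0 <= rooted_RW_prob X r e h :> R.
Proof. by rewrite divr_ge0. Qed.

Lemma rooted_RW_prob_le1 (R : realType) X r (V : finType) (e : rel V) (h : V) :
  rooted_RW_prob X r e h <= 1 :> R.
Proof. by rewrite ler_pdivrMr ?ltr0n // mul1r ler_nat count_size. Qed.

Lemma rooted_RW_prob_two_sided (R : realType) bp bm M r (V : finType) (e : rel V) (h : V) :
  inf_ones bp -> inf_ones bm -> fin_supp M ->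
  let X := two_sided (Ival bp) (Ival bm) M in
  (exists d s0, [/\ windows r d, centered r d s0 & matches (code2 bp bm M) d s0]) /\
  (forall d s0, windows r d -> centered r d s0 -> matches (code2 bp bm M) d s0 ->
     rooted_RW_prob X r e h = (block_num r e h d)%:R / (block_size r d)%:R :> R).
Proof.
move=> dp dm fM X.
have spec : two_sided_spec (Ival bp) (Ival bm) M X.
  rewrite /X /two_sided; case: pselect => [H|nH]; first by case: (cid H).
  by case: nH; apply: two_sided_exists.
have [tau [tauK XK cod low]] := coded_two_sided dp dm fM spec.
have rr := record_rep_exists tauK XK cod low.
split; first exact: matches_exists rr.
by move=> d s0 wd cd md; apply: rooted_RW_prob_match md.
Qed.

Lemma two_sided_approx (R : realType) (q : R) (d : measure_display) (T : measurableType d)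
    (P : probability T R) (Z : (nat * nat + nat * nat + nat) -> T -> nat)
    r (V : finType) (e : rel V) (h : V) :
  0 <= q -> q < 1 -> nat_rv_family Z -> mutually_independent P Z ->
  (forall ij, bernoulli_law P (1 - q) (Z (inl (inl ij)))) ->
  (forall ij, bernoulli_law P (1 - q) (Z (inl (inr ij)))) ->
  (forall (i m : nat), (1 <= i)%N ->
    P (Z (inr i) @^-1` [set m]) = (q ^+ (i * m) * (1 - q ^+ i))%:E) ->
  let X := fun w => two_sided (Ival (fun i j => Z (inl (inl (i, j))) w != 0%N))
              (Ival (fun i j => Z (inl (inr (i, j))) w != 0%N)) (fun i => Z (inr i) w) in
  exists2 L : R, (\int[P]_w (rooted_RW_prob (R := R) (X w) r e h)%:E = L%:E)%E &
  forall eps, 0 < eps -> exists K, [/\ uniq K, all (windows r) K,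
    L - eps <= \sum_(dd <- K) (block_num r e h dd)%:R * geo q (pattern dd) &
    1 - L - eps <=
      \sum_(dd <- K) (block_size r dd - block_num r e h dd)%:R * geo q (pattern dd)].
Proof.
move=> q0 q1 mZ iZ lp lm lM X.
pose bp w i j := Z (inl (inl (i, j))) w != 0%N.
pose bm w i j := Z (inl (inr (i, j))) w != 0%N.
pose MM w i := Z (inr i) w.
pose f w : R := rooted_RW_prob (X w) r e h.
have f0 w : 0 <= f w by apply: rooted_RW_prob_ge0.
have f1 w : f w <= 1 by apply: rooted_RW_prob_le1.
have int1 : (\int[P]_w (1 : R)%:E = 1)%E.
  apply: etrans (integral_cst P measurableT _) _.
  by apply: etrans (congr1 (fun y => _ * y)%E (probability_setT P)) _; rewrite mule1.
have [L LE] : exists L, (\int[P]_w (f w)%:E = L%:E)%E.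
  have : (0 <= \int[P]_w (f w)%:E)%E by apply: integral_ge0 => w _; rewrite lee_fin.
  have : (\int[P]_w (f w)%:E <= 1)%E by rewrite -int1; apply: ge0_le_integral_nonmeasurable.
  by case: (\int[P]_w (f w)%:E)%E => [x _ _| |]; [exists x | |].
exists L; first exact: LE.
have ip : mutually_independent P (fun ij => Z (inl (inl ij))).
  by apply: (@mutually_independent_comp _ _ _ P _ _ Z (fun ij => inl (inl ij))) => // ? ? [].
have im : mutually_independent P (fun ij => Z (inl (inr ij))).
  by apply: (@mutually_independent_comp _ _ _ P _ _ Z (fun ij => inl (inr ij))) => // ? ? [].
have mp : nat_rv_family (fun ij => Z (inl (inl ij))) by move=> ij A; apply: mZ.
have mm : nat_rv_family (fun ij => Z (inl (inr ij))) by move=> ij A; apply: mZ.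
(* A measurable null set containing all bad outcomes; once it is removed, the identities below hold
   pointwise. *)
have [N [mN PN goodN]] := filterI (filterI (ae_inf_ones q0 q1 mp ip lp)
  (ae_inf_ones q0 q1 mm im lm)) (ae_fin_supp q0 q1 mZ lM).
have good w : ~ N w -> [/\ inf_ones (bp w), inf_ones (bm w) & fin_supp (MM w)].
  by move=> nN; apply: contrapT => ng; apply: nN; apply: goodN => -[[? ?] ?]; apply: ng.
pose valid (x : seq (seq nat) * int) := windows r x.1 && `[< centered r x.1 x.2 >].
have /choice[H HP] : forall x, exists H : set T, [/\ measurable H,
    valid x -> (P H <= (geo q (pattern x.1))%:E)%E &
    valid x -> forall w, ~ N w -> (H w <-> matches (code2 (bp w) (bm w) (MM w)) x.1 x.2)].
  move=> x; have [/andP[wx /asboolP cx]|nv] := boolP (valid x); last first.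
    by exists set0; split.
  have [H [mH PH HP]] := match_event q0 q1 mZ iZ lp lm lM wx cx.
  by exists H; split=> // _ w /good[h1 h2 h3]; apply: HP.
pose xx n := odflt ([::], 0) (@pickle_inv (seq (seq nat) * int)%type n).
pose act n := (@pickle_inv (seq (seq nat) * int)%type n != None) && valid (xx n).
pose A n := if act n then H (xx n) `\` N else set0.
have mA n : measurable (A n).
  by rewrite /A; case: ifP => // _; apply: measurableD => //; have [] := HP (xx n).
(* Disjointness is forced rather than proved. This can only shrink the events, and only upper bounds
   on their probabilities are used. *)
pose E := seqDU A.
have mE n : measurable (E n) by apply: measurableD => //; apply: bigsetU_measurable.
have tE : trivIset setT E by apply: trivIset_seqDU.
have EA n w : E n w -> [/\ act n, ~ N w & H (xx n) w].
  by move=> [+ _]; rewrite /A; case: ifP => // _ [].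
pose phi n : R := (block_num r e h (xx n).1)%:R / (block_size r (xx n).1)%:R.
have fE n w : E n w -> f w = phi n.
  move=> /EA[/andP[_ vn] nN Hw]; have [g1 g2 g3] := good w nN.
  have [_ _ /(_ vn w nN)[/(_ Hw) mt _]] := HP (xx n).
  have [_ key] := rooted_RW_prob_two_sided R r e h g1 g2 g3.
  by case/andP: vn => wn /asboolP cn; apply: key wn cn mt.
(* Every good outcome matches some window, so the disjoint events have total mass 1. *)
have UE : \bigcup_n E n = ~` N.
  rewrite -seqDU_bigcup_eq; apply/seteqP; split=> w.
    by move=> [n _]; rewrite /A; case: ifP => // _ [].
  move=> nN; have [g1 g2 g3] := good w nN.
  have [[dd [s0 [wd cd md]]] _] := rooted_RW_prob_two_sided R r e h g1 g2 g3.
  have vx : valid (dd, s0) by rewrite /valid /= wd; apply/asboolP.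
  exists (pickle (dd, s0)) => //; rewrite /A /act /xx pickleK_inv /= vx; split=> //.
  by have [_ _ /(_ vx w nN)[_]] := HP (dd, s0); apply.
pose ee n : R := fine (P (E n)).
have eeE n : P (E n) = (ee n)%:E by rewrite /ee fineK // fin_num_measure.
have ee0 n : 0 <= ee n by rewrite /ee fine_ge0.
have sumE n : (\sum_(k < n) P (E k) = (\sum_(k < n) ee k)%:E)%E.
  by rewrite -sumEFin; apply: eq_bigr => k _.
have cvg1 : (\sum_(k < n) ee k) @[n --> \oo] --> (1 : R).
  have : (\sum_(0 <= k < n) P (E k))%E @[n --> \oo] --> (1 : R)%:E.
    have -> : (1 : R)%:E = (\sum_(0 <= k <oo) P (E k))%E.
      rewrite -(measure_semi_bigcup P mE tE); last by apply: bigcup_measurable.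
      by rewrite UE; apply/esym; apply: etrans (probability_setC P mN) _; rewrite PN sube0.
    by apply: is_cvg_nneseries => k _ _.
  move=> /fine_cvgP[_]; apply: cvg_trans; apply: near_eq_cvg; apply: nearW => n /=.
  by rewrite big_mkord sumE.
move=> eps eps0.
have [n hn] : exists n, 1 - eps <= \sum_(k < n) ee k.
  move: cvg1 => /cvgrPdist_le/(_ _ eps0)[n _ /(_ n (leqnn n))] /=.
  by rewrite ler_norml => /andP[h1 h2]; exists n; lra.
(* A simple function equal to [f] on [Un] and to 0 elsewhere. As [f] lies between 0 and 1 and [Un]
   has mass at least [1 - eps], it gives the integral of [f] up to [eps]. *)
pose s1 w : R := \sum_(k < n) phi k * \1_(E k) w.
pose Un := \big[setU/set0]_(k < n) E k.
have mUn : measurable Un by apply: bigsetU_measurable.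
have s1E w (j : 'I_n) : E j w -> s1 w = phi j.
  move=> Ew; rewrite /s1 (bigD1 j) //= indicE mem_set // mulr1 big1 ?addr0 // => k kj.
  rewrite indicE memNset ?mulr0 // => Ekw.
  have jk : j = k :> nat by apply: (tE j k I I); exists w.
  by move: kj; rewrite -val_eqE /= jk eqxx.
have s10 w : (forall j : 'I_n, ~ E j w) -> s1 w = 0.
  by move=> ne; rewrite /s1 big1 // => k _; rewrite indicE memNset ?mulr0.
have phi0 k : 0 <= phi k by rewrite divr_ge0.
have UnP w : Un w <-> exists j : 'I_n, E j w.
  rewrite /Un -bigcup_mkord; split=> [[k kn Ek]|[j Ej]]; last by exists j => //=.
  by exists (Ordinal (kn : (k < n)%N)).
have ints1 : (\int[P]_w (s1 w)%:E = (\sum_(k < n) phi k * ee k)%:E)%E.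
  rewrite /s1; under eq_integral do rewrite -sumEFin.
  rewrite ge0_integral_sum //; last 2 first.
  - move=> k; apply/measurable_EFinP; apply: measurable_funM; first exact: measurable_cst.
    exact: measurable_indic.
  - by move=> k w _; rewrite lee_fin mulr_ge0.
  rewrite -sumEFin; apply: eq_bigr => k _.
  under eq_integral do rewrite EFinM.
  rewrite ge0_integralZl_EFin //; last by apply/measurable_EFinP; apply: measurable_indic.
  rewrite integral_indic // setIT.
  by apply: etrans (congr1 (fun y => (phi k)%:E * y)%E (eeE k)) _; rewrite -EFinM.
have lowL : \sum_(k < n) phi k * ee k <= L.
  rewrite -lee_fin -ints1 -LE; apply: ge0_le_integral_nonmeasurable.
    by move=> w; apply: sumr_ge0 => k _; rewrite mulr_ge0.
  move=> w; have [/UnP[j Ej]|nU] := pselect (Un w); first by rewrite (s1E _ _ Ej) -(fE _ _ Ej).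
  by rewrite s10 // => j Ej; apply: nU; apply/UnP; exists j.
have upL : L <= \sum_(k < n) phi k * ee k + eps.
  rewrite -lee_fin -LE EFinD -ints1.
  apply: (@le_trans _ _ (\int[P]_w (s1 w + \1_(~` Un) w)%:E)%E).
    apply: ge0_le_integral_nonmeasurable => // w.
    have [/UnP[j Ej]|nU] := pselect (Un w).
      by rewrite (s1E _ _ Ej) -(fE _ _ Ej) lerDl.
    rewrite s10; last by move=> j Ej; apply: nU; apply/UnP; exists j.
    by rewrite indicE mem_set // add0r.
  under eq_integral do rewrite EFinD.
  rewrite ge0_integralD //; last 3 first.
  - by move=> w _; rewrite lee_fin; apply: sumr_ge0 => k _; rewrite mulr_ge0.
  - apply/measurable_EFinP; apply: measurable_sum => k.
    by apply: measurable_funM; [exact: measurable_cst | exact: measurable_indic].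
  - by apply/measurable_EFinP; apply: measurable_indic; apply: measurableC.
  apply: leeD => //; rewrite integral_indic //; last exact: measurableC.
  have PUn : P Un = (\sum_(k < n) ee k)%:E.
    by apply: etrans (measure_bigsetU P mE tE n) _; rewrite sumE.
  have : (P (~` Un) <= eps%:E)%E.
    by rewrite probability_setC // PUn -EFinB lee_fin; lra.
  by rewrite setIT.
pose I := [seq k <- iota 0 n | act k].
have uI : uniq I by rewrite filter_uniq ?iota_uniq.
have xI : {in I &, injective xx}.
  move=> k k'; rewrite !mem_filter => /andP[/andP[ak _] _] /andP[/andP[ak' _] _].
  rewrite /xx; have := @pickle_invK (seq (seq nat) * int)%type k.
  have := @pickle_invK (seq (seq nat) * int)%type k'.
  by case: pickle_inv ak => // y _; case: pickle_inv ak' => // y' _ /= <- <- ->.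
have xw k : k \in I -> windows r (xx k).1 /\ centered r (xx k).1 (xx k).2.
  by rewrite mem_filter => /andP[/andP[_ /andP[? /asboolP ?]] _].
have le_e k : k \in I -> ee k <= geo q (pattern (xx k).1).
  rewrite mem_filter => /andP[/andP[_ vk] _]; rewrite -lee_fin -eeE.
  have [mH /(_ vk) PH _] := HP (xx k); apply: le_trans PH.
  by apply: le_measure; rewrite ?inE // => w /EA[].
(* Indices that encode no valid window carry the empty event and drop out. *)
have sumI (F : nat -> R) : \sum_(k < n) F k * ee k = \sum_(k <- I) ee k * F k.
  rewrite /I big_filter -(big_mkord xpredT (fun k => F k * ee k)) /index_iota subn0.
  rewrite [RHS]big_mkcond; apply: eq_bigr => k _; case: ifPn => [_|na]; first by rewrite mulrC.
  suff -> : ee k = 0 by rewrite mulr0.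
  have -> : ee k = fine (P set0); last by rewrite measure0.
  by rewrite /ee; congr (fine (P _)); apply/seteqP; split=> // w /EA[]; rewrite (negbTE na).
exists (undup [seq (xx k).1 | k <- I]); split.
- exact: undup_uniq.
- by apply/allP => dd; rewrite mem_undup => /mapP[k /xw[wk _] ->].
- have := group_by_window uI xI xw le_e q0 q1 (wt := fun dd => (block_num r e h dd)%:R) ltac:(by []).
  by apply: le_trans; rewrite -sumI; lra.
- have := group_by_window uI xI xw le_e q0 q1
    (wt := fun dd => (block_size r dd - block_num r e h dd)%:R) ltac:(by []).
  apply: le_trans.
  rewrite -(sumI (fun k => (block_size r (xx k).1 - block_num r e h (xx k).1)%:R /
     (block_size r (xx k).1)%:R)).
  have -> : \sum_(k < n) (block_size r (xx k).1 - block_num r e h (xx k).1)%:R /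
     (block_size r (xx k).1)%:R * ee k = \sum_(k < n) ee k - \sum_(k < n) phi k * ee k.
    rewrite -sumrB; apply: eq_bigr => k _; rewrite natrB ?block_num_le // mulrBl divff.
      by rewrite mulrBl mul1r.
    by rewrite pnatr_eq0.
  lra.
Qed.

Theorem theorem1p1 (R : realType) (q : R) (hq0 : 0 <= q) (hq1 : q < 1)
  (* the infinite Bernoulli model on a probability space (Ω, P) *)
  (d : measure_display) (Ω : measurableType d) (P : probability Ω R)
  (B : nat * nat -> Ω -> nat)
  (hBm : nat_rv_family B)
  (hBind : mutually_independent P B)
  (hBlaw : forall ij, bernoulli_law P (1 - q) (B ij))
  (* ingredients of the two-sided Mallows permutation on (Ω', P'):
     Bernoulli arrays generating Π_+ and Π_-, and the variables M_i,
     all mutually independent *)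
  (d' : measure_display) (Ω' : measurableType d') (P' : probability Ω' R)
  (Z : (nat * nat + nat * nat + nat) -> Ω' -> nat)
  (hZm : nat_rv_family Z)
  (hZind : mutually_independent P' Z)
  (hBplaw : forall ij, bernoulli_law P' (1 - q) (Z (inl (inl ij))))
  (hBmlaw : forall ij, bernoulli_law P' (1 - q) (Z (inl (inr ij))))
  (hMlaw : forall (i m : nat), (1 <= i)%N ->
      P' (Z (inr i) @^-1` [set m]) = (q ^+ (i * m) * (1 - q ^+ i))%:E)
  (r : nat) (hr : (1 <= r)%N)
  (V : finType) (e : rel V) (h : V)
  (hesym : symmetric e) (heirr : irreflexive e) :
  let b := fun (w : Ω) (i j : nat) => B (i, j) w != 0%N in
  let X := fun w' : Ω' =>
    two_sided (Ival (fun i j => Z (inl (inl (i, j))) w' != 0%N))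
              (Ival (fun i j => Z (inl (inr (i, j))) w' != 0%N))
              (fun i => Z (inr i) w') in
  {ae P, forall w,
     ((bst_freq (R := R) (b w) n r e h)%:E) @[n --> \oo] -->
       (\int[P']_w' (rooted_RW_prob (R := R) (X w') r e h)%:E)%E}.
Proof.
move=> b X.
have [L -> approx] := two_sided_approx r e h hq0 hq1 hZm hZind hBplaw hBmlaw hMlaw.
apply: filterS (ae_regular hq0 hq1 hBm hBind hBlaw) => w reg.
apply: cvg_EFin; first exact: nearW.
apply/cvgrPdist_le => eps eps0.
have eps2 : 0 < eps / 2 by lra.
(* [h1] will bound the frequency from below and [h2] from above; half of [eps] goes to the choice of
   [K], half to the limit in [n]. *)
have [K [uK wK h1 h2]] := approx _ eps2.
have := bst_freq_lower e h hq0 hq1 reg eps2 uK wK.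
apply: filterS => n /andP[h3 h4] /=.
by rewrite ler_norml; apply/andP; split; lra.
Qed.
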